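(* Let $n\ge1$ and let the coefficient ring $\mathbb{K}$ of the Hecke algebra $\mathcal{H}_n$ contain $Q^{-1}$ and the rational numbers. Then the set of elements $\{\mathcal{N}_\lambda(e_{\lambda^\natural})\}_\lambda$, $\lambda$ running over the partitions of $n$, is a basis of the center of $\mathcal{H}_n$. The transition matrix to the basis $\{\Gamma_\lambda\}$ is equal to the product $D^{-1}\cdot P2M\cdot D$, where $D$ is the diagonal matrix with entries $Q^{n-\ell(\lambda)}$. That is, for every partition $\lambda$ of $n$, $$\mathcal{N}_\lambda(e_{\lambda^\natural})=\sum_{\mu\vdash n}Q^{\ell(\lambda)-\ell(\mu)}\,P2M[\lambda,\mu]\,\Gamma_\mu .$$
   Context: $\mathbb{K}$ is a commutative ring containing an invertible element $q$; $Q=q-q^{-1}$. $\mathcal{H}_n$ is the $\mathbb{K}$-algebra generated by $T_1,\dots,T_{n-1}$ with relations $T_iT_{i+1}T_i=T_{i+1}T_iT_{i+1}$, $T_iT_j=T_jT_i$ for $|i-j|>1$, and $T_i^2=QT_i+1$. For $w\in\mathfrak{S}_n$ with reduced word $s_{a_1}\cdots s_{a_l}$ ($s_i$ the transposition of $i,i+1$), $T_w=T_{a_1}\cdots T_{a_l}$; the $T_w$ form a $\mathbb{K}$-basis of $\mathcal{H}_n$. For a composition $I=[i_1,\dots,i_r]$ of $n$ (vector of positive integers of sum $n$), $\mathfrak{S}_I=\mathfrak{S}_{i_1}\times\cdots\times\mathfrak{S}_{i_r}\subset\mathfrak{S}_n$ is the Young subgroup and $\mathcal{H}(\mathfrak{S}_I)\cong\mathcal{H}_{i_1}\otimes\cdots\otimes\mathcal{H}_{i_r}$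 is the span in $\mathcal{H}_n$ of the $T_w$, $w\in\mathfrak{S}_I$. The normalization map is $$\mathcal{N}_I:\mathcal{H}(\mathfrak{S}_I)\to\mathcal{H}_n,\qquad \mathcal{N}_I(h)=\sum_{w\in\mathfrak{S}_n/\mathfrak{S}_I}T_w\,h\,T_{w^{-1}},$$ the sum being over the minimal length representatives $w$ of the left cosets $w\mathfrak{S}_I$. The Jucys--Murphy elements of $\mathcal{H}_m$ are $x_1=0$ and $x_j=\sum_{i<j}T_{(i,j)}$ for $2\le j\le m$, where $(i,j)$ is the transposition of $i$ and $j$. For a composition $I=[i_1,\dots,i_r]$ put $I^\natural=[i_1-1,\dots,i_r-1]$; then $e_{I^\natural}=e_{i_1-1}\times\cdots\times e_{i_r-1}\in\mathcal{H}(\mathfrak{S}_I)$ is the direct product of the elementary symmetric functions of degree $i_a-1$ in the Jucys--Murphy elements $x_1,\dots,x_{i_a}$ of the $a$-th factor $\mathcal{H}_{i_a}$; equivalently, it is the direct product of the elements $x_2x_3\cdots x_{i_a}$ (equal to $1$ if $i_a=1$) of the factors. $\Gamma_\lambda$ ($\lambda\vdash n$) is the Geck--Rouquier basis of the center of $\mathcal{H}_n$: over $\mathbb{Z}[Q]$ with $Q$ an indeterminate, $\Gamma_\lambda$ is the unique central element which specializes at $Q=0$ to the conjugacy class sum $\mathcal{C}_\lambda=\sum_w T_w$ ($w$ of cycle type $\lambda$), and such that the expansion of $\Gamma_\lambda-\mathcal{C}_\lambda$ in the basis $T_w$ involves no $w$ which is of minimal length in its conjugacy class of $\mathfrak{S}_n$;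 for general $\mathbb{K}$ one takes its image under $Q\mapsto q-q^{-1}$. $\ell(\lambda)$ is the number of parts of $\lambda$. $P2M$ is the matrix, indexed by partitions of $n$, defined by $p^\lambda=\sum_\mu P2M[\lambda,\mu]\,m_\mu$, where $p^\lambda=p_{\lambda_1}p_{\lambda_2}\cdots$ are products of power sums and $m_\mu$ are the monomial symmetric functions. *)

(* Defs.v *)
From HB Require Import structures.
From mathcomp Require Import all_boot all_order all_fingroup all_algebra.
From mathcomp Require Import generic_quotient boolp.
From mathcomp Require classical_sets.
From mathcomp Require Import mpoly.

Set Implicit Arguments.
Unset Strict Implicit.
Unset Printing Implicit Defensive.

Import GRing.Theory.

Local Open Scope quotient_scope.
Local Open Scope ring_scope.

Definition hecke_relations (R : comNzRingType) (Q : R) (n : nat)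
    (A : algType R) (t : 'I_n.-1 -> A) : Prop :=
  [/\ forall i j : 'I_n.-1, j = i.+1 :> nat -> t i * t j * t i = t j * t i * t j,
      forall i j : 'I_n.-1, (i.+1 < j)%N || (j.+1 < i)%N -> t i * t j = t j * t i
    & forall i : 'I_n.-1, t i ^+ 2 = Q *: t i + 1].

(* [hecke Q n] is the set of noncommutative polynomial expressions in the
   generators, modulo the least congruence containing the axioms of algebras
   and the relations of the presentation.  Generators are numbered from 0. *)
Inductive hterm (R : Type) (n : nat) : Type :=
  | HScal of R
  | HGen of 'I_n.-1
  | HAdd of hterm R n & hterm R n
  | HMul of hterm R n & hterm R n.

Arguments HScal {R n}.
Arguments HGen {R n}.

HB.instance Definition _ (R : Type) (n : nat) := gen_eqMixin (hterm R n).
HB.instance Definition _ (R : Type) (n : nat) := gen_choiceMixin (hterm R n).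

Inductive hequiv (R : comNzRingType) (Q : R) (n : nat) :
    hterm R n -> hterm R n -> Prop :=
  | heq_refl x : hequiv Q x x
  | heq_sym x y : hequiv Q x y -> hequiv Q y x
  | heq_trans x y z : hequiv Q x y -> hequiv Q y z -> hequiv Q x z
  | heq_add x x' y y' :
      hequiv Q x x' -> hequiv Q y y' -> hequiv Q (HAdd x y) (HAdd x' y')
  | heq_mul x x' y y' :
      hequiv Q x x' -> hequiv Q y y' -> hequiv Q (HMul x y) (HMul x' y')
  | heq_addA x y z : hequiv Q (HAdd x (HAdd y z)) (HAdd (HAdd x y) z)
  | heq_addC x y : hequiv Q (HAdd x y) (HAdd y x)
  | heq_add0 x : hequiv Q (HAdd (HScal 0) x) x
  | heq_addN x : hequiv Q (HAdd (HMul (HScal (-1)) x) x) (HScal 0)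
  | heq_mulA x y z : hequiv Q (HMul x (HMul y z)) (HMul (HMul x y) z)
  | heq_mul1 x : hequiv Q (HMul (HScal 1) x) x
  | heq_mulDl x y z :
      hequiv Q (HMul (HAdd x y) z) (HAdd (HMul x z) (HMul y z))
  | heq_mulDr x y z :
      hequiv Q (HMul x (HAdd y z)) (HAdd (HMul x y) (HMul x z))
  | heq_scalD a b : hequiv Q (HScal (a + b)) (HAdd (HScal a) (HScal b))
  | heq_scalM a b : hequiv Q (HScal (a * b)) (HMul (HScal a) (HScal b))
  | heq_scalC a x : hequiv Q (HMul (HScal a) x) (HMul x (HScal a))
  | heq_braid (i j : 'I_n.-1) : j = i.+1 :> nat ->
      hequiv Q (HMul (HMul (HGen i) (HGen j)) (HGen i))
               (HMul (HMul (HGen j) (HGen i)) (HGen j))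
  | heq_comm (i j : 'I_n.-1) : (i.+1 < j)%N || (j.+1 < i)%N ->
      hequiv Q (HMul (HGen i) (HGen j)) (HMul (HGen j) (HGen i))
  | heq_quad (i : 'I_n.-1) :
      hequiv Q (HMul (HGen i) (HGen i))
               (HAdd (HMul (HScal Q) (HGen i)) (HScal 1)).

Fixpoint heval (R S : comNzRingType) (f : R -> S) (n : nat) (A : algType S)
    (t : 'I_n.-1 -> A) (x : hterm R n) : A :=
  match x with
  | HScal a => (f a)%:A
  | HGen i => t i
  | HAdd x y => heval f t x + heval f t y
  | HMul x y => heval f t x * heval f t y
  end.

Lemma heval_equiv (R S : comNzRingType) (f : {rmorphism R -> S}) (Q : R)
    (n : nat) (A : algType S) (t : 'I_n.-1 -> A) (x y : hterm R n) :
  hecke_relations (f Q) t -> hequiv Q x y -> heval f t x = heval f t y.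
Proof.
move=> [tB tC tQ]; elim=> {x y} //=.
- by move=> x y z _ -> _ ->.
- by move=> x x' y y' _ -> _ ->.
- by move=> x x' y y' _ -> _ ->.
- by move=> x y z; rewrite addrA.
- by move=> x y; rewrite addrC.
- by move=> x; rewrite rmorph0 scale0r add0r.
- by move=> x; rewrite rmorphN rmorph1 scaleN1r mulN1r rmorph0 scale0r addNr.
- by move=> x y z; rewrite mulrA.
- by move=> x; rewrite rmorph1 scale1r mul1r.
- by move=> x y z; rewrite mulrDl.
- by move=> x y z; rewrite mulrDr.
- by move=> a b; rewrite rmorphD scalerDl.
- by move=> a b; rewrite rmorphM -scalerAl mul1r scalerA.
- by move=> a x; rewrite mulr_algl mulr_algr.
- by move=> i; rewrite rmorph1 scale1r mulr_algl -tQ expr2.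
Qed.

Section HeckeAlgebra.
Variables (R : comNzRingType) (Q : R) (n : nat).

Definition hequivb : rel (hterm R n) := fun x y => `[< hequiv Q x y >].

Lemma hequivb_refl : reflexive hequivb.
Proof. by move=> x; apply/asboolP/heq_refl. Qed.

Lemma hequivb_sym : ssrbool.symmetric hequivb.
Proof. by move=> x y; apply/asboolP/asboolP; exact: heq_sym. Qed.

Lemma hequivb_trans : transitive hequivb.
Proof. by move=> y x z /asboolP xy /asboolP yz; apply/asboolP/(heq_trans xy). Qed.

Canonical hequivb_equiv : equiv_rel (hterm R n) :=
  EquivRel hequivb hequivb_refl hequivb_sym hequivb_trans.

Definition hecke : Type := {eq_quot hequivb}.
HB.instance Definition _ : EqQuotient _ hequivb hecke := EqQuotient.on hecke.
HB.instance Definition _ := Choice.on hecke.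

Local Notation "\pic x" := (\pi_hecke x) (at level 0, x at level 0).

Lemma hecke_eqP (x y : hterm R n) : hequiv Q x y <-> \pic x = \pic y.
Proof.
split; first by move=> xy; apply/eqquotP/asboolP.
by move/eqquotP/asboolP.
Qed.

Lemma hecke_reprE (x : hterm R n) : hequiv Q (repr (\pic x)) x.
Proof. by apply/hecke_eqP; rewrite reprK. Qed.

Definition hscal (a : R) : hecke := \pic (HScal a).
Definition hgen (i : 'I_n.-1) : hecke := \pic (HGen i).
Definition hadd : hecke -> hecke -> hecke := lift_op2 hecke (@HAdd R n).
Definition hmul : hecke -> hecke -> hecke := lift_op2 hecke (@HMul R n).
Definition hopp (x : hecke) : hecke := hmul (hscal (-1)) x.
Definition hscale (a : R) (x : hecke) : hecke := hmul (hscal a) x.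

Lemma haddE x y : hadd \pic x \pic y = \pic (HAdd x y).
Proof. by unlock hadd; apply/hecke_eqP; apply: heq_add; exact: hecke_reprE. Qed.

Lemma hmulE x y : hmul \pic x \pic y = \pic (HMul x y).
Proof. by unlock hmul; apply/hecke_eqP; apply: heq_mul; exact: hecke_reprE. Qed.

Local Ltac hlift :=
  repeat (elim/quotW => ?);
  rewrite /hopp /hscale /hscal ?(haddE, hmulE); apply/hecke_eqP.

Lemma haddA : associative hadd. Proof. hlift; exact: heq_addA. Qed.
Lemma haddC : commutative hadd. Proof. hlift; exact: heq_addC. Qed.
Lemma hadd0 : left_id (hscal 0) hadd. Proof. hlift; exact: heq_add0. Qed.
Lemma haddN : left_inverse (hscal 0) hopp hadd.
Proof. hlift; exact: heq_addN. Qed.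
Lemma hmulA : associative hmul. Proof. hlift; exact: heq_mulA. Qed.
Lemma hmul1 : left_id (hscal 1) hmul. Proof. hlift; exact: heq_mul1. Qed.
Lemma hmul1r : right_id (hscal 1) hmul.
Proof.
hlift; apply: heq_trans (heq_mul1 _ _); apply: heq_sym; exact: heq_scalC.
Qed.
Lemma hmulDl : left_distributive hmul hadd.
Proof. hlift; exact: heq_mulDl. Qed.
Lemma hmulDr : right_distributive hmul hadd.
Proof. hlift; exact: heq_mulDr. Qed.

Lemma hscalD a b : hscal (a + b) = hadd (hscal a) (hscal b).
Proof. by rewrite /hscal haddE; apply/hecke_eqP/heq_scalD. Qed.
Lemma hscalM a b : hscal (a * b) = hmul (hscal a) (hscal b).
Proof. by rewrite /hscal hmulE; apply/hecke_eqP/heq_scalM. Qed.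
Lemma hscalC a x : hmul (hscal a) x = hmul x (hscal a).
Proof. move: x; hlift; exact: heq_scalC. Qed.

(* Nontriviality: [t_i |-> [[0, 1], [1, Q]]] is a representation over [R]. *)
Lemma hscal1_neq0 : hscal 1 != hscal 0.
Proof.
pose M : 'M[R]_2 := \matrix_(i, j)
  if (i == 0) && (j == 0) then 0 else if (i == 1) && (j == 1) then Q else 1.
have MQ : M ^+ 2 = Q *: M + 1.
  apply/matrixP => i j; rewrite !mxE !big_ord_recl big_ord0 !mxE.
  by case: i => [[|[|//]] ?]; case: j => [[|[|//]] ?]; rewrite /= ?mxE;
    rewrite -?val_eqE /= ?(mul0r, mulr0, mul1r, mulr1, addr0, add0r) //;
    rewrite addrC.
have rel : @hecke_relations R (idfun Q) n 'M[R]_2 (fun=> M) by split.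
apply/eqP => /hecke_eqP /(@heval_equiv _ _ idfun _ _ _ _ _ _ rel) /= /eqP.
by rewrite scale1r scale0r oner_eq0.
Qed.

HB.instance Definition _ :=
  GRing.isZmodule.Build hecke haddA haddC hadd0 haddN.
HB.instance Definition _ := GRing.Zmodule_isNzRing.Build hecke
  hmulA hmul1 hmul1r hmulDl hmulDr hscal1_neq0.

Lemma hscaleA a b x : hscale a (hscale b x) = hscale (a * b) x.
Proof. by rewrite /hscale hmulA hscalM. Qed.
Lemma hscale1 : left_id 1 hscale. Proof. exact: hmul1. Qed.
Lemma hscaleDr : right_distributive hscale +%R.
Proof. by move=> a x y; exact: hmulDr. Qed.
Lemma hscaleDl x : {morph hscale^~ x : a b / a + b}.
Proof. by move=> a b; rewrite /hscale hscalD hmulDl. Qed.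

HB.instance Definition _ := GRing.Zmodule_isLmodule.Build R hecke
  hscaleA hscale1 hscaleDr hscaleDl.

Lemma hscaleAl a (x y : hecke) : a *: (x * y) = (a *: x) * y.
Proof. exact: hmulA. Qed.

HB.instance Definition _ := GRing.Lmodule_isLalgebra.Build R hecke hscaleAl.

Lemma hscaleAr a (x y : hecke) : a *: (x * y) = x * (a *: y).
Proof.
suff -> : a *: (x * y) = hmul (hscal a) (hmul x y) by
  rewrite hmulA hscalC -hmulA.
by [].
Qed.

HB.instance Definition _ := GRing.Lalgebra_isAlgebra.Build R hecke hscaleAr.

Lemma hgen_relations : hecke_relations Q hgen.
Proof.
split=> [i j ij | i j ij | i].
- have wE a b c : hgen a * hgen b * hgen c
    = \pic (HMul (HMul (HGen a) (HGen b)) (HGen c)) by rewrite -!hmulE.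
  by rewrite !wE; apply/hecke_eqP/heq_braid.
- by apply: etrans (hmulE _ _) _; apply: etrans (esym (hmulE _ _));
    apply/hecke_eqP/heq_comm.
- rewrite expr2; apply: etrans (hmulE _ _) _.
  have -> : Q *: hgen i + 1
    = \pic (HAdd (HMul (HScal Q) (HGen i)) (HScal 1)) by rewrite -haddE -hmulE.
  by apply/hecke_eqP/heq_quad.
Qed.

End HeckeAlgebra.

(* The map [hecke Q n -> A] induced by a ring morphism [f : R -> S] and elements
   [t] of the [S]-algebra [A] satisfying the relations with parameter [f Q]. *)
Section HeckeLift.
Variables (R S : comNzRingType) (f : R -> S) (Q : R) (n : nat).
Variables (A : algType S) (t : 'I_n.-1 -> A).

Definition hecke_lift (x : hecke Q n) : A := heval f t (repr x).

End HeckeLift.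

Section HeckeLiftTheory.
Variables (R S : comNzRingType) (f : {rmorphism R -> S}) (Q : R) (n : nat).
Variables (A : algType S) (t : 'I_n.-1 -> A).
Hypothesis tR : hecke_relations (f Q) t.

Lemma hecke_lift_pi (x : hterm R n) :
  hecke_lift f t (\pi_(hecke Q n) x) = heval f t x.
Proof. exact/(heval_equiv tR)/hecke_reprE. Qed.

Lemma hecke_lift_gen i : hecke_lift f t (hgen Q i) = t i.
Proof. exact: hecke_lift_pi. Qed.

Lemma hecke_lift1 : hecke_lift f t (1 : hecke Q n) = 1.
Proof. by rewrite [LHS]hecke_lift_pi /= rmorph1 scale1r. Qed.

Lemma hecke_liftD : {morph @hecke_lift R S f Q n A t : x y / x + y}.
Proof.
elim/quotW => x; elim/quotW => y.
by rewrite [_ + _](haddE Q x y) !hecke_lift_pi.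
Qed.

Lemma hecke_liftM : {morph @hecke_lift R S f Q n A t : x y / x * y}.
Proof.
elim/quotW => x; elim/quotW => y.
by rewrite [_ * _](hmulE Q x y) !hecke_lift_pi.
Qed.

Lemma hecke_liftZ a (x : hecke Q n) :
  hecke_lift f t (a *: x) = f a *: hecke_lift f t x.
Proof.
elim/quotW: x => x; rewrite [_ *: _](hmulE Q (HScal a) x) !hecke_lift_pi /=.
by rewrite mulr_algl.
Qed.

Lemma hecke_lift_unique (g : hecke Q n -> A) :
    g 1 = 1 -> {morph g : x y / x + y} -> {morph g : x y / x * y} ->
    (forall a x, g (a *: x) = f a *: g x) -> (forall i, g (hgen Q i) = t i) ->
  g =1 hecke_lift f t.
Proof.
move=> g1 gD gM gZ gT; elim/quotW => x; rewrite hecke_lift_pi.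
elim: x => [a|i|x IHx y IHy|x IHx y IHy] /=; rewrite -?IHx -?IHy ?gT //.
- rewrite -g1 -gZ; congr g.
  by rewrite [RHS](hmulE Q (HScal a) (HScal 1)); apply/hecke_eqP;
    rewrite -[X in hequiv _ (HScal X)]mulr1; exact: heq_scalM.
- by rewrite -gD; congr g; rewrite [RHS](haddE Q x y).
- by rewrite -gM; congr g; rewrite [RHS](hmulE Q x y).
Qed.

End HeckeLiftTheory.

Section Words.
Variable n : nat.

Lemma sgen_subproof1 (i : 'I_n.-1) : (i < n)%N.
Proof. exact: leq_trans (ltn_ord i) (leq_pred n). Qed.

Lemma sgen_subproof2 (i : 'I_n.-1) : (i.+1 < n)%N.
Proof. by case: n i => [|m] i; [case: i | exact: ltn_ord]. Qed.

(* Products in ['S_n] are [(u * v) x = v (u x)]; the opposite convention amounts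
   to replacing every [w] by its inverse, which fixes the [sgen i]. *)
Definition sgen (i : 'I_n.-1) : 'S_n :=
  tperm (Ordinal (sgen_subproof1 i)) (Ordinal (sgen_subproof2 i)).

Definition word_perm (s : seq 'I_n.-1) : 'S_n := (\prod_(i <- s) sgen i)%g.

Lemma word_perm_surj (w : 'S_n) : exists s, word_perm s = w.
Proof.
have wM u v : (exists s, word_perm s = u) -> (exists s, word_perm s = v) ->
    exists s, word_perm s = (u * v)%g.
  by move=> [s <-] [s' <-]; exists (s ++ s'); rewrite /word_perm big_cat.
have wt d (i j : 'I_n) : j = (i + d.+1)%N :> nat ->
    exists s, word_perm s = tperm i j.
  elim: d i j => [|d IHd] i j ij.
    have lti : (i < n.-1)%N by have := ltn_ord j; rewrite ltn_predRL ij addn1.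
    exists [:: Ordinal lti]; rewrite /word_perm big_seq1 /sgen.
    by congr (tperm _ _); apply: val_inj; rewrite //= ij addn1.
  have ltk : (i + d.+1 < n)%N.
    by apply: leq_trans (ltn_ord j); rewrite ltnS ij leq_add2l.
  have ltk' : (i + d.+1 < n.-1)%N.
    by have := ltn_ord j; rewrite ltn_predRL ij addnS.
  pose k := Ordinal ltk; pose s := sgen (Ordinal ltk').
  have sE : s = tperm k j.
    by rewrite /s /sgen; congr (tperm _ _); apply: val_inj; rewrite //= ij -addnS.
  have -> : tperm i j = ((s * tperm i k) * s)%g.
    have ik : k != i by rewrite -val_eqE /= -[X in _ != X]addn0 eqn_add2l.
    have ij' : j != i by rewrite -val_eqE /= ij -[X in _ != X]addn0 eqn_add2l.
    rewrite sE -[X in (X * _ * _)%g]tpermV -mulgA -/(conjg _ _) tpermJ.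
    by rewrite tpermD // tpermL.
  have ws : exists s', word_perm s' = s.
    by exists [:: Ordinal ltk']; rewrite /word_perm big_seq1.
  by apply: (wM _ _ (wM _ _ ws _) ws); apply: IHd.
have [ts -> _] := prod_tpermP w.
elim: ts => [|[i j] ts IHts]; first by exists [::]; rewrite /word_perm !big_nil.
rewrite big_cons /=; apply: (wM) => //.
case: (ltngtP i j) => [ij|ji|/val_inj ->].
- by apply: (wt (j - i).-1); rewrite prednK ?subn_gt0 // subnKC // ltnW.
- rewrite tpermC; apply: (wt (i - j).-1).
  by rewrite prednK ?subn_gt0 // subnKC // ltnW.
- by exists [::]; rewrite tperm1 /word_perm big_nil.
Qed.

Lemma word_size_subproof (w : 'S_n) :
  exists l, [exists s : l.-tuple 'I_n.-1, word_perm s == w].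
Proof.
have [s sw] := word_perm_surj w.
by exists (size s); apply/existsP; exists (in_tuple s); apply/eqP.
Qed.

Definition plength (w : 'S_n) : nat := ex_minn (word_size_subproof w).

Lemma reduced_word_subproof (w : 'S_n) :
  exists s, (word_perm s == w) && (size s == plength w).
Proof.
rewrite /plength; case: ex_minnP => l /existsP[s /eqP sw] _.
by exists s; rewrite sw size_tuple !eqxx.
Qed.

(* Some reduced word of [w]; by Matsumoto's theorem [hT Q w] below does not
   depend on which one. *)
Definition reduced_word (w : 'S_n) : seq 'I_n.-1 :=
  xchoose (reduced_word_subproof w).

Definition min_in_class (w : 'S_n) : bool :=
  [forall v in (w ^: [set: 'S_n])%g, plength w <= plength v]%N.

Definition cycle_type (w : 'S_n) : seq nat :=
  sort geq [seq #|c| | c : {set 'I_n} <- enum (porbits w)].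

End Words.

Definition hT (R : comNzRingType) (Q : R) (n : nat) (w : 'S_n) : hecke Q n :=
  \prod_(i <- reduced_word w) hgen Q i.

Definition hcentral (R : comNzRingType) (Q : R) (n : nat) (z : hecke Q n) :=
  forall h : hecke Q n, z * h = h * z.

Section Young.
Variables (R : comNzRingType) (Q : R) (n : nat) (I : seq nat).

(* [reshape_index I j] is the number, from 0, of the block of the composition
   [I] of [n] which contains the position [j]. *)
Definition yblock (a : nat) : {set 'I_n} := [set j : 'I_n | reshape_index I j == a].

Definition young : {set 'S_n} :=
  [set w : 'S_n | [forall j : 'I_n, reshape_index I (w j) == reshape_index I j]].

Definition min_coset_rep (w : 'S_n) : bool :=
  [forall v in (w *: young)%g, plength w <= plength v]%N.

(* The formula makes sense for every [h]; the normalization map is its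
   restriction to the span of the [T_w], [w] in [young]. *)
Definition normalization (h : hecke Q n) : hecke Q n :=
  \sum_(w | min_coset_rep w) hT Q w * h * hT Q w^-1%g.

(* The Jucys-Murphy element, in the factor of the Young subalgebra given by
   the block of [j], of the position of [j] in that block. *)
Definition block_JM (j : 'I_n) : hecke Q n :=
  \sum_(i : 'I_n | (i < j)%N && (reshape_index I i == reshape_index I j))
    hT Q (tperm i j).

(* Factors are multiplied in increasing order of their indices. *)
Definition block_esym (a k : nat) : hecke Q n :=
  \sum_(A : {set 'I_n} | (A \subset yblock a) && (#|A| == k))
    \prod_(j in A) block_JM j.

Definition e_natural : hecke Q n :=
  \prod_(0 <= a < size I) block_esym a (nth 0%N I a).-1.

End Young.

Record intpart (n : nat) : Type := IntPart {
  intpart_bseq : n.-bseq 'I_n.+1;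
  _ : let s := map val intpart_bseq in
      [&& sorted geq s, 0 \notin s & sumn s == n]%N }.

HB.instance Definition _ (n : nat) := [isSub for @intpart_bseq n].
HB.instance Definition _ (n : nat) := [Countable of intpart n by <:].
HB.instance Definition _ (n : nat) := [Finite of intpart n by <:].

Coercion parts (n : nat) (la : intpart n) : seq nat := map val (intpart_bseq la).

(* Base change along a ring morphism [f] such that [f Q = Q']. *)
Definition hspec (R S : comNzRingType) (f : R -> S) (Q : R) (Q' : S) (n : nat) :
    hecke Q n -> hecke Q' n := hecke_lift f (@hgen S Q' n).

Definition class_sum (R : comNzRingType) (Q : R) (n : nat) (la : intpart n) :
    hecke Q n := \sum_(w : 'S_n | cycle_type w == la) hT Q w.

Definition is_geck_rouquier (n : nat) (la : intpart n)
    (g : hecke ('X : {poly int}) n) : Prop :=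
  [/\ hcentral g,
      hspec (horner_eval 0) 0 g = class_sum 0 la
    & exists c : {ffun 'S_n -> {poly int}},
        g - class_sum 'X la = \sum_w c w *: hT 'X w /\
        forall w, min_in_class w -> c w = 0].

(* [xget] makes this the element characterized by [is_geck_rouquier la]. *)
Definition geck_rouquier_univ (n : nat) (la : intpart n) :
    hecke ('X : {poly int}) n :=
  classical_sets.xget 0 (is_geck_rouquier la).

Definition geck_rouquier (R : comNzRingType) (Q : R) (n : nat) (la : intpart n) :
    hecke Q n :=
  hspec (fun p : {poly int} => (map_poly intr p).[Q]) Q (geck_rouquier_univ la).

(* Symmetric functions of degree [n] are represented by their images in [n]
   variables, which loses no information in that degree. *)
Definition psym (n : nat) (la : intpart n) : {mpoly int[n]} :=
  \prod_(k <- parts la) \sum_(i < n) 'X_i ^+ k.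

Definition msymf (n : nat) (mu : intpart n) : {mpoly int[n]} :=
  \sum_(m : 'X_{1..n < n.+1} | perm_eq [seq k <- bmnm m | 0 < k]%N mu) 'X_[m].

Definition part_mnm (n : nat) (mu : intpart n) : 'X_{1..n} :=
  [multinom nth 0%N mu i | i < n].

Definition p2m (n : nat) (la mu : intpart n) : int := (psym la)@_(part_mnm mu).

Section P2M.
Variable n : nat.
Implicit Types la mu nu : intpart n.

Lemma intpart_gt0 la k : k \in parts la -> (0 < k)%N.
Proof.
case: la => s sP; have /and3P[_ s0 _] := sP => ks.
by rewrite lt0n; apply: contraNneq s0 => <-.
Qed.

Lemma intpart_sorted la : sorted geq la.
Proof. by case: la => s sP; have /and3P[] := sP. Qed.

Lemma intpart_sum la : sumn la = n.
Proof. by case: la => s sP; have /and3P[_ _ /eqP] := sP. Qed.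

Lemma intpart_size la : (size la <= n)%N.
Proof. by rewrite size_map size_bseq. Qed.

Lemma parts_inj : injective (@parts n).
Proof.
move=> la mu lamu; apply/val_inj/val_inj/(inj_map val_inj).
exact: lamu.
Qed.

Lemma intpart_perm_eq la mu : perm_eq la mu = (la == mu).
Proof.
apply/idP/eqP => [lamu|->//]; apply/parts_inj.
apply: (sorted_eq _ _ (intpart_sorted la) (intpart_sorted mu) lamu).
- by move=> x y z /= xy zx; exact: leq_trans zx xy.
- by move=> x y /= /andP[xy yx]; apply/eqP; rewrite eqn_leq xy yx.
Qed.

Lemma part_mnmE mu : [seq k <- part_mnm mu | 0 < k]%N = mu.
Proof.
have -> : (part_mnm mu : seq nat) = mkseq (nth 0%N mu) n.
  apply: (@eq_from_nth _ 0%N) => [|i]; rewrite size_tuple ?size_mkseq // => lti.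
  by rewrite nth_mkseq // -(tnth_nth _ _ (Ordinal lti)) -mnm_tnth mnmE.
rewrite -[X in mkseq _ X](subnKC (intpart_size mu)) /mkseq iotaD map_cat filter_cat.
rewrite (_ : [seq _ | _ <- iota _ (n - _)] = nseq (n - size mu) 0%N).
  rewrite filter_nseq cats0 -/(mkseq _ _) mkseq_nth.
  by apply/all_filterP/allP => k; exact: intpart_gt0.
rewrite add0n; apply: (@eq_from_nth _ 0%N) => [|i]; rewrite size_map size_iota.
  by rewrite size_nseq.
move=> lti; rewrite (nth_map 0%N) ?size_iota // nth_iota // nth_nseq lti.
by apply: nth_default; exact: leq_addr.
Qed.

Lemma mdeg_sumn (m : 'X_{1..n}) : mdeg m = sumn m.
Proof. by rewrite sumnE. Qed.

Lemma sumn_pos (s : seq nat) : sumn [seq k <- s | 0 < k]%N = sumn s.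
Proof. by elim: s => //= -[|k] s IHs //=; rewrite IHs. Qed.

Lemma mdeg_part_mnm mu : mdeg (part_mnm mu) = n.
Proof. by rewrite mdeg_sumn -sumn_pos part_mnmE intpart_sum. Qed.

Lemma mnm_intpart (m : 'X_{1..n}) : mdeg m = n ->
  exists mu, perm_eq [seq k <- m | 0 < k]%N mu.
Proof.
move=> mn; pose s := sort geq [seq k <- m | 0 < k]%N.
have ps : perm_eq s [seq k <- m | 0 < k]%N by rewrite /s perm_sort.
have les k : k \in s -> (k < n.+1)%N.
  rewrite (perm_mem ps) mem_filter => /andP[_ /tnthP[i ->]].
  by rewrite ltnS -[leqRHS]mn mdegE (bigD1 i) //= mnm_tnth leq_addr.
have szs : (size s <= n)%N.
  rewrite (perm_size ps) size_filter; apply: leq_trans (count_size _ _) _.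
  by rewrite size_tuple.
pose t : seq 'I_n.+1 := pmap insub s.
have tE : map val t = s.
  rewrite /t; elim: (s) les => //= k r IHr ler.
  rewrite insubT /= ?ler ?mem_head // => lt; rewrite IHr // => x xr.
  by apply: ler; rewrite inE xr orbT.
have szt : (size t <= n)%N by rewrite -(size_map val) tE.
have Pt : let u := map val (Bseq szt) in
    [&& sorted geq u, 0 \notin u & sumn u == n]%N.
  rewrite /= tE; apply/and3P; split.
  - by apply: sort_sorted => x y; exact: leq_total.
  - by rewrite (perm_mem ps) mem_filter.
  - by rewrite (perm_sumn ps) sumn_pos -mdeg_sumn mn.
by exists (IntPart Pt); rewrite /parts /= tE perm_sym.
Qed.

Lemma mcoeff_msymf mu (m : 'X_{1..n}) : mdeg m = n ->
  (msymf mu)@_m = (perm_eq [seq k <- m | 0 < k]%N mu)%:R.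
Proof.
move=> mn; have ltm : (mdeg m < n.+1)%N by rewrite mn.
rewrite raddf_sum /= big_mkcond (bigD1 (BMultinom ltm)) //= mcoeffX eqxx.
rewrite big1 ?addr0; first by case: ifP.
move=> m' ne; case: ifP => // _; rewrite mcoeffX.
by rewrite bmeqP /= in ne; rewrite (negPf ne).
Qed.

Lemma mcoeff_msymf_neq0 mu (m : 'X_{1..n}) : mdeg m != n -> (msymf mu)@_m = 0.
Proof.
move=> mn; rewrite raddf_sum /= big1 // => m' m'mu; rewrite mcoeffX.
case: eqP => // mm'; case/eqP: mn.
by rewrite -mm' mdeg_sumn -sumn_pos (perm_sumn m'mu) intpart_sum.
Qed.

Lemma mcoeff_msymf_part mu nu : (msymf mu)@_(part_mnm nu) = (nu == mu)%:R.
Proof. by rewrite mcoeff_msymf ?mdeg_part_mnm // part_mnmE intpart_perm_eq. Qed.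

Lemma psym_sym la : psym la \is symmetric.
Proof.
rewrite rpred_prod // => k _; apply/issymP => s.
rewrite raddf_sum /= (reindex_inj (@perm_inj _ s^-1%g)) /=.
apply: eq_bigr => i _; rewrite rmorphXn /= msymX; congr ('X_[_] ^+ _).
apply/mnmP => j; rewrite mnmE !mnm1E -{1}(permKV s j); congr (nat_of_bool _).
by rewrite ?permKV ?permK (inj_eq perm_inj).
Qed.

Lemma psym_homog la : psym la \is n.-homog.
Proof.
suff homS (s : seq nat) : \prod_(k <- s) \sum_(i < n) 'X_i ^+ k
    \is [in int[n], (sumn s).-homog].
  by have := homS la; rewrite intpart_sum.
elim: s => [|k s IHs] /=; first by rewrite big_nil dhomog1.
rewrite big_cons; apply: dhomogM; last exact: IHs.
apply: rpred_sum => i _; have := @dhomogMn n int mdeg 1 'X_i k.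
by rewrite mul1n; apply; rewrite dhomogX /= mdeg1.
Qed.

(* The defining property of the matrix [p2m], which characterizes it. *)
Lemma psymE la : psym la = \sum_mu (p2m la mu)%:MP * msymf mu.
Proof.
apply/mpolyP => m; rewrite raddf_sum /=.
have [mn|mn] := eqVneq (mdeg m) n; last first.
  rewrite (dhomog_nemf_coeff (psym_homog la) mn) big1 // => mu _.
  by rewrite mcoeffCM mcoeff_msymf_neq0 ?mulr0.
have [mu pmu] := mnm_intpart mn.
rewrite (bigD1 mu) //= mcoeffCM mcoeff_msymf // pmu mulr1 big1 ?addr0; last first.
  move=> nu numu; rewrite mcoeffCM mcoeff_msymf // (permPl pmu) intpart_perm_eq.
  by rewrite eq_sym (negPf numu) mulr0.
have : perm_eq m (part_mnm mu).
  have pz (s : seq nat) : perm_eq s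
      ([seq k <- s | 0 < k]%N ++ nseq (size s - size [seq k <- s | 0 < k]%N) 0%N).
    rewrite -(perm_filterC (ltn 0) s) perm_cat2l.
    have -> : (size s - size [seq k <- s | 0 < k] =
               size [seq k <- s | predC (ltn 0) k])%N.
      by rewrite !size_filter -(count_predC (ltn 0) s) addKn.
    elim: s => //= -[|k] s IHs //=; by rewrite perm_cons.
  apply: (perm_trans (pz _)); rewrite perm_sym; apply: (perm_trans (pz _)).
  rewrite part_mnmE !size_tuple (perm_size pmu) perm_cat2r perm_sym.
  exact: pmu.
case/tuple_permP => s sE; rewrite /p2m -(msym_coeff (part_mnm mu) s (psym_sym la)).
congr (_@__); apply/mnmP => i; rewrite mnmE.
have -> : m = Multinom [tuple tnth (part_mnm mu) (s j) | j < n].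
  by apply/val_inj/val_inj.
by rewrite mnm_tnth tnth_mktuple mnm_tnth.
Qed.

Lemma p2m_unique la (c : intpart n -> int) :
  psym la = \sum_mu (c mu)%:MP * msymf mu -> c =1 p2m la.
Proof.
move=> cE nu; rewrite /p2m cE raddf_sum (bigD1 nu) //= mcoeffCM.
rewrite mcoeff_msymf_part eqxx mulr1 big1 ?addr0 // => mu numu.
by rewrite mcoeffCM mcoeff_msymf_part eq_sym (negPf numu) mulr0.
Qed.

End P2M.

(* Rows and columns are indexed by partitions through [enum_rank]. *)
Definition P2M (n : nat) : 'M[int]_#|{: intpart n}| :=
  \matrix_(a, b) p2m (enum_val a) (enum_val b).

Definition Qdiag (R : comNzRingType) (Q : R) (n : nat) : 'M[R]_#|{: intpart n}| :=
  diag_mx (\row_a Q ^+ (n - size (parts (enum_val a)))).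

Definition center_basis (R : comNzRingType) (Q : R) (n : nat) (I : finType)
    (b : I -> hecke Q n) : Prop :=
  (forall i, hcentral (b i)) /\
  forall z, hcentral z -> exists! c : {ffun I -> R}, z = \sum_i c i *: b i.

(* Main.v *)
(** Idea of the proof.  Write [g_i] for the generators, [tau h = coef h 1] for the
    symmetrizing trace and [gam] for the product of the Jucys-Murphy elements
    other than the first one of every block, that is [e_natural].

    A central element [z] is determined by the trace function [tau (z * _)], and
    [H / [H, H]] is spanned by the increasing words in the generators of the
    Young subgroups of the partitions: from [H_{m+1} = H_m + H_m g_m H_m] one
    rotates factors until the letters increase, and two compositions with the
    same parts give words conjugate by some [T_d].  So everything reduces to the
    numbers [tau (z * word mu)].

    For [z = N_la (gam)] one computes [sum_d tau (word mu * T_d * gam * T_d^-1)]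
    by letting the letters of [word mu] act one by one on [T_d].  The diagonal
    term survives only when the block numbers of [d] decrease weakly along the
    blocks of [mu]; each strict descent contributes a factor [Q], and each
    equality a generator of the Young subgroup of [la].  On words in distinct
    generators [tau (gam * _)] is 1 if all the generators occur and 0 otherwise.
    Hence the blocks of [la] remain intervals, each inside one block of [mu], and
    the surviving [d] correspond to the ways of merging the parts of [la] into
    the parts of [mu]; their number is [P2M la mu].

    This matrix is triangular for the number of parts, with positive integers on
    the diagonal.  Over [Z[Q]] this provides, up to an integer factor that can be
    cancelled, central elements dual to the words, which are the [Gamma_mu]; when
    the integers are invertible it shows that the [N_la (gam)] form a basis. *)

Require Import Defs.
From HB Require Import structures.
From mathcomp Require Import all_boot all_order all_fingroup all_algebra.
From mathcomp Require Import generic_quotient mpoly.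
From mathcomp Require Import zify ring.

Set Implicit Arguments.
Unset Strict Implicit.
Unset Printing Implicit Defensive.

Import GRing.Theory.
Local Open Scope ring_scope.

(** * Length and inversions *)

(** Permutations multiply from left to right: left multiplication by [sgen i] exchanges two adjacent
    positions, right multiplication by a Young subgroup moves values inside blocks. A minimal
    representative [d] is thus known from its word of block numbers [b (d x)], and [g_i] acts on
    [T_d] by comparing two adjacent letters of that word. Letters of a word act in increasing order,
    so a block number once changed at the lower position is never touched again, and the terms that
    left [T_d] need not be computed. The ring is arbitrary, so H/[H,H] is not formed: expansions
    modulo commutators are tested against all trace functions at once. The partition attached to a
    word is independent of the ring and of [Q]; cycle types can then be identified at [Q = 0] over
    the integers and used over Z[Q]. This also replaces the general theory of minimal length
    elements: it is enough that their reduced words have distinct letters. Over Z[Q] the elimination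
    yields only a multiple m Gamma; Gamma itself is written down by dual bases and inherits
    centrality because m is not a zero divisor. *)

Ltac liaif := repeat match goal with
  | |- context [if ?b then _ else _] =>
    lazymatch b with
    | context [if _ then _ else _] => fail
    | _ => let e := fresh in destruct b eqn:e
    end
  end; lia.

Section Inversions.
Variable n : nat.
Implicit Types (u v w : 'S_n) (i j : 'I_n.-1) (x y : 'I_n).

Definition lo i : 'I_n := Ordinal (sgen_subproof1 i).
Definition hi i : 'I_n := Ordinal (sgen_subproof2 i).

Lemma sgen_lo i : sgen i (lo i) = hi i. Proof. exact: tpermL. Qed.
Lemma sgen_hi i : sgen i (hi i) = lo i. Proof. exact: tpermR. Qed.

Lemma sgen_val i x :
  sgen i x = (if x == i :> nat then i.+1 else if x == i.+1 :> nat then i : nat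
              else x) :> nat.
Proof.
rewrite /sgen permE /= -!val_eqE /=.
by case: ifP => // _; case: ifP.
Qed.

Lemma sgen2 i : (sgen i * sgen i = 1)%g. Proof. exact: tperm2. Qed.
Lemma sgenV i : ((sgen i)^-1 = sgen i)%g. Proof. exact: tpermV. Qed.
Lemma sgenK i w : (sgen i * (sgen i * w) = w)%g.
Proof. by rewrite mulgA sgen2 mul1g. Qed.
Lemma sgenKr i w : (w * sgen i * sgen i = w)%g.
Proof. by rewrite -mulgA sgen2 mulg1. Qed.

(** Products compose from left to right, so an inversion between two adjacent positions is a left
    descent. *)
Definition desc w i := (w (hi i) < w (lo i))%N.

Lemma perm_neq w x y : (w x == w y :> nat) = (x == y :> nat).
Proof. by rewrite val_eqE (inj_eq perm_inj). Qed.

Lemma desc_sgen w i : desc (sgen i * w) i = ~~ desc w i.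
Proof.
rewrite /desc !permM sgen_lo sgen_hi -leqNgt.
by have := perm_neq w (lo i) (hi i); rewrite /=; lia.
Qed.

Lemma desc1 i : desc 1%g i = false.
Proof. by rewrite /desc !perm1 /=; lia. Qed.

Definition invs w : {set 'I_n * 'I_n} :=
  [set p : 'I_n * 'I_n | (p.1 < p.2)%N && (w p.2 < w p.1)%N].

(** The map [(x, y) |-> (s x, s y)] carries the inversions of [w] onto those of [s w] other than
    [(lo i, hi i)], which is new. *)
Lemma invs_sgen w i : ~~ desc w i -> #|invs (sgen i * w)| = #|invs w|.+1.
Proof.
rewrite /desc => dw; pose s := sgen i; pose F (p : 'I_n * 'I_n) := (s p.1, s p.2).
have injF : injective F.
  by move=> [x y] [x' y'] [/perm_inj -> /perm_inj ->].
rewrite -(card_imset (mem (invs w)) injF).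
have -> : invs (sgen i * w) = (lo i, hi i) |: [set F p | p in invs w].
  apply/setP => -[x y]; rewrite !inE /= !permM -/s.
  have sK : involutive s by move=> z; rewrite /s -permM sgen2 perm1.
  have -> : ((x, y) \in [set F p | p in invs w]) = ((s x, s y) \in invs w).
    rewrite -[RHS](mem_imset _ _ injF) /F /= !sK //.
  rewrite inE /= xpair_eqE; case: eqVneq => [-> | nx] /=.
    case: eqVneq => [-> | ny] /=.
      by rewrite /s sgen_lo sgen_hi; move: dw; have := perm_neq w (lo i) (hi i);
         rewrite /= ; lia.
    congr (_ && _).
    by rewrite /s !sgen_val /=; move: ny; rewrite -val_eqE /=; liaif.
  case: (boolP ((x == hi i) && (y == lo i))) => [/andP[/eqP -> /eqP ->]|nxy].
    by rewrite /s sgen_lo sgen_hi /=; move: dw; rewrite /=; lia.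
  congr (_ && _).
  by rewrite /s !sgen_val /=; move: nx nxy; rewrite -!val_eqE /=; liaif.
rewrite cardsU1; apply/eqP; rewrite -[in X in _ == X]add1n eqn_add2r eqb1.
apply/negP => /imsetP[[x y]]; rewrite inE /= => /andP[xy _] [].
move=> /(congr1 val) /= + /(congr1 val) /=.
by rewrite /s !sgen_val; liaif.
Qed.

Lemma invs_sgenN w i : desc w i -> #|invs w| = #|invs (sgen i * w)|.+1.
Proof.
by move=> dw; rewrite -{1}(sgenK i w) invs_sgen // desc_sgen dw.
Qed.

Lemma perm_incr_ge w : (forall x y, x < y -> w x < w y)%N ->
  forall x, (x <= w x)%N.
Proof.
move=> wi x; move: {2}(x : nat) (erefl (x : nat)) => k.
elim: k x => [|k IHk] x xk; first by rewrite xk.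
have lt : (k < n)%N by have := ltn_ord x; lia.
have := wi (Ordinal lt) x; rewrite /= xk => /(_ (ltnSn _)).
by have := IHk (Ordinal lt) erefl; rewrite /=; lia.
Qed.

(** An increasing permutation dominates the identity; so does its inverse, which is increasing
    too. *)
Lemma perm_incr_id w : (forall x y, x < y -> w x < w y)%N -> w = 1%g.
Proof.
move=> wi; apply/permP => x; rewrite perm1; apply/val_inj/eqP => /=.
rewrite eqn_leq perm_incr_ge // andbT.
rewrite -{2}(permK w x); apply: perm_incr_ge => {}x y xy.
rewrite ltnNge; apply/negP => yx.
have := perm_neq w^-1%g x y; case: ltngtP yx => // lt _.
  by have := wi _ _ lt; rewrite !permKV; lia.
by have := lt; lia.
Qed.

Lemma no_desc_id w : (forall i, ~~ desc w i) -> w = 1%g.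
Proof.
move=> wd; apply: perm_incr_id => x y xy.
have : (y = x + (y - x).-1.+1 :> nat)%N by lia.
move: (y - x).-1 => k; elim: k y {xy} => [|k IHk] y yE.
  have lt : (x < n.-1)%N by have := ltn_ord y; lia.
  have := wd (Ordinal lt); rewrite /desc.
  have -> : lo (Ordinal lt) = x by apply: val_inj.
  have -> : hi (Ordinal lt) = y by apply: val_inj => /=; lia.
  by have := perm_neq w x y; lia.
have lt : (x + k.+1 < n)%N by have := ltn_ord y; lia.
have lt' : (x + k.+1 < n.-1)%N by have := ltn_ord y; lia.
have := IHk (Ordinal lt) erefl.
have := wd (Ordinal lt'); rewrite /desc.
have -> : lo (Ordinal lt') = Ordinal lt by apply: val_inj.
have -> : hi (Ordinal lt') = y by apply: val_inj => /=; lia.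
by have := perm_neq w (Ordinal lt) y; rewrite /=; lia.
Qed.

Lemma word_perm_cons i s : word_perm (i :: s) = (sgen i * word_perm s)%g.
Proof. by rewrite /word_perm big_cons. Qed.
Lemma word_perm_nil : word_perm [::] = 1%g :> 'S_n.
Proof. by rewrite /word_perm big_nil. Qed.
Lemma word_perm_cat s t :
  word_perm (s ++ t) = (word_perm s * word_perm t)%g :> 'S_n.
Proof. by rewrite /word_perm big_cat. Qed.
Lemma word_perm_rev s : word_perm (rev s) = ((word_perm s)^-1)%g :> 'S_n.
Proof.
elim: s => [|i s IHs]; first by rewrite /rev /= word_perm_nil invg1.
rewrite rev_cons -cats1 word_perm_cat IHs !word_perm_cons word_perm_nil mulg1.
by rewrite invMg sgenV.
Qed.

Lemma invs1 : #|invs 1%g| = 0.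
Proof.
apply/eqP; rewrite cards_eq0; apply/eqP/setP => -[x y].
by rewrite !inE /= !perm1; lia.
Qed.

Lemma invs_word s : (#|invs (word_perm s)| <= size s)%N.
Proof.
elim: s => [|i s IHs] /=; first by rewrite word_perm_nil invs1.
rewrite word_perm_cons; case: (boolP (desc (word_perm s) i)) => d.
  by rewrite -ltnS -(invs_sgenN d) (leq_trans IHs) // leqW.
by rewrite invs_sgen.
Qed.

Lemma invs_wordP w : exists s, word_perm s = w /\ size s = #|invs w|.
Proof.
move: {2}#|invs w| (erefl #|invs w|) => k; elim: k w => [|k IHk] w wk.
  exists [::]; rewrite word_perm_nil wk; split=> //; apply/esym/no_desc_id => i.
  by apply/negP => /invs_sgenN; rewrite wk.
have [i di] : exists i, desc w i.
  apply/existsP; apply: contraPT wk; rewrite negb_exists => /forallP wd.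
  by rewrite (no_desc_id wd) invs1.
have [s [sw ss]] := IHk (sgen i * w)%g (succn_inj (etrans (esym (invs_sgenN di)) wk)).
exists (i :: s); rewrite word_perm_cons sw sgenK; split=> //=.
by rewrite (invs_sgenN di) ss.
Qed.

Lemma plength_min s : (plength (word_perm s : 'S_n) <= size s)%N.
Proof.
rewrite /plength; case: ex_minnP => l _; apply.
by apply/existsP; exists (in_tuple s).
Qed.

Lemma plengthE w : plength w = #|invs w|.
Proof.
apply/eqP; rewrite eqn_leq; apply/andP; split.
  by have [s [<- <-]] := invs_wordP w; exact: plength_min.
rewrite /plength; case: ex_minnP => l /existsP[s /eqP <-] _.
by rewrite -{2}(size_tuple s) invs_word.
Qed.

End Inversions.

(** A sealed copy of [plength], so that conversion does not reach the search for a shortest word. *)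
HB.lock Definition len n (w : 'S_n) := plength w.

Section Length.
Variable n : nat.
Implicit Types (u v w : 'S_n) (i j : 'I_n.-1) (x y : 'I_n).

Lemma lenE w : len w = #|invs w|. Proof. by rewrite len.unlock plengthE. Qed.
Lemma len_min s : (len (word_perm s : 'S_n) <= size s)%N.
Proof. by rewrite len.unlock plength_min. Qed.

Lemma len_sgen w i : ~~ desc w i -> len (sgen i * w) = (len w).+1.
Proof. by rewrite !lenE; exact: invs_sgen. Qed.

Lemma len_sgenN w i : desc w i -> len w = (len (sgen i * w)).+1.
Proof. by rewrite !lenE; exact: invs_sgenN. Qed.

Lemma len1 : len (1%g : 'S_n) = 0.
Proof. by rewrite lenE invs1. Qed.

Lemma reduced_wordP w :
  word_perm (reduced_word w) = w /\ size (reduced_word w) = len w.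
Proof.
by rewrite len.unlock; have /andP[/eqP ? /eqP ?] := xchooseP (reduced_word_subproof w).
Qed.

Lemma lenV w : len w^-1%g = len w.
Proof.
suff le u : (len u^-1%g <= len u)%N.
  by apply/eqP; rewrite eqn_leq le -{1}(invgK w) le.
have [wu su] := reduced_wordP u; rewrite -su.
have -> : u^-1%g = word_perm (rev (reduced_word u)) by rewrite word_perm_rev wu.
by rewrite -size_rev len_min.
Qed.

Definition reduced s := size s == len (word_perm s : 'S_n).

Lemma reduced_cons i s :
  reduced (i :: s) = reduced s && ~~ desc (word_perm s) i.
Proof.
rewrite /reduced word_perm_cons /=.
have le := len_min s.
case: (boolP (desc (word_perm s) i)) => d; last first.
  by rewrite len_sgen // eqSS andbT.
by have := len_sgenN d; rewrite andbF; lia.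
Qed.

End Length.

(** * Commutation and braid relations between simple transpositions *)

Section Braid.
Variable n : nat.
Implicit Types (u v w : 'S_n) (i j : 'I_n.-1) (x y : 'I_n).

Definition far i j := (i.+1 < j)%N || (j.+1 < i)%N.

Lemma far_sym i j : far i j = far j i. Proof. by rewrite /far orbC. Qed.

Lemma desc_far w i j : far i j -> desc (sgen i * w) j = desc w j.
Proof.
rewrite /far /desc !permM => ij.
have -> : sgen i (lo j) = lo j by apply/val_inj; rewrite /= sgen_val /=; liaif.
by have -> : sgen i (hi j) = hi j by apply/val_inj; rewrite /= sgen_val /=; liaif.
Qed.

Lemma sgen_comm i j : far i j -> (sgen i * sgen j = sgen j * sgen i)%g.
Proof.
rewrite /far => ij; apply/permP => x; apply/val_inj; rewrite /= !permM !sgen_val.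
by liaif.
Qed.

Lemma sgen_braid i j : j = i.+1 :> nat ->
  (sgen i * sgen j * sgen i = sgen j * sgen i * sgen j)%g.
Proof.
move=> ij; apply/permP => x; apply/val_inj; rewrite /= !permM !sgen_val ij.
by liaif.
Qed.

Section Adjacent.
Variables (i j : 'I_n.-1) (ij : j = i.+1 :> nat) (w : 'S_n).

Let lohi : lo j = hi i. Proof. exact: val_inj. Qed.
Let s_ilo : sgen i (lo j) = lo i. Proof. by rewrite lohi sgen_hi. Qed.
Let s_ihi : sgen i (hi j) = hi j.
Proof. by apply/val_inj; rewrite /= sgen_val /=; liaif. Qed.
Let s_jlo : sgen j (lo i) = lo i.
Proof. by apply/val_inj; rewrite /= sgen_val /=; liaif. Qed.
Let s_jhi : sgen j (hi i) = hi j. Proof. by rewrite -lohi sgen_lo. Qed.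

(** In the coset of [w] under two adjacent generators every descent is a comparison between the
    three values of [w] at [lo i], [hi i] and [hi j]. *)
Lemma desc_ij : desc (sgen i * w) j = (w (hi j) < w (lo i))%N.
Proof. by rewrite /desc !permM s_ilo s_ihi. Qed.
Lemma desc_ji : desc (sgen j * w) i = (w (hi j) < w (lo i))%N.
Proof. by rewrite /desc !permM s_jlo s_jhi. Qed.
Lemma desc_iji : desc (sgen j * (sgen i * w)) i = desc w j.
Proof. by rewrite /desc !permM s_jlo s_jhi s_ihi sgen_lo lohi. Qed.
Lemma desc_jij : desc (sgen i * (sgen j * w)) j = desc w i.
Proof. by rewrite /desc !permM s_ilo s_ihi s_jlo sgen_hi lohi. Qed.
Lemma desc_adj : (desc w i = (w (hi i) < w (lo i))%N) *
  (desc w j = (w (hi j) < w (hi i))%N).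
Proof. by rewrite /desc lohi. Qed.
Lemma adj_neq : [/\ w (lo i) != w (hi i) :> nat, w (lo i) != w (hi j) :> nat &
  w (hi i) != w (hi j) :> nat].
Proof. by rewrite !perm_neq /= ij; split; lia. Qed.
End Adjacent.

Lemma far_or_adj i j : i != j -> [\/ far i j, j = i.+1 :> nat | i = j.+1 :> nat].
Proof.
rewrite -val_eqE /= => ij; case: (boolP (far i j)) => [|nf]; first by constructor 1.
by case: (ltnP i j) => h; [constructor 2|constructor 3]; move: nf; rewrite /far; lia.
Qed.

End Braid.

(** * The basis [T_w] and the symmetrizing trace *)

(* Locked, because comparing two instances of [hT] by conversion unfolds the choice
   of reduced words. *)
HB.lock Definition Tw (R : comNzRingType) (Q : R) (n : nat) (w : 'S_n) := hT Q w.

Section LeftRegular.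
Variables (R : comNzRingType) (Q : R) (n : nat).
Local Notation H := (hecke Q n).
Local Notation F := {ffun 'S_n -> R}.
Implicit Types (u v w : 'S_n) (i j : 'I_n.-1) (f : F) (h : H).

Lemma hgen_comm i j : far i j -> hgen Q i * hgen Q j = hgen Q j * hgen Q i.
Proof. by have [_ + _] := hgen_relations Q n; exact. Qed.
Lemma hgen_braid i j : j = i.+1 :> nat ->
  hgen Q i * hgen Q j * hgen Q i = hgen Q j * hgen Q i * hgen Q j.
Proof. by have [+ _ _] := hgen_relations Q n; exact. Qed.
Lemma hgen_quad i : hgen Q i * hgen Q i = Q *: hgen Q i + 1.
Proof. by have [_ _ +] := hgen_relations Q n; move=> <-; rewrite expr2. Qed.

Definition hword (s : seq 'I_n.-1) : H := \prod_(i <- s) hgen Q i.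

Lemma hword_nil : hword [::] = 1. Proof. exact: big_nil. Qed.
Lemma hword_cons i s : hword (i :: s) = hgen Q i * hword s.
Proof. exact: big_cons. Qed.
Lemma hword_cat s t : hword (s ++ t) = hword s * hword t.
Proof. exact: big_cat. Qed.

(** Induction on the length. If the first letters [i] and [j] differ, both are left descents of [w],
    so [w] also has reduced words that begin with the two sides of the relation between [i] and [j];
    each given word is compared with one of them after its first letter. *)
Lemma matsumoto s t : reduced s -> reduced t -> word_perm s = word_perm t ->
  hword s = hword t.
Proof.
move: {2}(size s) (leqnn (size s)) => k.
elim: k s t => [|k IHk] s t ss rs rt st.
  have ts : size t = size s by rewrite (eqP rs) (eqP rt) st.
  by move: ss ts; rewrite leqn0 => /nilP -> /= /size0nil ->.
case: s t ss rs rt st => [|i s] [|j t] //.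
- by move=> _ /eqP /= + /eqP /=; move=> + + e; rewrite e => <-.
- by move=> _ /eqP /= + /eqP /=; move=> + + e; rewrite -e => <-.
rewrite ltnS !reduced_cons !word_perm_cons !hword_cons.
move=> ss /andP[rs ds] /andP[rt dt] st.
have st' : size t = size s.
  have : size (i :: s) = size (j :: t); last by case.
  have /eqP -> : reduced (i :: s) by rewrite reduced_cons rs.
  have /eqP -> : reduced (j :: t) by rewrite reduced_cons rt.
  by rewrite !word_perm_cons st.
case: (eqVneq i j) st => [-> /mulgI/(IHk _ _ ss rs rt) -> // | ij].
set w := (sgen i * word_perm s)%g => st.
have di : desc w i by rewrite desc_sgen.
have dj : desc w j by rewrite st desc_sgen.
have ws : word_perm s = (sgen i * w)%g by rewrite /w sgenK.
have wt : word_perm t = (sgen j * w)%g by rewrite st sgenK.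
have rred u : reduced (reduced_word u).
  by have [uE su] := reduced_wordP u; rewrite /reduced uE su.
have rwP u : word_perm (reduced_word u) = u by case: (reduced_wordP u).
have adj (a b : 'I_n.-1) (p q : seq _) : b = a.+1 :> nat -> word_perm p = (sgen a * w)%g ->
    word_perm q = (sgen b * w)%g -> reduced p -> reduced q -> (size p <= k)%N ->
    (size q <= k)%N -> desc w a -> desc w b ->
    hgen Q a * hword p = hgen Q b * hword q.
  move=> ab wp wq rp rq sp sq da db.
  (* [r] spells what remains of [w] once the braid [aba = bab] is removed on the left. *)
  pose r := reduced_word (sgen a * (sgen b * (sgen a * w)))%g.
  have rE : (sgen a * (sgen b * (sgen a * w)) = sgen b * (sgen a * (sgen b * w)))%g.
    by rewrite !mulgA sgen_braid.
  have [daE dbE] := desc_adj ab w.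
  have lt : (w (hi b) < w (lo a))%N by rewrite daE in da; rewrite dbE in db; exact: ltn_trans db da.
  have e1 : word_perm [:: b, a & r] = word_perm p.
    by rewrite wp !word_perm_cons rwP !sgenK.
  have e2 : word_perm [:: a, b & r] = word_perm q.
    by rewrite wq !word_perm_cons rwP rE !sgenK.
  have r1 : reduced [:: b, a & r].
    rewrite !reduced_cons rred !word_perm_cons rwP sgenK.
    by rewrite !desc_sgen !negbK (desc_iji ab) db (desc_ij ab).
  have r2 : reduced [:: a, b & r].
    rewrite !reduced_cons rred !word_perm_cons rwP rE sgenK.
    by rewrite !desc_sgen !negbK (desc_jij ab) da (desc_ji ab).
  rewrite -(IHk [:: b, a & r] p) // ?(eqP r1) ?e1 -?(eqP rp) //.
  rewrite -(IHk [:: a, b & r] q) // ?(eqP r2) ?e2 -?(eqP rq) //.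
  by rewrite !hword_cons !mulrA hgen_braid.
case: (far_or_adj ij) => h; first 1 last.
- by apply: (adj i j) => //; rewrite st'.
- by apply/esym/(adj j i) => //; rewrite st'.
pose r := reduced_word (sgen j * (sgen i * w))%g.
have e1 : word_perm (j :: r) = word_perm s by rewrite ws word_perm_cons rwP sgenK.
have e2 : word_perm (i :: r) = word_perm t.
  by rewrite wt word_perm_cons rwP mulgA (sgen_comm h) -mulgA sgenK.
have r1 : reduced (j :: r).
  by rewrite reduced_cons rred rwP desc_sgen negbK desc_far.
have r2 : reduced (i :: r).
  rewrite reduced_cons rred rwP mulgA -(sgen_comm h) -mulgA desc_sgen negbK.
  by rewrite desc_far // far_sym.
rewrite -(IHk _ _ _ r1 rs e1); last by rewrite (eqP r1) e1 -(eqP rs).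
rewrite -(IHk _ _ _ r2 rt e2); last by rewrite (eqP r2) e2 -(eqP rt) st'.
by rewrite !hword_cons !mulrA hgen_comm.
Qed.

Lemma hT_Tw w : hT Q w = Tw Q w :> H. Proof. by rewrite Tw.unlock. Qed.

Lemma Tw_word s : reduced s -> Tw Q (word_perm s) = hword s.
Proof.
rewrite Tw.unlock => rs; have [ws ss] := reduced_wordP (word_perm s).
by apply: matsumoto => //; rewrite /reduced ws ss.
Qed.

Lemma redP w : exists2 s, reduced s & word_perm s = w.
Proof.
by have [ws ss] := reduced_wordP w; exists (reduced_word w); rewrite // /reduced ws ss.
Qed.

Lemma Tw1 : Tw Q 1%g = 1 :> H.
Proof.
rewrite -hword_nil -(@Tw_word [::]) ?word_perm_nil //.
by rewrite /reduced word_perm_nil len1.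
Qed.

Lemma TwM u v : len (u * v)%g = (len u + len v)%N ->
  Tw Q (u * v)%g = Tw Q u * Tw Q v.
Proof.
have [s rs <-] := redP u; have [t rt <-] := redP v.
rewrite -word_perm_cat -(eqP rs) -(eqP rt) -size_cat => st.
by rewrite !Tw_word ?hword_cat // /reduced st.
Qed.

Lemma len_gen i : len (sgen i) = 1%N.
Proof. by rewrite -[sgen i]mulg1 len_sgen ?desc1 // len1. Qed.

Lemma Tw_gen i : Tw Q (sgen i) = hgen Q i.
Proof.
have -> : sgen i = word_perm [:: i] by rewrite word_perm_cons word_perm_nil mulg1.
rewrite Tw_word ?hword_cons ?hword_nil ?mulr1 //.
by rewrite /reduced word_perm_cons word_perm_nil mulg1 len_gen.
Qed.

Lemma hgen_Tw i w : hgen Q i * Tw Q w =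
  Tw Q (sgen i * w)%g + (if desc w i then Q *: Tw Q w else 0).
Proof.
case: ifPn => d; last first.
  by rewrite addr0 TwM ?Tw_gen // len_gen len_sgen.
have e : Tw Q w = hgen Q i * Tw Q (sgen i * w)%g.
  rewrite -Tw_gen -TwM sgenK // len_gen (len_sgenN d) //.
rewrite {1 2}e mulrA hgen_quad mulrDl mul1r -scalerAl addrC //.
Qed.

Definition rdesc w i := desc w^-1%g i.

Lemma Tw_hgen i w : Tw Q w * hgen Q i =
  Tw Q (w * sgen i)%g + (if rdesc w i then Q *: Tw Q w else 0).
Proof.
have lr : len (w * sgen i)%g = len (sgen i * w^-1)%g.
  by rewrite -lenV invMg sgenV.
rewrite /rdesc; case: ifPn => d; last first.
  by rewrite addr0 TwM ?Tw_gen // lr len_gen len_sgen // addn1 lenV.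
have e : Tw Q w = Tw Q (w * sgen i)%g * hgen Q i.
  by rewrite -Tw_gen -TwM sgenKr // len_gen lr addn1 -(len_sgenN d) lenV.
by rewrite {1 2}e -mulrA hgen_quad mulrDr mulr1 -scalerAr addrC.
Qed.

(** Left multiplication by [g_i], written on coefficients: [f] stands for the sum of the
    [f w *: T_w]. Acting on functions on the group, where independence is automatic, is what shows
    that the [T_w] are independent. *)
Definition Lreg i f : F := [ffun u => f (sgen i * u)%g + (if desc u i then Q * f u else 0)].

Fixpoint hact (x : hterm R n) (f : F) : F :=
  match x with
  | HScal a => [ffun u => a * f u]
  | HGen i => Lreg i f
  | HAdd x y => hact x f + hact y f
  | HMul x y => hact x (hact y f)
  end.

Lemma hactD x f g : hact x (f + g) = hact x f + hact x g.
Proof.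
elim: x f g => [a|i|x IHx y IHy|x IHx y IHy] f g /=; first 2 last.
- by rewrite IHx IHy addrACA.
- by rewrite IHy IHx.
- by apply/ffunP => u; rewrite !ffunE mulrDr.
- by apply/ffunP => u; rewrite !ffunE; case: ifP => _; ring.
Qed.

Lemma hactZ x a f : hact x [ffun u => a * f u] = [ffun u => a * hact x f u].
Proof.
elim: x f => [b|i|x IHx y IHy|x IHx y IHy] f /=; first 2 last.
- by rewrite IHx IHy; apply/ffunP => u; rewrite !ffunE mulrDr.
- by rewrite IHy IHx.
- by apply/ffunP => u; rewrite !ffunE mulrCA.
- by apply/ffunP => u; rewrite !ffunE; case: ifP => _; ring.
Qed.

Lemma hact_equiv x y f : hequiv Q x y -> hact x f = hact y f.
Proof.
move=> xy; elim: xy f => {x y} //=.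
- by move=> x y z _ h1 _ h2 f; rewrite h1 h2.
- by move=> x x' y y' _ h1 _ h2 f; rewrite h1 h2.
- by move=> x x' y y' _ hx _ hy f; rewrite hy hx.
- by move=> x y z f; rewrite addrA.
- by move=> x y f; rewrite addrC.
- by move=> x f; apply/ffunP => u; rewrite !ffunE mul0r add0r.
- by move=> x f; apply/ffunP => u; rewrite !ffunE mul0r mulN1r addNr.
- by move=> x f; apply/ffunP => u; rewrite !ffunE mul1r.
- by move=> x y z f; rewrite hactD.
- by move=> a b f; apply/ffunP => u; rewrite !ffunE mulrDl.
- by move=> a b f; apply/ffunP => u; rewrite !ffunE mulrA.
- by move=> a x f; rewrite hactZ.
- move=> i j ij f; apply/ffunP => u.
  rewrite !ffunE !(desc_iji ij) !(desc_jij ij) !desc_sgen !(desc_ij ij) !(desc_ji ij).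
  rewrite !sgenK.
  have -> : (sgen j * (sgen i * (sgen j * u)) = sgen i * (sgen j * (sgen i * u)))%g.
    by rewrite !mulgA (sgen_braid ij).
  have [d1 d2] := desc_adj ij u; have [n1 n2 n3] := adj_neq ij u.
  rewrite !d1 !d2.
  (* Only the six elements of the coset of [u] under the two generators occur, and the order of
     three values of [u] decides all the descents. *)
  move: (f _) (f _) (f _) (f _) (f _) (f _) => f1 f2 f3 f4 f5 f6.
  case: ltngtP n1 => //= h1 _; case: ltngtP n2 => //= h2 _;
    case: ltngtP n3 => //= h3 _; (try by exfalso; lia); ring.
- move=> i j ij f; apply/ffunP => u.
  rewrite !ffunE !desc_far // 1?far_sym //.
  have -> : (sgen j * (sgen i * u) = sgen i * (sgen j * u))%g.
    by rewrite !mulgA (sgen_comm ij).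
  by case: ifP => _; case: ifP => _; ring.
- move=> i f; apply/ffunP => u; rewrite !ffunE sgenK desc_sgen.
  by case: (desc u i) => /=; ring.
Qed.

Definition hreg (h : H) : F -> F := hact (generic_quotient.repr h).

Lemma hreg_pi x f : hreg (\pi_H x)%qT f = hact x f.
Proof. exact/hact_equiv/hecke_reprE. Qed.

Lemma hreg_gen i f : hreg (hgen Q i) f = Lreg i f.
Proof. exact: hreg_pi. Qed.

Lemma hregD h h' f : hreg (h + h') f = hreg h f + hreg h' f.
Proof.
by elim/quotW: h => x; elim/quotW: h' => y; rewrite [_ + _](haddE Q x y) !hreg_pi.
Qed.

Lemma hregM h h' f : hreg (h * h') f = hreg h (hreg h' f).
Proof.
by elim/quotW: h => x; elim/quotW: h' => y; rewrite [_ * _](hmulE Q x y) !hreg_pi.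
Qed.

Lemma hregZ a h f : hreg (a *: h) f = [ffun u => a * hreg h f u].
Proof.
by elim/quotW: h => x; rewrite [_ *: _](hmulE Q (HScal a) x) !hreg_pi.
Qed.

Lemma hreg1 f : hreg 1 f = f.
Proof. by rewrite [LHS]hreg_pi /=; apply/ffunP => u; rewrite !ffunE mul1r. Qed.

(** The indicator function of 1 represents [T_1 = 1], so the action of [h] on it gives the
    coefficients of [h] in the [T_w]. *)
Definition coef h : F := hreg h [ffun w => (w == 1%g)%:R].

Lemma coefD h h' u : coef (h + h') u = coef h u + coef h' u.
Proof. by rewrite /coef hregD ffunE. Qed.
Lemma coefZ a h u : coef (a *: h) u = a * coef h u.
Proof. by rewrite /coef hregZ ffunE. Qed.
Lemma coef0 u : coef 0 u = 0.
Proof. by rewrite -(scale0r 0) coefZ mul0r. Qed.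
Lemma coefN h u : coef (- h) u = - coef h u.
Proof. by rewrite -scaleN1r coefZ mulN1r. Qed.
Lemma coefB h h' u : coef (h - h') u = coef h u - coef h' u.
Proof. by rewrite coefD coefN. Qed.
Lemma coef_sum (I : Type) (r : seq I) (P : pred I) (F : I -> H) u :
  coef (\sum_(i <- r | P i) F i) u = \sum_(i <- r | P i) coef (F i) u.
Proof. exact: (big_morph (fun h => coef h u) (fun x y => coefD x y u) (coef0 u)). Qed.
Lemma coef_if (b : bool) h u : coef (if b then h else 0) u = if b then coef h u else 0.
Proof. by case: b; rewrite ?coef0. Qed.

Lemma coef_gen i h u : coef (hgen Q i * h) u =
  coef h (sgen i * u)%g + (if desc u i then Q * coef h u else 0).
Proof. by rewrite /coef hregM hreg_gen ffunE. Qed.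

Lemma coef_Tw w u : coef (Tw Q w) u = (u == w)%:R.
Proof.
have [s + <-] := redP w; elim: s u {w} => [|i s IHs] u.
  by rewrite word_perm_nil Tw1 /coef hreg1 ffunE.
rewrite reduced_cons => /andP[rs ds]; rewrite Tw_word; last first.
  by rewrite reduced_cons rs.
rewrite hword_cons -Tw_word // coef_gen !IHs // word_perm_cons.
rewrite -(inj_eq (mulgI (sgen i))) sgenK; case: ifP; rewrite ?addr0 // => du.
suff /negPf -> : u != word_perm s by rewrite mulr0 addr0.
by apply: contraNneq ds => <-.
Qed.

Lemma hgen_sum i f :
  hgen Q i * (\sum_w f w *: Tw Q w) = \sum_w Lreg i f w *: Tw Q w.
Proof.
rewrite mulr_sumr.
under eq_bigr => w _ do rewrite -scalerAr hgen_Tw scalerDr.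
rewrite big_split /= (reindex_inj (mulgI (sgen i))) /=.
rewrite -big_split /=; apply: eq_bigr => w _; rewrite sgenK ffunE scalerDl.
by case: ifP => _; rewrite ?scaler0 ?scale0r // scalerA mulrC.
Qed.

Lemma hreg_sum h f : h * (\sum_w f w *: Tw Q w) = \sum_w hreg h f w *: Tw Q w.
Proof.
elim/quotW: h => x; rewrite hreg_pi; elim: x f => [a|i|x IHx y IHy|x IHx y IHy] f /=.
- transitivity (a *: \sum_w f w *: Tw Q w).
    by [].
  by rewrite scaler_sumr; apply: eq_bigr => w _; rewrite ffunE scalerA.
- exact: hgen_sum.
- rewrite -(haddE Q x y) [X in X * _ = _](erefl : _ = _ + _ :> H) mulrDl IHx IHy -big_split /=.
  by apply: eq_bigr => w _; rewrite ffunE scalerDl.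
- rewrite -(hmulE Q x y) [X in X * _ = _](erefl : _ = _ * _ :> H) -mulrA IHy IHx.
  by [].
Qed.

Lemma Tw_expand h : h = \sum_w coef h w *: Tw Q w.
Proof.
rewrite -hreg_sum (bigD1 1%g) //= big1 ?ffunE ?eqxx; last first.
  by move=> w w1; rewrite ffunE (negPf w1) scale0r.
by rewrite scale1r addr0 Tw1 mulr1.
Qed.

Lemma coef_inj h h' : coef h =1 coef h' -> h = h'.
Proof.
by move=> hh; rewrite (Tw_expand h) (Tw_expand h'); apply: eq_bigr => w _; rewrite hh.
Qed.

Lemma coef_genr i h u : coef (h * hgen Q i) u =
  coef h (u * sgen i)%g + (if rdesc u i then Q * coef h u else 0).
Proof.
rewrite {1}(Tw_expand h) mulr_suml coef_sum.
under eq_bigr => w _ do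
  rewrite -scalerAl coefZ Tw_hgen coefD coef_if coefZ !coef_Tw mulrDr.
rewrite big_split /= (bigD1 (u * sgen i)%g) //= sgenKr eqxx mulr1 big1 ?addr0.
  congr (_ + _); rewrite (bigD1 u) //= eqxx big1 ?addr0.
    by case: ifP => _; rewrite ?mulr0 // mulr1 mulrC.
  move=> w wu; rewrite eq_sym (negPf wu) mulr0.
  by case: ifP => _; rewrite mulr0.
move=> w wu; rewrite (_ : u == _ = false) ?mulr0 //.
by apply: contraNF wu => /eqP ->; rewrite sgenKr.
Qed.

(** Duality of the bases [T_w] and [T_{w^-1}] for the trace form: the letters of a reduced word are
    moved over one by one, and the quadratic term never appears because no descent is met. *)
Lemma coef_tau h w : coef (h * Tw Q w) 1%g = coef h w^-1%g.
Proof.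
have [s + <-] := redP w; elim: s h {w} => [|i s IHs] h rs.
  by rewrite word_perm_nil Tw1 mulr1 invg1.
rewrite Tw_word // hword_cons mulrA; move: rs; rewrite reduced_cons => /andP[rs ds].
rewrite -Tw_word // IHs // coef_genr word_perm_cons invMg sgenV.
by rewrite /rdesc invgK (negPf ds) addr0.
Qed.

(** For one generator both sides are the coefficient at [sgen i], since the identity has no descent;
    words are then rotated letter by letter. *)
Lemma coef_tauC h h' : coef (h * h') 1%g = coef (h' * h) 1%g.
Proof.
suff gen s h1 : coef (hword s * h1) 1%g = coef (h1 * hword s) 1%g.
  rewrite (Tw_expand h) mulr_suml mulr_sumr !coef_sum; apply: eq_bigr => w _.
  rewrite -scalerAl -scalerAr !coefZ; congr (_ * _).
  by have [s rs <-] := redP w; rewrite Tw_word.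
elim: s h1 => [|i s IHs] h1; first by rewrite hword_nil mul1r mulr1.
rewrite hword_cons -mulrA [h1 * _]mulrA -IHs [hword s * (h1 * _)]mulrA.
by rewrite coef_gen coef_genr /rdesc invg1 desc1 mulg1 mul1g.
Qed.

Lemma coefE h w : coef h w = coef (h * Tw Q w^-1%g) 1%g.
Proof. by rewrite coef_tau invgK. Qed.

Lemma hecke_ind (P : H -> Prop) :
  (forall a h, P h -> P (a *: h)) -> P 1 -> (forall i, P (hgen Q i)) ->
  (forall h h', P h -> P h' -> P (h + h')) ->
  (forall i h, P h -> P (hgen Q i * h)) -> forall h, P h.
Proof.
move=> PZ P1 Pg PD PM h; rewrite (Tw_expand h); elim/big_ind: _ => //.
- by rewrite -(scale0r 1); apply: PZ.
- move=> w _; apply: PZ; have [s rs <-] := redP w; rewrite Tw_word //.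
  elim: s {rs} => [|i s IHs]; first by rewrite hword_nil.
  by rewrite hword_cons; apply: PM.
Qed.

Lemma central_gen h : (forall i, h * hgen Q i = hgen Q i * h) -> hcentral h.
Proof.
move=> hg; elim/hecke_ind => //.
- by move=> a x hx; rewrite -scalerAl -scalerAr hx.
- by rewrite mul1r mulr1.
- by move=> x y hx hy; rewrite mulrDl mulrDr hx hy.
- by move=> i x hx; rewrite mulrA hg -mulrA hx mulrA.
Qed.

End LeftRegular.

(** * Young subgroups and the normalization map *)

Section YoungPerm.
Variables (n : nat) (b : 'I_n -> nat).
Hypothesis b_homo : forall x y : 'I_n, (x <= y)%N -> (b x <= b y)%N.
Implicit Types (d u v w y : 'S_n) (i j : 'I_n.-1) (x : 'I_n).

(** A weakly increasing [b] encodes a composition by its fibres. It will be the block number in a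
    partition, or the blocks cut out by a set of generators. *)
Definition block_gen i := b (lo i) == b (hi i).
Definition block_perm y := [forall x, b (y x) == b x].
(** The explicit form of minimal length in the coset of [d]: the values of each block occur in
    increasing order. *)
Definition minrep d :=
  [forall x : 'I_n, forall x' : 'I_n, (x < x')%N && (b (d x) == b (d x')) ==> (d x < d x')%N].

Lemma block_permP y : reflect (forall x, b (y x) = b x) (block_perm y).
Proof. by apply: (iffP forallP) => h x; apply/eqP. Qed.

Lemma minrepP d : reflect
  (forall x x' : 'I_n, (x < x')%N -> b (d x) = b (d x') -> (d x < d x')%N) (minrep d).
Proof.
apply: (iffP forallP) => [h x x' xx' bb | h x].
  by have /forallP/(_ x')/implyP := h x; apply; rewrite xx' bb eqxx.
by apply/forallP => x'; apply/implyP => /andP[xx' /eqP]; apply: h.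
Qed.

Lemma block_gen_perm i : block_gen i -> block_perm (sgen i).
Proof.
move=> /eqP bi; apply/block_permP => x; rewrite /sgen permE /=.
case: eqVneq => [->|_]; first by rewrite -/(hi i) bi.
by case: eqVneq => [->|_] //; rewrite -/(lo i) bi.
Qed.

Lemma block_perm1 : block_perm 1%g.
Proof. by apply/block_permP => x; rewrite perm1. Qed.
Lemma block_permM y z : block_perm y -> block_perm z -> block_perm (y * z)%g.
Proof.
by move=> /block_permP hy /block_permP hz; apply/block_permP => x; rewrite permM hz hy.
Qed.

Lemma b_lt (x x' : 'I_n) : (b x < b x')%N -> (x < x')%N.
Proof. by move=> h; rewrite ltnNge; apply: contraL h => /b_homo; rewrite -leqNgt. Qed.

(** Pairs of positions with values in different blocks are ordered by [d * y] as by [d]; pairs with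
    values in one block are in order for [d] and are inverted exactly by [y]. The inversions thus
    split into two disjoint sets. *)
Lemma len_minrep d y : minrep d -> block_perm y ->
  len (d * y)%g = (len d + len y)%N.
Proof.
move=> /minrepP dm /block_permP yb; rewrite !lenE.
pose G (p : 'I_n * 'I_n) := (d^-1 p.1, d^-1 p.2)%g.
have injG : injective G by move=> [p1 p2] [q1 q2] [/perm_inj -> /perm_inj ->].
rewrite -(card_imset (mem (invs y)) injG).
have memG p : (p \in [set G q | q in invs y]) = ((d p.1, d p.2) \in invs y).
  by rewrite -[RHS](mem_imset _ _ injG) /G /= !permK; case: p.
have -> : invs (d * y) = invs d :|: [set G q | q in invs y].
  apply/setP => -[x x']; rewrite in_setU memG !inE /= !permM.
  have hx := yb (d x); have hx' := yb (d x').
  have n1 := perm_neq d x x'; have n2 := perm_neq y (d x) (d x').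
  have n3 := perm_neq (d * y) x x'; rewrite !permM in n3.
  case: (ltngtP (b (d x)) (b (d x'))) => bb.
  - have := b_lt bb; have : (y (d x) < y (d x'))%N by apply: b_lt; rewrite hx hx'.
    by lia.
  - have := b_lt bb; have : (y (d x') < y (d x))%N by apply: b_lt; rewrite hx hx'.
    by lia.
  - case: (ltngtP x x') => [xx'|xx'|xx'] /=.
    + by have := dm _ _ xx' bb; lia.
    + by have := dm _ _ xx' (esym bb); lia.
    + by move: n1; rewrite xx' eqxx; lia.
rewrite cardsU disjoint_setI0 ?cards0 ?subn0 //.
rewrite disjoint_subset; apply/subsetP => -[x x'] /[!inE] /andP[/= xx' dd].
rewrite memG inE /= negb_and -leqNgt; apply/orP; left; exact: ltnW.
Qed.

Lemma minrep_rdesc d : minrep d = [forall i, block_gen i ==> ~~ rdesc d i].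
Proof.
apply/minrepP/forallP => [dm i | dm].
  apply/implyP => /eqP bi; rewrite /rdesc /desc -leqNgt leqNgt.
  apply/negP => /dm; rewrite !permKV => /(_ (esym bi)).
  by rewrite /=; lia.
suff inc k (v v' : 'I_n) : v' = (v + k.+1)%N :> nat -> b v = b v' ->
    (d^-1%g v < d^-1%g v')%N.
  move=> x x' xx' bb; rewrite ltnNge leq_eqVlt negb_or perm_neq; apply/andP; split.
    by apply/eqP; lia.
  apply/negP => dd; have := inc (d x - d x').-1 (d x') (d x).
  by rewrite !permK => /(_ _ (esym bb)); move: dd; lia.
elim: k v v' => [|k IHk] v v' vv' bb.
  have lt : (v < n.-1)%N by have := ltn_ord v'; lia.
  have e1 : lo (Ordinal lt) = v by apply: val_inj.
  have e2 : hi (Ordinal lt) = v' by apply: val_inj => /=; lia.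
  have := dm (Ordinal lt); rewrite /block_gen /rdesc /desc e1 e2 bb eqxx /=.
  by have := perm_neq d^-1%g v v'; lia.
have lt : (v + k.+1 < n)%N by have := ltn_ord v'; lia.
have h1 : (b v <= b (Ordinal lt))%N by apply: b_homo; rewrite /=; lia.
have h2 : (b (Ordinal lt) <= b v')%N by apply: b_homo; rewrite /=; lia.
have bE : b v = b (Ordinal lt) by lia.
apply: (ltn_trans (IHk v (Ordinal lt) erefl bE)).
have lt' : (v + k.+1 < n.-1)%N by have := ltn_ord v'; lia.
have e1 : lo (Ordinal lt') = Ordinal lt by apply: val_inj.
have e2 : hi (Ordinal lt') = v' by apply: val_inj => /=; lia.
have := dm (Ordinal lt'); rewrite /block_gen /rdesc /desc e1 e2 -bE bb eqxx /=.
by have := perm_neq d^-1%g (Ordinal lt) v'; rewrite /=; lia.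
Qed.

(** A value strictly between [d (lo i)] and [d (hi i)] would lie in the same block, hence at a
    position strictly between two adjacent ones; so the two values are consecutive. With
    [minrep_diff] this is Deodhar's lemma. *)
Lemma minrep_same d i : minrep d -> b (d (lo i)) = b (d (hi i)) ->
  exists j, [/\ block_gen j, lo j = d (lo i), hi j = d (hi i) &
                (sgen i * d = d * sgen j)%g].
Proof.
move=> /minrepP dm bi.
have dlt : (d (lo i) < d (hi i))%N by apply: dm => //=.
have dS : d (hi i) = (d (lo i)).+1 :> nat.
  apply/eqP; rewrite eqn_leq dlt andbT leqNgt; apply/negP => lt.
  have lt' : ((d (lo i)).+1 < n)%N by have := ltn_ord (d (hi i)); lia.
  pose v := Ordinal lt'; pose x := (d^-1 v)%g.
  have dx : d x = v by rewrite permKV.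
  have b1 : (b (d (lo i)) <= b v)%N by apply: b_homo => /=.
  have b2 : (b v <= b (d (hi i)))%N by apply: b_homo => /=; lia.
  case: (ltngtP x (lo i)) => [xl|xl|/val_inj xl].
  - by have := dm _ _ xl; rewrite dx /=; lia.
  - case: (ltngtP x (hi i)) => [xh|xh|/val_inj xh].
    + by move: xl xh; rewrite /=; lia.
    + by have := dm _ _ xh; rewrite dx /=; lia.
    + by move: lt; rewrite -xh dx /=; lia.
  - by have : d x = d x :> nat by []; rewrite {1}xl dx /=; lia.
have lt : (d (lo i) < n.-1)%N by have := ltn_ord (d (hi i)); lia.
have e1 : lo (Ordinal lt) = d (lo i) by apply: val_inj.
have e2 : hi (Ordinal lt) = d (hi i) by apply: val_inj => /=.
exists (Ordinal lt); rewrite /block_gen e1 e2 bi eqxx; split=> //.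
have sE k : sgen k = tperm (lo k) (hi k) by [].
by rewrite !sE e1 e2 -tpermJ conjgE mulKVg.
Qed.

Lemma minrep_diff d i : minrep d -> b (d (lo i)) != b (d (hi i)) ->
  minrep (sgen i * d)%g.
Proof.
move=> /minrepP dm bi; apply/minrepP => x x' xx'; rewrite !permM => bb.
case: (ltngtP (sgen i x) (sgen i x')) => [lt|lt|/val_inj/perm_inj e]; first exact: dm.
- have [e1 e2] : x = lo i /\ x' = hi i.
    move: lt xx'; rewrite !sgen_val => lt xx'.
    by split; apply/val_inj; move: lt; rewrite /=; liaif.
  by move: bb bi; rewrite e1 e2 sgen_lo sgen_hi => ->; rewrite eqxx.
- by move: xx'; rewrite e; lia.
Qed.

End YoungPerm.

Section YoungHecke.
Variables (R : comNzRingType) (Q : R) (n : nat) (b : 'I_n -> nat).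
Hypothesis b_homo : forall x y : 'I_n, (x <= y)%N -> (b x <= b y)%N.
Local Notation H := (hecke Q n).
Implicit Types (d u v w y : 'S_n) (i j : 'I_n.-1) (h x : H) (P : pred 'I_n.-1).

Lemma Tw_minrep d y : minrep b d -> block_perm b y ->
  Tw Q (d * y)%g = Tw Q d * Tw Q y.
Proof. by move=> dm yb; rewrite TwM // (len_minrep b_homo). Qed.

Lemma hgen_minrep d i j : minrep b d -> block_gen b j -> (sgen i * d = d * sgen j)%g ->
  hgen Q i * Tw Q d = Tw Q d * hgen Q j /\
  Tw Q d^-1%g * hgen Q i = hgen Q j * Tw Q d^-1%g.
Proof.
move=> dm bj ij; have bs := block_gen_perm bj.
have l1 : len (d * sgen j)%g = (len d).+1.
  by rewrite (len_minrep b_homo) // len_gen addn1.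
have l2 : len (d^-1 * sgen i)%g = (len d^-1).+1.
  by rewrite -(sgenV i) -invMg !lenV ij.
rewrite -!Tw_gen -!TwM ?len_gen ?addn1 ?add1n // ?ij //.
  by split=> //; congr (Tw Q _); apply: invg_inj; rewrite !invMg !sgenV invgK.
by rewrite -(sgenV j) -invMg -ij invMg sgenV.
Qed.

(** The quadratic terms of [z g_i] and [g_i z] agree one by one. In the others either
    [s_i d = d s_j], and [g_j] is moved across [g], or [s_i d] is again minimal. *)
Lemma normalization_central (g : H) :
  (forall j, block_gen b j -> hgen Q j * g = g * hgen Q j) ->
  hcentral (\sum_(d | minrep b d) Tw Q d * g * Tw Q d^-1%g).
Proof.
move=> gc; apply: central_gen => i; rewrite mulr_suml mulr_sumr.
under eq_bigr => d _ do rewrite -mulrA Tw_hgen /rdesc invgK mulrDr.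
under [RHS]eq_bigr => d _ do rewrite -mulrA mulrA hgen_Tw mulrDl.
rewrite !big_split /=; congr (_ + _); last first.
  apply: eq_bigr => d _; case: ifP => _; last by rewrite mulr0 mul0r.
  by rewrite -scalerAr -scalerAl mulrA.
rewrite (bigID (fun d : 'S_n => b (d (lo i)) == b (d (hi i)))) /=.
rewrite [RHS](bigID (fun d : 'S_n => b (d (lo i)) == b (d (hi i)))) /=.
congr (_ + _).
  apply: eq_bigr => d /andP[dm /eqP bd].
  have [j [bj _ _ ij]] := minrep_same b_homo dm bd.
  have [e1 e2] := hgen_minrep dm bj ij.
  have l1 : Tw Q (sgen i * d)%g = Tw Q d * hgen Q j.
    by rewrite ij Tw_minrep ?Tw_gen // block_gen_perm.
  have l2 : Tw Q (d^-1 * sgen i)%g = hgen Q j * Tw Q d^-1%g.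
    rewrite -Tw_gen -TwM; last first.
      rewrite -[in RHS](sgenV j) lenV -(lenV (sgen j * _)) invMg sgenV invgK.
      by rewrite (len_minrep b_homo) ?block_gen_perm // lenV addnC.
    by congr (Tw Q _); apply: invg_inj; rewrite !invMg !sgenV invgK.
  by rewrite l1 l2 -!mulrA [hgen Q j * (g * _)]mulrA gc // -mulrA.
(* Here [d] and [s_i d] are both minimal, and exchanging them matches the two sums. *)
rewrite [RHS](reindex_inj (mulgI (sgen i))) /=; apply: eq_big => d.
  rewrite !permM sgen_lo sgen_hi [b (d (hi i)) == _]eq_sym.
  have [bd|bd] := boolP (b (d (lo i)) == b (d (hi i))); rewrite ?andbF ?andbT //.
  apply/idP/idP => dm; first exact: minrep_diff.
  by rewrite -(sgenK i d); apply: minrep_diff => //; rewrite !permM sgen_lo sgen_hi eq_sym.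
by move=> _; rewrite sgenK invMg sgenV mulrA.
Qed.

Inductive inAlg (P : pred 'I_n.-1) : H -> Prop :=
  | inAlg1 : inAlg P 1
  | inAlg_gen i : P i -> inAlg P (hgen Q i)
  | inAlgD h h' : inAlg P h -> inAlg P h' -> inAlg P (h + h')
  | inAlgZ a h : inAlg P h -> inAlg P (a *: h)
  | inAlgM h h' : inAlg P h -> inAlg P h' -> inAlg P (h * h').

Lemma inAlg0 P : inAlg P 0.
Proof. by rewrite -(scale0r 1); apply/inAlgZ/inAlg1. Qed.

Lemma inAlgS (P P' : pred 'I_n.-1) h : subpred P P' -> inAlg P h -> inAlg P' h.
Proof.
move=> PP'; elim=> {h}; first exact: inAlg1.
- by move=> i /PP'; apply: inAlg_gen.
- by move=> h h' _ ? _ ?; apply: inAlgD.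
- by move=> a h _ ?; apply: inAlgZ.
- by move=> h h' _ ? _ ?; apply: inAlgM.
Qed.

Lemma inAlgT h : inAlg predT h.
Proof.
elim/hecke_ind: h => [a h|||h h'|i h]; first exact: inAlgZ.
- exact: inAlg1.
- by move=> i; apply: inAlg_gen.
- exact: inAlgD.
- by move=> hh; apply: inAlgM => //; apply: inAlg_gen.
Qed.

Lemma inAlg_comm P h x : (forall i, P i -> x * hgen Q i = hgen Q i * x) ->
  inAlg P h -> x * h = h * x.
Proof.
move=> xP; elim=> {h}; first by rewrite mulr1 mul1r.
- by move=> i Pi; apply: xP.
- by move=> h h' _ e _ e'; rewrite mulrDr mulrDl e e'.
- by move=> a h _ e; rewrite -scalerAr -scalerAl e.
- by move=> h h' _ e _ e'; rewrite mulrA e -mulrA e' mulrA.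
Qed.

Lemma inAlg_word P s : all P s -> inAlg P (hword Q s).
Proof.
elim: s => [_|i s IHs]; first by rewrite hword_nil; apply: inAlg1.
rewrite hword_cons => /andP[Pi Ps]; apply: inAlgM; last exact: IHs.
exact: inAlg_gen.
Qed.

Lemma inAlg_sum P (I : Type) (r : seq I) (A : pred I) (F : I -> H) :
  (forall k, A k -> inAlg P (F k)) -> inAlg P (\sum_(k <- r | A k) F k).
Proof.
move=> h; elim/big_ind: _ => //; first exact: inAlg0.
by move=> x y; apply: inAlgD.
Qed.

Lemma inAlg_ind2 P (S : H -> Prop) (h x : H) :
  (forall a x, S x -> S (a *: x)) -> (forall x x', S x -> S x' -> S (x + x')) ->
  (forall i x, P i -> S x -> S (hgen Q i * x)) -> inAlg P h -> S x -> S (h * x).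
Proof.
move=> SZ SD SM Ph; elim: Ph x => {h} [x|i Pi x|h h' _ IH _ IH' x|a h _ IH x|h h' _ IH _ IH' x] Sx.
- by rewrite mul1r.
- exact: SM.
- by rewrite mulrDl; apply: SD; auto.
- by rewrite -scalerAl; auto.
- by rewrite -mulrA; auto.
Qed.

Lemma inAlg_indr P (S : H -> Prop) (h x : H) :
  (forall a x, S x -> S (a *: x)) -> (forall x x', S x -> S x' -> S (x + x')) ->
  (forall i x, P i -> S x -> S (x * hgen Q i)) -> inAlg P h -> S x -> S (x * h).
Proof.
move=> SZ SD SM Ph; elim: Ph x => {h} [x|i Pi x|h h' _ IH _ IH' x|a h _ IH x|h h' _ IH _ IH' x] Sx.
- by rewrite mulr1.
- exact: SM.
- by rewrite mulrDr; apply: SD; auto.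
- by rewrite -scalerAr; auto.
- by rewrite mulrA; auto.
Qed.

Lemma inAlg_block h : inAlg (block_gen b) h -> forall u, ~~ block_perm b u -> coef h u = 0.
Proof.
move=> hb; rewrite -[h]mulr1.
apply: (@inAlg_ind2 _ (fun x => forall u, ~~ block_perm b u -> coef x u = 0)) hb _.
- by move=> a x xs u ub; rewrite coefZ xs ?mulr0.
- by move=> x z xs zs u ub; rewrite coefD xs ?zs ?addr0.
- move=> i x bi xs u ub; rewrite coef_gen xs; last first.
    by apply: contra ub => ub; rewrite -(sgenK i u) block_permM ?block_gen_perm.
  by rewrite xs // mulr0 if_same addr0.
- move=> u ub; rewrite -Tw1 coef_Tw (_ : u == 1%g = false) //.
  by apply: contraNF ub => /eqP ->; apply: block_perm1.
Qed.

Lemma coef_minrep d h : minrep b d -> inAlg (block_gen b) h ->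
  coef (Tw Q d * h) d = coef h 1%g.
Proof.
move=> dm hb; rewrite {1}(Tw_expand h) mulr_sumr coef_sum (bigD1 1%g) //= big1.
  by rewrite addr0 -scalerAr Tw1 mulr1 coefZ coef_Tw eqxx mulr1.
move=> u u1; rewrite -scalerAr coefZ; case: (boolP (block_perm b u)) => ub; last first.
  by rewrite (inAlg_block hb) // mul0r.
rewrite -Tw_minrep // coef_Tw -{1}(mulg1 d) (inj_eq (mulgI d)) eq_sym (negPf u1).
by rewrite mulr0.
Qed.

End YoungHecke.

(** * Trace functions *)

Lemma perm_swap_mid (T : eqType) (s1 s2 t : seq T) (i : T) :
  perm_eq ((s2 ++ s1) ++ i :: t) ((s1 ++ i :: s2) ++ t).
Proof. by apply/seq.permP => a; rewrite !count_cat /=; lia. Qed.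

Section Traces.
Variables (R : comNzRingType) (Q : R) (n : nat).
Local Notation H := (hecke Q n).
Implicit Types (i j : 'I_n.-1) (h x : H) (P : pred 'I_n.-1) (s t r : seq 'I_n.-1).

Definition incr : rel 'I_n.-1 := fun i j => (i < j)%N.

Lemma incr_trans : transitive incr. Proof. by move=> i j k; apply: ltn_trans. Qed.
Lemma incr_irr : irreflexive incr. Proof. by move=> i; rewrite /incr ltnn. Qed.

Lemma sorted_enum (A : {set 'I_n.-1}) : sorted incr (enum A).
Proof.
rewrite /enum_mem; apply: sorted_filter; first exact: incr_trans.
rewrite -enumT; have := iota_ltn_sorted 0 n.-1.
by rewrite -val_enum_ord sorted_map.
Qed.

Lemma enum_incr s : sorted incr s -> enum [set i in s] = s.
Proof.
move=> ss; apply: (irr_sorted_eq incr_trans incr_irr) => //; first exact: sorted_enum.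
by move=> i; rewrite mem_enum inE.
Qed.

Lemma incr_sorted_eq s t : sorted incr s -> sorted incr t -> s =i t -> s = t.
Proof. exact: (irr_sorted_eq incr_trans incr_irr). Qed.

Lemma hword_far i s : all (far i) s -> hgen Q i * hword Q s = hword Q s * hgen Q i.
Proof.
elim: s => [|j s IHs]; first by rewrite hword_nil mul1r mulr1.
move=> /andP[ij fs]; rewrite hword_cons mulrA hgen_comm // -!mulrA.
by rewrite IHs.
Qed.

Lemma hword_farL s t : all (fun i => all (far i) t) s ->
  hword Q s * hword Q t = hword Q t * hword Q s.
Proof.
elim: s => [|j s IHs]; first by rewrite hword_nil mul1r mulr1.
move=> /andP[ij fs]; rewrite hword_cons -mulrA IHs // mulrA hword_far //.
by rewrite -mulrA.
Qed.

(* Splitting at the largest letter and rotating leaves a word in smaller letters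
   followed by an increasing one. *)
Lemma distinct_word_aux (T : Type) (phi : H -> T) P :
    (forall s t, all P s -> all P t ->
       phi (hword Q s * hword Q t) = phi (hword Q t * hword Q s)) ->
  forall m s t, uniq s -> all P s -> all P t -> all (fun i => i < m)%N s ->
    all (fun i => m <= i)%N t -> sorted incr t ->
  exists r, [/\ sorted incr r, perm_eq r (s ++ t) &
    phi (hword Q s * hword Q t) = phi (hword Q r)].
Proof.
move=> phiP; elim=> [|m IHm] s t us Ps Pt sm tm st.
  by case: s us Ps sm => // *; exists t; rewrite hword_nil mul1r.
have [/hasP[i si im]|/hasPn nm] := boolP (has (fun i : 'I_n.-1 => i == m :> nat) s); last first.
  apply: IHm => //; last by apply: sub_all tm => i; apply: ltnW.
  apply/allP => i si; have := allP sm i si; have := nm i si.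
  by rewrite ltnS leq_eqVlt => /negPf ->.
case/splitPr: si us Ps sm => s1 s2; rewrite cat_uniq cons_uniq.
move=> /and3P[u1 /norP[i1 hs12] /andP[i2 u2]]; rewrite !all_cat /= => /and3P[P1 Pi P2].
move=> /and3P[s1m _ s2m].
have sub s' : all (fun j : 'I_n.-1 => j < m.+1)%N s' -> i \notin s' ->
    all (fun j : 'I_n.-1 => j < m)%N s'.
  move=> s'm is'; apply/allP => j js'; have := allP s'm _ js'.
  rewrite ltnS leq_eqVlt => /orP[/eqP jm|//]; case/negP: is'.
  by rewrite (_ : i = j) //; apply/val_inj; rewrite /= (eqP im) jm.
have s1l := sub _ s1m i1; have s2l := sub _ s2m i2.
have [||||||r [sr pr phr]] := IHm (s2 ++ s1) (i :: t).
- rewrite cat_uniq u1 u2 andbT /=; apply/hasPn => j j1; apply/negP => j2.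
  by case/hasP: hs12; exists j.
- by rewrite all_cat P1 P2.
- by rewrite /= Pi Pt.
- by rewrite all_cat s1l s2l.
- rewrite /= (eqP im) leqnn; apply: sub_all tm => j; exact: ltnW.
- rewrite /= path_min_sorted //; apply: sub_all tm => j; rewrite /incr (eqP im) //.
exists r; split=> //.
  exact/(perm_trans pr)/perm_swap_mid.
rewrite -phr !hword_cat !hword_cons -!mulrA.
(* Letters of [s2] are below [m], those of [t] above [m], so they differ by at least two. *)
have c2 : hword Q s2 * hword Q t = hword Q t * hword Q s2.
  apply: hword_farL; apply/allP => j j2; apply/allP => k kt.
  by apply/orP; left; apply: leq_ltn_trans (allP s2l _ j2) (allP tm _ kt).
have -> : hword Q s1 * (hgen Q i * (hword Q s2 * hword Q t))
    = hword Q (s1 ++ i :: t) * hword Q s2.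
  by rewrite c2 hword_cat hword_cons !mulrA.
rewrite phiP ?all_cat /= ?P1 ?P2 ?Pi //.
by rewrite hword_cat hword_cons !mulrA.
Qed.

(** Symmetry of [phi] is asked only on words in [P]: the form [tau (gam * _)], to which this is
    applied, is shown to be symmetric on the Young subalgebra. *)
Lemma distinct_word (T : Type) (phi : H -> T) P s t :
    (forall s t, all P s -> all P t ->
       phi (hword Q s * hword Q t) = phi (hword Q t * hword Q s)) ->
  uniq s -> uniq t -> all P s -> s =i t -> phi (hword Q s) = phi (hword Q t).
Proof.
move=> phiP us ut Ps st.
have Pt : all P t by rewrite -(eq_all_r st).
have aux r : uniq r -> all P r -> exists r', [/\ sorted incr r', r' =i r &
    phi (hword Q r) = phi (hword Q r')].
  move=> ur Pr; have [||||r' [sr' pr' e]] := distinct_word_aux phiP (m := n.-1) (t := [::]) ur Pr.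
  - by [].
  - by apply/allP => i _; apply: ltn_ord.
  - by [].
  - by [].
  exists r'; split=> //; first by move=> i; rewrite (perm_mem pr') cats0.
  by rewrite -e hword_nil mulr1.
have [s' [ss' es' ->]] := aux s us Ps; have [t' [st' et' ->]] := aux t ut Pt.
by rewrite (@incr_sorted_eq s' t') // => i; rewrite es' et' st.
Qed.

Definition trace (phi : H -> R) : Prop :=
  [/\ forall x y, phi (x + y) = phi x + phi y, forall a x, phi (a *: x) = a * phi x
    & forall x y, phi (x * y) = phi (y * x)].

Lemma trace_word phi s t : trace phi -> uniq s -> uniq t -> s =i t ->
  phi (hword Q s) = phi (hword Q t).
Proof.
move=> [_ _ tC] us ut; apply: (@distinct_word _ phi predT) => //.
exact: all_predT.
Qed.

Lemma trace0 phi : trace phi -> phi 0 = 0.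
Proof. by move=> [_ tZ _]; rewrite -(scale0r 0) tZ mul0r. Qed.

Lemma trace_central z : hcentral z -> trace (fun x => coef (z * x) 1%g).
Proof.
move=> zC; split=> [x y|a x|x y]; first by rewrite mulrDr coefD.
  by rewrite -scalerAr coefZ.
by rewrite mulrA coef_tauC mulrA -zC mulrA.
Qed.

(* [dec m i] is [H_m + H_m g_i H_m] for [i = m :> nat], where [H_m] is generated by
   the [g_j] with [j < m]. *)
Inductive dec (m : nat) (i : 'I_n.-1) : H -> Prop :=
  | dec_low a : inAlg (fun j => j < m)%N a -> dec m i a
  | dec_gen a c : inAlg (fun j => j < m)%N a -> inAlg (fun j => j < m)%N c ->
      dec m i (a * hgen Q i * c)
  | decD x y : dec m i x -> dec m i y -> dec m i (x + y).

Lemma inAlg_pred0 P h : P =1 pred0 -> inAlg P h -> exists a, h = a%:A.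
Proof.
move=> P0; elim=> {h}.
- by exists 1; rewrite scale1r.
- by move=> i; rewrite P0.
- by move=> _ _ _ [a ->] _ [a' ->]; exists (a + a'); rewrite scalerDl.
- by move=> a _ _ [a' ->]; exists (a * a'); rewrite scalerA.
- by move=> _ _ _ [a ->] _ [a' ->]; exists (a * a'); rewrite mulr_algl scalerA.
Qed.

Lemma low_comm m (i : 'I_n.-1) a : (m < i)%N -> inAlg (fun j => j < m)%N a ->
  hgen Q i * a = a * hgen Q i.
Proof.
move=> mi; apply: inAlg_comm => j jm; apply: hgen_comm; rewrite /far; lia.
Qed.

(** The set [dec] is stable under left multiplication by generators. The critical product is
    [g_i a g_i c]: decompose [a] one level lower; its low part commutes with [g_i], which leaves a
    square, and in its other part the braid relation turns [g_i g_k g_i] into [g_k g_i g_k]. *)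
Lemma decP m i h : i = m :> nat -> inAlg (fun j => j < m.+1)%N h -> dec m i h.
Proof.
elim: m i h => [|m IHm] i h im hh.
all: rewrite -[h]mulr1; apply: (inAlg_ind2 (S := dec _ i)) hh _ => [b x|x y|j x jm|];
  [ elim=> {x} [a aa|a c aa cc|x y _ hx _ hy];
    [ exact/dec_low/inAlgZ | by rewrite !scalerAl; apply: dec_gen; [apply: inAlgZ|]
    | by rewrite scalerDr; apply: decD ]
  | exact: decD | | exact/dec_low/inAlg1 ].
all: have [jl|jl] := ltnP j i; [| have {jl jm} -> : j = i by apply/val_inj => /=; lia].
- by move: jl; rewrite im.
- elim=> {x} [a aa|a c aa cc|x y _ hx _ hy]; last by rewrite mulrDr; apply: decD.
    by rewrite -[X in X * a]mul1r; apply: dec_gen => //; apply: inAlg1.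
  have [e ->] := inAlg_pred0 (fun j => ltn0 j) aa.
  rewrite -mulrA mulr_algl -scalerAr mulrA hgen_quad mulrDl mul1r scalerDr.
  apply: decD; last exact/dec_low/inAlgZ.
  rewrite -scalerAl scalerA -[X in X * c]mul1r !scalerAl.
  by apply: dec_gen => //; apply/inAlgZ/inAlg1.
- have aj : inAlg (fun k => k < m.+1)%N (hgen Q j) by apply: inAlg_gen; rewrite -im.
  elim=> {x} [a aa|a c aa cc|x y _ hx _ hy]; last by rewrite mulrDr; apply: decD.
    exact/dec_low/inAlgM.
  by rewrite !mulrA; apply: dec_gen => //; apply: inAlgM.
- elim=> {x} [a aa|a c aa cc|x y _ hx _ hy]; last by rewrite mulrDr; apply: decD.
    by rewrite -[X in X * a]mul1r; apply: dec_gen => //; apply: inAlg1.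
  have lt : (m < n.-1)%N by have := ltn_ord i; lia.
  pose k : 'I_n.-1 := Ordinal lt.
  have sub x : inAlg (fun j => j < m)%N x -> inAlg (fun j => j < m.+1)%N x.
    by apply: inAlgS => l; apply: ltnW.
  have mi : (m < i)%N by rewrite im.
  rewrite !mulrA; have := IHm k a erefl aa; elim=> {a aa} [a aa|a e aa ee|x y _ hx _ hy].
  + rewrite (low_comm mi aa) -[a * _ * _]mulrA hgen_quad mulrDr mulr1 mulrDl -scalerAr.
    apply: decD; last by apply/dec_low/inAlgM => //; apply: sub.
    by rewrite scalerAl; apply: dec_gen => //; apply/inAlgZ/sub.
  + have -> : hgen Q i * (a * hgen Q k * e) * hgen Q i * c
        = (a * hgen Q k) * hgen Q i * (hgen Q k * e * c).
      rewrite !mulrA (low_comm mi aa) -!mulrA; congr (a * _).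
      rewrite !mulrA -(mulrA _ e) -(low_comm mi ee) !mulrA; congr (_ * e * c).
      by rewrite (@hgen_braid _ _ _ k i).
    have ak : inAlg (fun j => j < m.+1)%N (hgen Q k) by apply: inAlg_gen.
    by apply: dec_gen; repeat apply: inAlgM; rewrite //; apply: sub.
  + by rewrite mulrDr !mulrDl; apply: decD.
Qed.

(** Stands for membership of the class of [h] in the span of the increasing words modulo
    commutators; one family [c] serves all trace functions. *)
Definition spanned h := exists c : {ffun {set 'I_n.-1} -> R}, forall phi, trace phi ->
  phi h = \sum_A c A * phi (hword Q (enum A)).

Lemma spannedD h h' : spanned h -> spanned h' -> spanned (h + h').
Proof.
move=> [c hc] [c' hc']; exists [ffun A => c A + c' A] => phi tp.
have [tD _ _] := tp; rewrite tD hc // hc' // -big_split /=.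
by apply: eq_bigr => A _; rewrite ffunE mulrDl.
Qed.

Lemma spannedZ a h : spanned h -> spanned (a *: h).
Proof.
move=> [c hc]; exists [ffun A => a * c A] => phi tp.
have [_ tZ _] := tp; rewrite tZ hc // mulr_sumr.
by apply: eq_bigr => A _; rewrite ffunE mulrA.
Qed.

Lemma spanned_eq h h' : (forall phi, trace phi -> phi h = phi h') -> spanned h' -> spanned h.
Proof. by move=> e [c hc]; exists c => phi tp; rewrite e // hc. Qed.

Lemma spanned_word s : sorted incr s -> spanned (hword Q s).
Proof.
move=> ss; exists [ffun A => (A == [set i in s])%:R] => phi tp.
rewrite (bigD1 [set i in s]) //= ffunE eqxx mul1r enum_incr // big1 ?addr0 // => A ne.
by rewrite ffunE (negPf ne) mul0r.
Qed.

Lemma spanned_aux m h s : inAlg (fun j => j < m)%N h -> sorted incr s ->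
  all (fun j => m <= j)%N s -> spanned (h * hword Q s).
Proof.
elim: m h s => [|m IHm] h s hh ss sm.
  have [a ->] := inAlg_pred0 (fun j => ltn0 j) hh.
  by rewrite mulr_algl; apply/spannedZ/spanned_word.
have sm' : all (fun j => m <= j)%N s by apply: sub_all sm => j; apply: ltnW.
have [lt|ge] := ltnP m n.-1; last first.
  by apply: IHm => //; apply: inAlgS hh => j _; apply: leq_trans (ltn_ord j) ge.
have := @decP m (Ordinal lt) h erefl hh; elim=> {h hh} [a aa|a c aa cc|x y _ hx _ hy].
- exact: IHm.
- apply: (@spanned_eq _ ((c * a) * hword Q (Ordinal lt :: s))).
    move=> phi [_ _ tC]; rewrite -!mulrA.
    (* [c] involves letters below [m], [s] letters above [m]; once behind [s], the factor [c] can be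
       rotated to the front. *)
    have -> : c * hword Q s = hword Q s * c.
      apply/esym; apply: inAlg_comm cc => j jm; apply/esym/hword_far.
      by apply/allP => k ks; have := allP sm _ ks; rewrite /far; lia.
    by rewrite !mulrA tC hword_cons !mulrA.
  apply: IHm => //=; first exact: inAlgM.
    by rewrite path_min_sorted.
  by rewrite leqnn.
- by rewrite mulrDl; apply: spannedD.
Qed.

Lemma spannedP h : spanned h.
Proof.
rewrite -[h]mulr1 -(hword_nil Q n); apply: (@spanned_aux n.-1) => //.
by apply: inAlgS (inAlgT h) => j _; apply: ltn_ord.
Qed.

End Traces.

(** * Jucys-Murphy elements *)

Section JucysMurphy.
Variables (R : comNzRingType) (Q : R) (n : nat) (b : 'I_n -> nat).
Hypothesis b_homo : forall x y : 'I_n, (x <= y)%N -> (b x <= b y)%N.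
Local Notation H := (hecke Q n).
Local Notation g := (hgen Q).
Implicit Types (i j k : 'I_n.-1) (x y z : 'I_n) (h : H).

Lemma ord_eqE x y : (x == y) = (x == y :> nat). Proof. by []. Qed.

Lemma gen_eqE i j : (i == j) = (i == j :> nat). Proof. by []. Qed.

Lemma tperm_hi k x : (x < k)%N ->
  tperm x (hi k) = (sgen k * tperm x (lo k) * sgen k)%g.
Proof.
move=> xk; rewrite -{1}(sgenV k) -mulgA -conjgE tpermJ sgen_lo.
by congr tperm; apply/val_inj; rewrite /= sgen_val; liaif.
Qed.

Lemma tperm_lo k z : (k.+1 < z)%N ->
  tperm (lo k) z = (sgen k * tperm (hi k) z * sgen k)%g.
Proof.
move=> xk; rewrite -{1}(sgenV k) -mulgA -conjgE tpermJ sgen_hi.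
by congr tperm; apply/val_inj; rewrite /= sgen_val; liaif.
Qed.

Lemma Tw_conj k t : (t * t = 1)%g -> ~~ desc t k -> ~~ desc (t * sgen k)%g k ->
  Tw Q (sgen k * t * sgen k)%g = g k * Tw Q t * g k.
Proof.
move=> /eqP; rewrite -eq_invg_mul => /eqP tV d1 d2.
by rewrite hgen_Tw (negPf d1) addr0 Tw_hgen /rdesc invMg sgenV tV (negPf d2) addr0.
Qed.

Lemma Tw_tperm_hi k x : (x < k)%N ->
  Tw Q (tperm x (hi k)) = g k * Tw Q (tperm x (lo k)) * g k.
Proof.
move=> xk; rewrite tperm_hi // Tw_conj ?tperm2 //.
  by rewrite /desc tpermR tpermD ?ord_eqE /=; lia.
have e : tperm x (lo k) (hi k) = hi k by rewrite tpermD // ord_eqE /=; lia.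
rewrite /desc !permM e (tpermR x (lo k)).
by rewrite !sgen_val /=; liaif.
Qed.

Lemma Tw_tperm_lo k z : (k.+1 < z)%N ->
  Tw Q (tperm (lo k) z) = g k * Tw Q (tperm (hi k) z) * g k.
Proof.
move=> kz; rewrite tperm_lo // Tw_conj ?tperm2 //.
  by rewrite /desc tpermL tpermD ?ord_eqE /=; lia.
have e : tperm (hi k) z (lo k) = lo k by rewrite tpermD // ord_eqE /=; lia.
rewrite /desc !permM e (tpermL (hi k) z).
by rewrite !sgen_val /=; liaif.
Qed.

Lemma Tw_comm k t : (t * t = 1)%g -> (sgen k * t = t * sgen k)%g ->
  g k * Tw Q t = Tw Q t * g k.
Proof.
move=> /eqP; rewrite -eq_invg_mul => /eqP tV kt.
by rewrite hgen_Tw Tw_hgen kt /rdesc tV.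
Qed.

Lemma Tw_tperm_comm k x z : x != lo k -> x != hi k -> z != lo k -> z != hi k ->
  g k * Tw Q (tperm x z) = Tw Q (tperm x z) * g k.
Proof.
move=> xl xh zl zh; apply: Tw_comm; first exact: tperm2.
have -> : sgen k = tperm (lo k) (hi k) by [].
by apply: (mulgI (tperm x z)^-1%g); rewrite mulKg -conjgE tpermJ !tpermD.
Qed.

(** With [t = T_(k+1,z)] the sum is [g t g + t], which commutes with [g] by the quadratic
    relation. *)
Lemma Tw_tperm_pair k z : (k.+1 < z)%N ->
  let x := Tw Q (tperm (lo k) z) + Tw Q (tperm (hi k) z) in g k * x = x * g k.
Proof.
move=> kz /=; rewrite Tw_tperm_lo //; set t := Tw _ _.
rewrite mulrDr mulrDl !mulrA hgen_quad -[_ * t * _ * _]mulrA hgen_quad.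
rewrite !mulrDl !mulrDr !mul1r !mulr1 -!scalerAl -!scalerAr -!addrA.
by congr (_ + _); rewrite [RHS]addrC.
Qed.

Definition jm (z : 'I_n) : H :=
  \sum_(x : 'I_n | (x < z)%N && (b x == b z)) Tw Q (tperm x z).

Definition nonfirst (z : 'I_n) := [exists x : 'I_n, (x < z)%N && (b x == b z)].

Lemma jm_first z : ~~ nonfirst z -> jm z = 0.
Proof.
move=> /existsPn nf; apply: big_pred0 => x; exact/negbTE.
Qed.

Lemma jm_hi k : block_gen b k -> jm (hi k) = g k * jm (lo k) * g k + g k.
Proof.
move=> /eqP bk; rewrite /jm (bigD1 (lo k)) /=; last by rewrite bk eqxx andbT.
rewrite addrC Tw_gen; congr (_ + _).
rewrite mulr_sumr mulr_suml; apply: eq_big => x.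
  by rewrite bk -andbA [(b x == _) && _]andbC andbA; congr andb; rewrite ord_eqE /=; lia.
by move=> /andP[/andP[xk _] xl]; apply: Tw_tperm_hi; move: xk xl; rewrite ord_eqE /=; lia.
Qed.

(** The terms at [lo k] and [hi k] occur together or not at all, and their sum commutes with [g k];
    every other term commutes by itself. *)
Lemma jm_comm k z : block_gen b k -> z != lo k -> z != hi k -> g k * jm z = jm z * g k.
Proof.
move=> /eqP bk zl zh.
have cond : ((lo k < z)%N && (b (lo k) == b z)) = ((hi k < z)%N && (b (hi k) == b z)).
  by rewrite bk; congr andb; move: zl zh; rewrite !ord_eqE /=; lia.
have comm_rest : g k * (\sum_(x : 'I_n | [&& (x < z)%N && (b x == b z), x != lo k & x != hi k])
    Tw Q (tperm x z)) = (\sum_(x : 'I_n | [&& (x < z)%N && (b x == b z), x != lo k & x != hi k])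
    Tw Q (tperm x z)) * g k.
  rewrite mulr_sumr mulr_suml; apply: eq_bigr => x /and3P[_ xl xh].
  exact: Tw_tperm_comm.
have [c|c] := boolP ((lo k < z)%N && (b (lo k) == b z)); last first.
  suff -> : jm z = \sum_(x : 'I_n | [&& (x < z)%N && (b x == b z), x != lo k & x != hi k])
    Tw Q (tperm x z) by [].
  apply: eq_bigl => x; case: (eqVneq x (lo k)) => [->|_]; first by rewrite (negPf c).
  by case: (eqVneq x (hi k)) => [->|_]; rewrite ?andbT // -cond (negPf c).
have -> : jm z = Tw Q (tperm (lo k) z) + Tw Q (tperm (hi k) z) +
    \sum_(x : 'I_n | [&& (x < z)%N && (b x == b z), x != lo k & x != hi k]) Tw Q (tperm x z).
  rewrite /jm (bigD1 (lo k)) //= (bigD1 (hi k)) /=; last first.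
    by rewrite -cond c ord_eqE /=; lia.
  by rewrite addrA; congr (_ + _); apply: eq_bigl => x; rewrite -!andbA.
rewrite mulrDr mulrDl comm_rest Tw_tperm_pair //.
by move: c; rewrite cond => /andP[].
Qed.

Definition below_gen (m : nat) : pred 'I_n.-1 := fun i => block_gen b i && (i < m)%N.

Lemma Tw_tperm_inAlg (x z : 'I_n) : (x < z)%N -> b x = b z ->
  inAlg (below_gen z) (Tw Q (tperm x z)).
Proof.
move: {2}(z : nat) (erefl (z : nat)) => m; elim: m x z => [|m IHm] x z zm xz bxz.
  by rewrite zm in xz.
have lt : (m < n.-1)%N by have := ltn_ord z; lia.
pose k : 'I_n.-1 := Ordinal lt; have zE : z = hi k by apply: val_inj.
have bk : block_gen b k.
  have h1 : (b x <= b (lo k))%N by apply: b_homo; rewrite /=; lia.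
  have h2 : (b (lo k) <= b (hi k))%N by apply: b_homo => /=.
  by rewrite zE in bxz; apply/eqP; lia.
have gk : inAlg (below_gen z) (g k) by apply: inAlg_gen; rewrite /below_gen bk zm /=.
have [xm|xm] : (x < m)%N \/ x = m :> nat by lia.
  rewrite zE in gk *; rewrite (@Tw_tperm_hi k) //; apply: inAlgM => //; apply: inAlgM => //.
  apply: inAlgS (IHm _ (lo k) _ _ _) => //.
    by move=> i; rewrite /below_gen => /andP[-> /=]; lia.
  by rewrite zE in bxz; rewrite bxz (eqP bk).
have -> : x = lo k by apply: val_inj.
by rewrite zE Tw_gen -zE.
Qed.

Lemma jm_inAlg z : inAlg (below_gen z) (jm z).
Proof.
by apply: inAlg_sum => x /andP[xz /eqP bxz]; apply: Tw_tperm_inAlg.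
Qed.

Lemma jm_jm_comm k : block_gen b k -> jm (hi k) * jm (lo k) = jm (lo k) * jm (hi k).
Proof.
move=> bk; apply: inAlg_comm (jm_inAlg (lo k)) => i /andP[bi ik].
by apply/esym/jm_comm => //; rewrite ord_eqE /=; move: ik; rewrite /=; lia.
Qed.

(** Formal consequence of the quadratic relation and of the commutation of [x] with [t x t + t]. *)
Lemma jm_pair k : block_gen b k ->
  g k * (jm (lo k) * jm (hi k)) = (jm (lo k) * jm (hi k)) * g k.
Proof.
move=> bk; have := jm_jm_comm bk; rewrite jm_hi //; set x := jm (lo k); set t := g k.
have tq : t * t = Q *: t + 1 by apply: hgen_quad.
rewrite mulrDl mulrDr => e.
transitivity (t * (x * (t * x * t)) + t * (x * t)); first by rewrite !mulrDr.
have e' : x * (t * x * t) = t * x * t * x + t * x - x * t by rewrite e addrK.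
rewrite {1}e' !mulrDr mulrN subrK !mulrDl.
have tt a : t * (t * a) = Q *: (t * a) + a.
  by rewrite mulrA tq mulrDl mul1r -scalerAl.
have tt' a : a * t * t = Q *: (a * t) + a.
  by rewrite -mulrA tq mulrDr mulr1 -scalerAr.
rewrite -!(mulrA t) !tt !mulrA !tt'.
have e2 : x * t * x * t + x * t = t * x * t * x + t * x by rewrite e !mulrA.
rewrite !addrA [LHS](_ : _ = Q *: (t * x * t * x + t * x) + (x * t * x + x)); last first.
  by rewrite scalerDr -!addrA; congr (_ + _); rewrite addrCA.
by rewrite -e2 scalerDr -!addrA; congr (_ + _); rewrite addrCA.
Qed.

(** The Jucys-Murphy element of a first position is 0 and is replaced by 1. Indexing by natural
    numbers allows the product to be split and peeled from the end. *)
Definition gfac (m : nat) : H :=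
  if insub m is Some z then (if nonfirst z then jm z else 1) else 1.
Definition gam (m : nat) : H := \prod_(0 <= l < m) gfac l.

Lemma gfacE z : gfac z = if nonfirst z then jm z else 1.
Proof. by rewrite /gfac insubT //= => lt; congr (if nonfirst _ then jm _ else _); apply: val_inj. Qed.

Lemma gfac_hi k : block_gen b k -> gfac k.+1 = jm (hi k).
Proof.
move=> bk; rewrite -[k.+1]/(hi k : nat) gfacE (_ : nonfirst _ = true) //.
by apply/existsP; exists (lo k); rewrite /= ltnSn.
Qed.

Lemma gfac_comm k (l : nat) : block_gen b k -> l != k -> l != k.+1 -> g k * gfac l = gfac l * g k.
Proof.
move=> bk lk lk1; rewrite /gfac; case: insubP => [z _ zl|_]; last by rewrite mulr1 mul1r.
case: ifP => _; last by rewrite mulr1 mul1r.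
by apply: jm_comm => //; rewrite ord_eqE /= zl.
Qed.

(** Only the factors at [k] and [k+1] can fail to commute with [g k], and their product does
    commute. *)
Lemma gam_comm k : block_gen b k -> g k * gam n = gam n * g k.
Proof.
move=> bk; have kn := sgen_subproof2 k.
have comm_prod lo hi : (forall l, (lo <= l < hi)%N -> g k * gfac l = gfac l * g k) ->
    g k * (\prod_(lo <= l < hi) gfac l) = (\prod_(lo <= l < hi) gfac l) * g k.
  move=> hl; rewrite big_nat_cond; elim/big_rec: _ => [|l x]; first by rewrite mulr1 mul1r.
  by rewrite andbT => ll e; rewrite mulrA hl // -mulrA e mulrA.
rewrite /gam (big_cat_nat (n := k)) //=; last by have := ltn_ord k; lia.
rewrite [\prod_(k <= _ < n) _]big_ltn ?(ltnW kn) // [\prod_(k.+1 <= _ < n) _]big_ltn // (mulrA (gfac k)).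
have e1 := @comm_prod 0 k; have e2 := @comm_prod k.+2 n.
rewrite mulrA e1; last by move=> l lk; apply: gfac_comm => //; lia.
have e3 : g k * (gfac k * gfac k.+1) = gfac k * gfac k.+1 * g k.
  rewrite gfac_hi // -[k : nat]/(lo k : nat) gfacE; case: ifPn => [_|nf]; first exact: jm_pair.
  (* If [lo k] is first in its block, its factor is 1 and the next factor is [g k] itself. *)
  by rewrite mul1r jm_hi // jm_first // mulr0 mul0r add0r.
rewrite -mulrA [g k * _]mulrA e3 -mulrA e2 ?mulrA //.
by move=> l lk; apply: gfac_comm => //; lia.
Qed.

Lemma gam_inAlg m : inAlg (fun i => block_gen b i && (i.+1 < m)%N) (gam m).
Proof.
rewrite /gam big_nat_cond; elim/big_ind: _ => [||l]; first exact: inAlg1.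
  exact: inAlgM.
rewrite andbT => /andP[_ lm]; rewrite /gfac; case: insubP => [z _ zl|_]; last exact: inAlg1.
case: ifP => _; last exact: inAlg1.
by apply: inAlgS (jm_inAlg z) => i /andP[-> /=]; rewrite zl; lia.
Qed.

Definition low (k : nat) : pred 'I_n.-1 := fun i => (i < k)%N.

Lemma low_coef0 k h (u : 'S_n) (x : 'I_n) : inAlg (low k) h -> (x <= k)%N -> (k < u x)%N ->
  coef h u = 0.
Proof.
(* Two blocks, the positions up to [k] and the others: [h] lies in their Young subalgebra, and [u]
   does not preserve them. *)
move=> hl xk ux; pose b' (z : 'I_n) : nat := (k < z)%N.
apply: (@inAlg_block R Q n b') => //.
  by apply: inAlgS hl => i ik; rewrite /block_gen /b' /=; move: ik; rewrite /low; lia.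
by apply/negP => /block_permP/(_ x); rewrite /b' ux ltnNge xk.
Qed.

Lemma jm_tau0 k h : inAlg (low k) h -> coef (jm (hi k) * h) 1%g = 0.
Proof.
move=> hl; rewrite coef_tauC mulr_sumr coef_sum big1 // => x /andP[xk _].
rewrite coef_tau tpermV; apply: (low_coef0 (x := x) hl) => //.
by rewrite tpermL.
Qed.

Lemma gen_tau0 k h h' : inAlg (low k) h -> inAlg (low k) h' ->
  coef (h * (g k * h')) 1%g = 0.
Proof.
move=> hl hl'; rewrite mulrA coef_tauC mulrA -Tw_gen coef_tau sgenV.
apply: (low_coef0 (x := lo k) (inAlgM hl' hl)) => //=.
by rewrite sgen_lo.
Qed.

Lemma jm_gen k : block_gen b k ->
  jm (hi k) * g k = Q *: jm (hi k) + g k * jm (lo k) + 1.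
Proof.
move=> bk; rewrite jm_hi // mulrDl -!mulrA !hgen_quad !mulrDr !mulr1 scalerDr.
by rewrite -!scalerAr !addrA; congr (_ + _); rewrite addrAC.
Qed.

Lemma nonfirst_gen (z : 'I_n) : nonfirst z -> exists2 k, block_gen b k & z = hi k.
Proof.
move=> /existsP[x /andP[xz /eqP bxz]].
have lt : (z.-1 < n.-1)%N by have := ltn_ord z; lia.
have zE : z = hi (Ordinal lt) by apply: val_inj => /=; lia.
exists (Ordinal lt) => //; rewrite /block_gen eqn_leq -zE.
by rewrite -{2}bxz !b_homo //=; lia.
Qed.

(** The word decreases, so its largest letter [k] meets the last factor of [gam]. If [k] is missing
    the trace vanishes by [jm_tau0]; otherwise [jm_gen] gives three terms, of which only the
    constant 1 survives under the trace, and both [k] and the factor disappear. *)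
Lemma coef_gam_sorted m s : sorted (@incr n) s -> all (block_gen b) s ->
    all (fun i : 'I_n.-1 => i.+1 < m)%N s ->
  coef (gam m * hword Q (rev s)) 1%g =
    [forall i : 'I_n.-1, block_gen b i && (i.+1 < m)%N ==> (i \in s)]%:R.
Proof.
elim: m s => [|m IHm] s ss sb sm.
  case: s sm {ss sb} => // _; rewrite /gam big_nil mul1r hword_nil -Tw1 coef_Tw eqxx.
  by rewrite (_ : [forall _, _] = true) //; apply/forallP => i; rewrite andbF.
have gS : gam m.+1 = gam m * gfac m by rewrite /gam big_nat_recr.
have [/existsP[k /andP[bk /eqP km]]|/existsPn nk] :=
    boolP [exists k : 'I_n.-1, block_gen b k && (k.+1 == m)]; last first.
  have g1 : gfac m = 1.
    rewrite /gfac; case: insubP => // z _ zm; case: ifP => // /nonfirst_gen[k bk zk].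
    by have := nk k; rewrite bk -zm zk eqxx.
  rewrite gS g1 mulr1 IHm //.
    congr (nat_of_bool _)%:R; apply: eq_forallb => i; congr (_ ==> _).
    by have := nk i; case: (block_gen b i) => //=; lia.
  apply/allP => i si; have := allP sm i si; have := nk i; rewrite (allP sb) //=.
  by rewrite ltnS leq_eqVlt => /negPf ->.
have gl : inAlg (low k) (gam m).
  by apply: inAlgS (gam_inAlg m) => i /andP[_]; rewrite -km ltnS.
rewrite gS -km gfac_hi // km.
have small i : i \in s -> i != k -> (i < k)%N.
  by move=> /(allP sm) /=; rewrite gen_eqE -km; lia.
have [ks|ks] := boolP (k \in s); last first.
  rewrite coef_tauC mulrA coef_tauC jm_tau0; last first.
    apply: inAlgM => //; apply: inAlg_word; rewrite all_rev; apply/allP => i si.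
    by apply: small => //; apply: contraNneq ks => <-.
  rewrite (_ : [forall _, _] = false) //; apply/forallP => /(_ k).
  by rewrite bk km leqnn (negPf ks).
pose s' := [seq i : 'I_n.-1 <- s | (i < k)%N].
have ss' : sorted (@incr n) s' by apply: sorted_filter ss; apply: incr_trans.
have sE : s = rcons s' k.
  apply: incr_sorted_eq => // [|i].
    rewrite sorted_pairwise; last exact: incr_trans.
    rewrite -cats1 pairwise_cat -(sorted_pairwise (@incr_trans n)) ss' allrel1r /= andbT.
    by apply/allP => i; rewrite mem_filter => /andP[].
  rewrite mem_rcons inE mem_filter; case: eqVneq => [->//|ik] /=.
  by case: (boolP (i \in s)) => si; rewrite ?andbF // small.
have s'l : all (low k) s' by apply/allP => i; rewrite mem_filter => /andP[].
rewrite sE rev_rcons hword_cons -!mulrA [jm _ * _]mulrA jm_gen // !mulrDl !mulrDr.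
rewrite !coefD mul1r -scalerAl -scalerAr coefZ.
have wl : inAlg (low k) (hword Q (rev s')) by apply: inAlg_word; rewrite all_rev.
have jl : inAlg (low k) (jm (lo k)).
  by apply: inAlgS (jm_inAlg (lo k)) => i /andP[].
rewrite (coef_tauC (gam m) (jm (hi k) * _)) -(mulrA (jm _)) jm_tau0 ?mulr0 ?add0r; last exact: inAlgM.
rewrite -(mulrA (g k)) gen_tau0 ?add0r //; last exact: inAlgM.
rewrite IHm //.
- congr (nat_of_bool _)%:R; apply: eq_forallb => i; rewrite mem_rcons inE -km !ltnS.
  rewrite gen_eqE [in RHS]leq_eqVlt; case: eqVneq => //= ik; rewrite ?implybT //.
  by rewrite ik ltnn andbF.
- by apply/allP => i; rewrite mem_filter => /andP[_ /(allP sb)].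
- by rewrite -km.
Qed.

End JucysMurphy.

(** * Coefficients of normalized elements *)

Section NormalizationCoef.
Variables (R : comNzRingType) (Q : R) (n : nat) (b : 'I_n -> nat).
Hypothesis b_homo : forall x y : 'I_n, (x <= y)%N -> (b x <= b y)%N.
Local Notation H := (hecke Q n).
Local Notation g := (hgen Q).
Implicit Types (i j k : 'I_n.-1) (x y : H) (p : 'I_n) (d u : 'S_n) (s v : seq 'I_n.-1).

(** [gam] commutes with the Young subalgebra, so the form is symmetric there and distinct letters
    may be put in decreasing order. *)
Lemma coef_gam s : uniq s -> all (block_gen b) s ->
  coef (gam Q b n * hword Q s) 1%g = [forall i, block_gen b i ==> (i \in s)]%:R.
Proof.
move=> us sb; pose phi x := coef (gam Q b n * x) 1%g.
have phiP (r t : seq 'I_n.-1) : all (block_gen b) r -> all (block_gen b) t ->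
    phi (hword Q r * hword Q t) = phi (hword Q t * hword Q r).
  move=> _ tb; rewrite /phi mulrA coef_tauC mulrA -(inAlg_comm _ (inAlg_word Q tb)).
    by rewrite mulrA.
  by move=> i bi; rewrite gam_comm.
pose s' := enum [set i in s].
have es i : (i \in s') = (i \in s) by rewrite mem_enum inE.
have sb' : all (block_gen b) s'.
  by apply/allP => i; rewrite es; apply/allP.
have := distinct_word phiP us (t := rev s') _ sb; rewrite rev_uniq enum_uniq /phi => -> //.
  rewrite coef_gam_sorted //; first last.
  - by apply/allP => i _; apply: sgen_subproof2.
  - exact: sorted_enum.
  congr (nat_of_bool _)%:R; apply: eq_forallb => i.
  by rewrite es sgen_subproof2 andbT.
by move=> i; rewrite mem_rev es.
Qed.

Section Process.
Variables (d : 'S_n) (dm : minrep b d).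
Let col p := b (d p).

(* [junk m] collects the terms [T_u a] whose block numbers already differ from those
   of [d] at a position [p < m]; the letters still to be applied, all [>= m], do not
   act on that position. *)
Definition agree m u := [forall p : 'I_n, (p < m)%N ==> (b (u p) == b (d p))].
Definition junk m x := forall u, agree m u -> coef x u = 0.

Lemma agree_sgen m k u : (m <= k)%N -> agree m u -> agree m (sgen k * u)%g.
Proof.
move=> mk /forallP au; apply/forallP => p; apply/implyP => pm.
rewrite permM (_ : sgen k p = p); first exact: (implyP (au p)).
by apply: val_inj; rewrite /= sgen_val; liaif.
Qed.

Lemma junk_gen m k x : (m <= k)%N -> junk m x -> junk m (g k * x).
Proof.
move=> mk jx u au; rewrite coef_gen !jx ?agree_sgen //.
by rewrite mulr0 if_same addr0.
Qed.

Lemma junk_le m m' x : (m <= m')%N -> junk m x -> junk m' x.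
Proof.
move=> mm jx u /forallP au; apply: jx; apply/forallP => p; apply/implyP => pm.
by apply: (implyP (au p)); apply: leq_trans mm.
Qed.

Lemma junkD m x y : junk m x -> junk m y -> junk m (x + y).
Proof. by move=> jx jy u au; rewrite coefD jx ?jy ?addr0. Qed.

Lemma junkZ m a x : junk m x -> junk m (a *: x).
Proof. by move=> jx u au; rewrite coefZ jx ?mulr0. Qed.

Lemma Tw_block_supp u (w : 'S_n) y : inAlg (block_gen b) y ->
  coef (Tw Q w * y) u != 0 -> forall p, b (u p) = b (w p).
Proof.
move=> yb; pose S x := forall u, ~~ [forall p, b (u p) == b (w p)] -> coef x u = 0.
suff /(_ u) Sy : S (Tw Q w * y).
  move=> cu; have : [forall p, b (u p) == b (w p)].
    by apply: contraR cu => /Sy ->.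
  by move=> /forallP h p; apply/eqP.
apply: (inAlg_indr (S := S)) yb _ => [a x Sx v nv|x x' Sx Sx' v nv|i x bi Sx v nv|v nv].
- by rewrite coefZ Sx // mulr0.
- by rewrite coefD Sx // Sx' // addr0.
- rewrite coef_genr Sx ?Sx ?mulr0 ?if_same ?addr0 //.
  apply: contra nv => /forallP h; apply/forallP => p; rewrite -(eqP (h p)) permM.
  by have /block_permP -> := block_gen_perm bi.
- rewrite coef_Tw; case: eqVneq => // vw; case/negP: nv.
  by rewrite vw; apply/forallP.
Qed.

(** Positions of [i] carried by [d] to the values of [j], which gives [s_i d = d s_j]. *)
Definition linked i j := (d (lo i) == lo j) && (d (hi i) == hi j).

(** The smallest letter acts first. A term [T_{s_k d}] with another block number at [lo k] is junk
    for good, as the later letters exceed [k]; the word [v] collects the generators which appear to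
    the right of [T_d]. *)
Lemma process gm s : inAlg (block_gen b) gm -> sorted (@incr n) s ->
  forall m, all (fun i : 'I_n.-1 => i < m)%N s ->
  exists v x, [/\ uniq v, all (block_gen b) v, forall j, block_gen b j -> (j \in v) = has (linked^~ j) s,
    size v = count (fun i => col (hi i) == col (lo i)) s & junk m x] /\
    hword Q (rev s) * Tw Q d * gm =
      (if all (fun i => col (hi i) <= col (lo i))%N s
       then Q ^+ count (fun i => col (hi i) < col (lo i))%N s else 0)
      *: (Tw Q d * hword Q v * gm) + x.
Proof.
move=> gb; elim/last_ind: s => [|s k IHs] ss m sm.
  exists [::], 0; split; first by split=> // u _; rewrite coef0.
  by rewrite hword_nil mul1r mulr1 expr0 scale1r addr0.
move: sm; rewrite all_rcons => /andP[km _].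
have [ss' sk] : sorted (@incr n) s /\ all (fun i : 'I_n.-1 => i < k)%N s.
  move: ss; rewrite sorted_pairwise; last exact: incr_trans.
  by rewrite -cats1 pairwise_cat allrel1r -(sorted_pairwise (@incr_trans n)) => /and3P[].
have [v [x [[uv vb vE sv jx] e]]] := IHs ss' k sk.
have rE : hword Q (rev (rcons s k)) * Tw Q d * gm = g k * (hword Q (rev s) * Tw Q d * gm).
  by rewrite rev_rcons hword_cons !mulrA.
have count1 (a : pred 'I_n.-1) : count a (rcons s k) = (count a s + a k)%N.
  by rewrite -cats1 count_cat /= addn0.
have jgx : junk m (g k * x) by apply: (junk_le (ltnW km)); apply: junk_gen.
have yb : inAlg (block_gen b) (hword Q v * gm) by apply: inAlgM => //; apply: inAlg_word.
have swap_junk : col (hi k) != col (lo k) ->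
    junk m (Tw Q (sgen k * d)%g * (hword Q v * gm)).
  move=> ne u /forallP/(_ (lo k))/implyP/(_ km)/eqP au.
  apply/eqP; apply: contraR ne => /(Tw_block_supp yb)/(_ (lo k)).
  by rewrite permM sgen_lo au /col => ->.
rewrite all_rcons !count1 rE e mulrDr -scalerAr -!mulrA (mulrA (g k)).
have vE' : col (hi k) != col (lo k) -> forall j, block_gen b j ->
    (j \in v) = has (linked^~ j) (rcons s k).
  move=> ne j bj; rewrite has_rcons -vE // /linked; case: eqP => //= lj.
  by case: eqP => //= hj; case/negP: ne; rewrite /col lj hj eq_sym.
(* A descent of block numbers keeps [T_d] with a factor [Q], an ascent loses it, and an equality
   moves the letter across [T_d] as a linked generator. *)
case: (ltngtP (col (hi k)) (col (lo k))) => ck.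
- have dk : desc d k by apply: (b_lt b_homo).
  exists v, ((if all (fun i => col (hi i) <= col (lo i))%N s
    then Q ^+ count (fun i => col (hi i) < col (lo i))%N s else 0) *:
      (Tw Q (sgen k * d)%g * (hword Q v * gm)) + g k * x); split.
    split=> //; last 2 first.
    - by rewrite addn0.
    - by apply: junkD => //; apply/junkZ/swap_junk; rewrite ltn_eqF.
    by apply: vE'; rewrite ltn_eqF.
  rewrite hgen_Tw dk mulrDl scalerDr [RHS]addrA; congr (_ + _); rewrite addrC; congr (_ + _).
  rewrite /= -scalerAl scalerA addn1 exprSr.
  by rewrite -(mulrA (Tw Q d)); case: ifP => _; rewrite ?mul0r.
- have dk : desc d k = false.
    by apply/negbTE; rewrite /desc -leqNgt; apply/ltnW/(b_lt b_homo).
  exists v, ((if all (fun i => col (hi i) <= col (lo i))%N s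
    then Q ^+ count (fun i => col (hi i) < col (lo i))%N s else 0) *:
      (Tw Q (sgen k * d)%g * (hword Q v * gm)) + g k * x); split.
    split=> //; last 2 first.
    - by rewrite addn0.
    - by apply: junkD => //; apply/junkZ/swap_junk; rewrite gtn_eqF.
    by apply: vE'; rewrite gtn_eqF.
  by rewrite hgen_Tw dk addr0 /= scale0r add0r.
- have [j [bj lj hj sd]] := minrep_same b_homo dm (esym ck).
  have [gd _] := hgen_minrep Q b_homo dm bj sd.
  exists (j :: v), (g k * x); split; last first.
    rewrite /= addn0; congr (_ *: _ + _).
    by rewrite gd hword_cons !mulrA.
  split=> //=; first last.
  - by rewrite sv addn1.
  - move=> i bi; rewrite inE has_rcons vE //; congr orb.
    rewrite /linked -lj -hj -!val_eqE /= eqSS [LHS]eq_sym.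
    by rewrite -gen_eqE gen_eqE /=; case: eqP.
  - by rewrite bj vb.
  rewrite uv andbT vE //; apply/hasPn => i si; apply/negP => /andP[/eqP e1 _].
  have := allP sk i si; rewrite lj in e1; have /(congr1 val) /= -> := perm_inj e1.
  by rewrite ltnn.
Qed.

End Process.

Definition good (d : 'S_n) s :=
  [&& minrep b d, all (fun i => b (d (hi i)) <= b (d (lo i)))%N s &
    [forall j, block_gen b j ==> has (linked d ^~ j) s]].

Lemma coef_normalization s : sorted (@incr n) s ->
  coef ((\sum_(d | minrep b d) Tw Q d * gam Q b n * Tw Q d^-1%g) * hword Q (rev s)) 1%g =
  Q ^+ (size s - #|[pred j | block_gen b j]|) *+ #|[set d | good d s]|.
Proof.
move=> ss; rewrite mulr_suml coef_sum -sum1_card -sumrMnr.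
transitivity (\sum_(d : 'S_n | minrep b d) if good d s then
    Q ^+ (size s - #|[pred j | block_gen b j]|) else 0); last first.
  rewrite -big_mkcondr /=; apply: eq_bigl => d; rewrite inE /good.
  by case: (minrep b d).
apply: eq_bigr => d dm.
(* Rotating puts [T_{d^-1}] last, so the trace becomes the coefficient at [d]. *)
rewrite coef_tauC !mulrA coef_tau invgK.
have gb : inAlg (block_gen b) (gam Q b n).
  by apply: inAlgS (gam_inAlg Q b_homo n) => i /andP[].
have sn : all (fun i : 'I_n.-1 => i < n)%N s.
  by apply/allP => i _; apply: leq_trans (ltn_ord i) (leq_pred n).
have [v [x [[uv vb vE sv jx] ->]]] := process dm gb ss sn.
rewrite coefD (jx d) ?addr0; last by apply/forallP => p; rewrite eqxx implybT.
rewrite coefZ -mulrA (coef_minrep b_homo dm); last by apply: inAlgM => //; apply: inAlg_word.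
rewrite coef_tauC coef_gam // /good dm /=.
case: (boolP (all _ s)) => [As|_] /=; last by rewrite mul0r.
have -> : [forall i, block_gen b i ==> (i \in v)]
    = [forall j, block_gen b j ==> has (linked d ^~ j) s].
  by apply: eq_forallb => j; case: (boolP (block_gen b j)) => //= /vE ->.
case: (boolP [forall j, _ ==> has _ _]) => [/forallP Bd|_]; last by rewrite mulr0.
rewrite mulr1; congr (Q ^+ _).
(* [v] lists each generator of the Young subgroup once; these are the equalities along [s], so the
   remaining letters are the strict descents. *)
have <- : size v = #|[pred j | block_gen b j]|.
  rewrite -(card_uniqP uv); apply: eq_card => j; rewrite !inE.
  apply/idP/idP => [/(allP vb)//|bj]; rewrite vE //.
  exact: (implyP (Bd j)).
rewrite sv -(count_predC (fun i => b (d (hi i)) == b (d (lo i))) s) addKn.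
apply: eq_in_count => i /(allP As) /=; by case: ltngtP.
Qed.
End NormalizationCoef.

(** * Counting by merging parts *)

Section BlockChain.
Variables (n : nat) (b : 'I_n -> nat).
Hypothesis b_homo : forall x y : 'I_n, (x <= y)%N -> (b x <= b y)%N.

Lemma block_chain (r : 'I_n -> 'I_n -> Prop) :
  (forall x, r x x) -> (forall x y z, r x y -> r y z -> r x z) ->
  (forall i, block_gen b i -> r (lo i) (hi i)) ->
  forall x y : 'I_n, (x <= y)%N -> b x = b y -> r x y.
Proof.
move=> rr rt rs x y xy bxy; have yE : y = (x + (y - x))%N :> nat by lia.
move: (y - x)%N yE => k; elim: k y {xy} bxy => [|k IHk] y bxy yE.
  by rewrite (_ : y = x) //; apply: ord_inj; rewrite yE addn0.
have lt : (x + k < n.-1)%N by have := ltn_ord y; lia.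
pose i : 'I_n.-1 := Ordinal lt.
have yi : y = hi i by apply: ord_inj; rewrite /= yE addnS.
have h1 : (b x <= b (lo i))%N by apply: b_homo; rewrite /=; lia.
have h2 : (b (lo i) <= b (hi i))%N by apply: b_homo => /=.
have bl : b x = b (lo i) by rewrite yi in bxy; lia.
apply: rt (IHk (lo i) bl _) _ => //.
by rewrite yi; apply: rs; rewrite /block_gen -bl bxy yi.
Qed.

Lemma block_const (T : Type) (F : 'I_n -> T) :
  (forall i, block_gen b i -> F (lo i) = F (hi i)) -> forall x y, b x = b y -> F x = F y.
Proof.
move=> Fs; have step (x y : 'I_n) : (x <= y)%N -> b x = b y -> F x = F y.
  by apply: (block_chain (r := fun x y => F x = F y)) => // ? ? ? -> ->.
move=> x y bxy; case: (leqP x y) => [xy|/ltnW yx]; first exact: step.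
by apply/esym/step.
Qed.

End BlockChain.

Section Arrange.
Variables (n : nat) (F b : 'I_n -> nat).
Implicit Types (v p : 'I_n).

(* The order in which the values occur when the blocks of [b] merged by [F] into one
   block are listed in decreasing order of their numbers. *)
Definition key_lt v v' :=
  (F v < F v')%N || (F v == F v') && ((b v' < b v)%N || (b v == b v') && (v < v')%N).

Lemma key_irr v : key_lt v v = false.
Proof. by rewrite /key_lt !ltnn !andbF. Qed.

Lemma key_trans : transitive key_lt.
Proof. by move=> y x z; rewrite /key_lt; lia. Qed.

Lemma key_total v v' : v != v' -> key_lt v v' || key_lt v' v.
Proof. by rewrite ord_eqE /key_lt; lia. Qed.

Definition rank v := #|[set v' | key_lt v' v]|.

Lemma rank_lt v v' : key_lt v v' -> (rank v < rank v')%N.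
Proof.
move=> vv'; apply/proper_card/properP; split.
  by apply/subsetP => x; rewrite !inE => /key_trans; apply.
by exists v; rewrite inE // key_irr.
Qed.

Lemma rank_bound v : (rank v < n)%N.
Proof.
rewrite -[X in (_ < X)%N]card_ord -cardsT; apply/proper_card/properP; split.
  exact: subsetT.
by exists v; rewrite // inE key_irr.
Qed.

Lemma rank_inj : injective (fun v => Ordinal (rank_bound v)).
Proof.
move=> v v' [/eqP e]; apply/eqP; apply: contraLR e => /key_total /orP[] /rank_lt.
  by rewrite neq_ltn => ->.
by rewrite neq_ltn orbC => ->.
Qed.

(** Sends a value to the position at which it is listed; the representative [d] will be its
    inverse. *)
Definition arr : 'S_n := perm rank_inj.

Lemma arrP v v' : (arr v < arr v')%N = key_lt v v'.
Proof.
rewrite !permE /=; apply/idP/idP => [lt|]; last exact: rank_lt.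
case: (eqVneq v v') => [e|/key_total/orP[]//]; first by rewrite e ltnn in lt.
by move=> /rank_lt; rewrite ltnNge (ltnW lt).
Qed.

Lemma arr_unique (e : 'S_n) : (forall v v', key_lt v v' -> e v < e v')%N -> e = arr.
Proof.
move=> eP; apply/esym/eqP; rewrite eq_mulVg1; apply/eqP.
apply: perm_incr_id => x y xy; rewrite !permM; apply: eP.
by rewrite -arrP !permKV.
Qed.

(** Both functions have sorted lists of values, and the fibre sizes make these lists permutations of
    each other. *)
Lemma homo_count_eq (c c' : 'I_n -> nat) :
  (forall x y : 'I_n, (x <= y)%N -> (c x <= c y)%N) ->
  (forall x y : 'I_n, (x <= y)%N -> (c' x <= c' y)%N) ->
  (forall j, #|[set v | c v == j]| = #|[set v | c' v == j]|) -> c =1 c'.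
Proof.
have sorted_codom (d : 'I_n -> nat) : (forall x y : 'I_n, (x <= y)%N -> (d x <= d y)%N) ->
    sorted leq [seq d x | x <- enum 'I_n].
  move=> dh; rewrite sorted_map; apply: (@sub_sorted _ (relpre val leq)).
    by move=> x y /=; apply: dh.
  by rewrite -sorted_map val_enum_ord iota_sorted.
move=> ch c'h cc x.
have : [seq c x | x <- enum 'I_n] = [seq c' x | x <- enum 'I_n].
  apply: (sorted_eq leq_trans anti_leq); [exact: sorted_codom|exact: sorted_codom|].
  have cE (d : 'I_n -> nat) j : count_mem j [seq d x | x <- enum 'I_n] = #|[set v | d v == j]|.
    rewrite count_map -size_filter cardE; apply/perm_size/uniq_perm.
    - by rewrite filter_uniq ?enum_uniq.
    - exact: enum_uniq.
    - by move=> v; rewrite mem_filter !mem_enum !inE andbT.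
  by apply/allP => j _ /=; rewrite !cE cc.
by move/eq_in_map => /(_ x); apply; rewrite mem_enum.
Qed.

Hypothesis b_homo : forall x y : 'I_n, (x <= y)%N -> (b x <= b y)%N.
Hypothesis Fb : forall i, block_gen b i -> F (lo i) = F (hi i).
Variable c : 'I_n -> nat.
Hypothesis c_homo : forall x y : 'I_n, (x <= y)%N -> (c x <= c y)%N.

(** [F] is constant on the blocks of [b], so nothing fits in the key order between consecutive
    values of one block. *)
Lemma arr_lo_hi i : block_gen b i -> arr (hi i) = (arr (lo i)).+1 :> nat.
Proof.
move=> bi; have lt : (arr (lo i) < arr (hi i))%N.
  by rewrite arrP /key_lt Fb // eqxx (eqP bi) eqxx ltnSn !orbT.
apply/eqP; rewrite eqn_leq lt andbT leqNgt; apply/negP => lt2.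
have lt3 : ((arr (lo i)).+1 < n)%N by have := ltn_ord (arr (hi i)); lia.
pose v := (arr^-1 (Ordinal lt3))%g.
have e1 : key_lt (lo i) v by rewrite -arrP permKV /=.
have e2 : key_lt v (hi i) by rewrite -arrP permKV.
have := Fb bi; move: e1 e2; rewrite /key_lt -(eqP bi) /=.
by lia.
Qed.

Lemma arr_gen i : block_gen b i ->
  exists2 j, lo j = arr (lo i) & hi j = arr (hi i).
Proof.
move=> bi; have e := arr_lo_hi bi.
have lt : (arr (lo i) < n.-1)%N by have := ltn_ord (arr (hi i)); lia.
by exists (Ordinal lt); apply: ord_inj.
Qed.

Lemma arr_minrep : minrep b arr^-1%g.
Proof.
apply/minrepP => x x' xx' bb; rewrite ltnNge leq_eqVlt negb_or; apply/andP; split.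
  by rewrite perm_neq; lia.
apply/negP => lt; have : (arr (arr^-1 x')%g < arr (arr^-1 x)%g)%N.
  by rewrite arrP /key_lt (block_const b_homo Fb bb) bb !ltnn !eqxx lt.
by rewrite !permKV; lia.
Qed.

(** Weakly decreasing block numbers along the blocks of [c], increasing values inside the blocks of
    [b] and [c = F o d] together force the key order. *)
Lemma good_arr_unique d s : s =i [pred i | block_gen c i] -> good b d s ->
  (forall p, c p = F (d p)) -> d = arr^-1%g.
Proof.
move=> sE /and3P[dm /allP As _] cF; suff <- : (d^-1 = arr)%g by rewrite invgK.
have FE v : F v = c (d^-1 v)%g by rewrite cF permKV.
apply: arr_unique => v v'; rewrite /key_lt !FE => /orP[/(b_lt c_homo)//|/andP[/eqP cc]].
move=> /orP[bb|/andP[/eqP bb vv']].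
  rewrite ltnNge; apply/negP => lt.
  have chain (p p' : 'I_n) : (p <= p')%N -> c p = c p' -> (b (d p') <= b (d p))%N.
    apply: (block_chain c_homo (r := fun p p' => b (d p') <= b (d p))%N) => //.
      by move=> x y z h1 h2; apply: leq_trans h2 h1.
    by move=> i ci; apply: As; rewrite sE.
  by have := chain _ _ lt (esym cc); rewrite !permKV leqNgt bb.
rewrite ltnNge leq_eqVlt negb_or perm_neq; apply/andP; split; first by lia.
apply/negP => lt; have /minrepP/(_ _ _ lt) := dm; rewrite !permKV => /(_ (esym bb)).
by lia.
Qed.

Hypothesis counts : forall j, #|[set v | F v == j]| = #|[set p | c p == j]|.

(** The listing is sorted by [F], whose fibres have the sizes of the blocks of [c]; hence they fill
    these blocks in order. *)
Lemma arr_block v : c (arr v) = F v.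
Proof.
have h : c =1 (fun p => F (arr^-1 p)%g).
  apply: homo_count_eq => //.
    move=> x y xy; rewrite leqNgt; apply/negP => lt.
    have : (arr (arr^-1 y)%g < arr (arr^-1 x)%g)%N by rewrite arrP /key_lt lt.
    by rewrite !permKV; lia.
  move=> j; rewrite -counts -(card_imset _ (@perm_inj _ arr)).
  apply: eq_card => p; rewrite !inE; apply/imsetP/eqP => [[v' + ->]|pj].
    by rewrite inE permK => /eqP.
  by exists (arr^-1 p)%g; rewrite ?permKV // inE pj.
by rewrite h permK.
Qed.

Lemma arr_block_gen i j : block_gen b i -> lo j = arr (lo i) -> hi j = arr (hi i) ->
  block_gen c j.
Proof. by move=> bi lj hj; rewrite /block_gen lj hj !arr_block Fb. Qed.

Lemma arr_good s : s =i [pred i | block_gen c i] -> good b arr^-1%g s.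
Proof.
move=> sE; apply/and3P; split; first exact: arr_minrep.
  apply/allP => i; rewrite sE inE => /eqP ci.
  have : key_lt (arr^-1 (lo i))%g (arr^-1 (hi i))%g by rewrite -arrP !permKV /=.
  by rewrite /key_lt -!arr_block !permKV ci ltnn eqxx /=; lia.
apply/forallP => j; apply/implyP => bj; have [i li hi_] := arr_gen bj.
apply/hasP; exists i; first by rewrite sE inE (arr_block_gen bj).
by rewrite /linked li hi_ !permK !eqxx.
Qed.

End Arrange.

Section GoodBlocks.
Variables (n : nat) (b c : 'I_n -> nat).
Hypothesis b_homo : forall x y : 'I_n, (x <= y)%N -> (b x <= b y)%N.

(** Every generator inside a block of [b] is linked to one inside a block of [c], so a block of [b]
    lands in a single block of [c]. This yields the merging map. *)
Lemma good_const d s : s =i [pred i | block_gen c i] -> good b d s ->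
  forall v v', b v = b v' -> c (d^-1 v)%g = c (d^-1 v')%g.
Proof.
move=> sE /and3P[dm _ /forallP Bd]; apply: block_const => // j bj.
have /hasP[i si /andP[/eqP li /eqP hi_]] := implyP (Bd j) bj.
by move: si; rewrite sE inE -li -hi_ !permK => /eqP.
Qed.

End GoodBlocks.

Section CountGood.
Variables (n r : nat) (B : 'I_n -> 'I_r) (c : 'I_n -> nat).
Let b (v : 'I_n) : nat := B v.
Hypothesis b_homo : forall x y : 'I_n, (x <= y)%N -> (b x <= b y)%N.
Hypothesis c_homo : forall x y : 'I_n, (x <= y)%N -> (c x <= c y)%N.
Hypothesis B_surj : forall a, exists v, B v = a.
Hypothesis c_bound : forall p, (c p < n)%N.

(** Targets are labels in ['I_n], those beyond the blocks of [c] receiving nothing. The same maps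
    index the terms of a product of power sums in [n] variables. *)
Definition merges : {set {ffun 'I_r -> 'I_n}} :=
  [set f : {ffun 'I_r -> 'I_n} |
    [forall j : 'I_n, #|[set v | f (B v) == j]| == #|[set p | c p == j]|]].

(** The bijection sends a merging map to the inverse of its arrangement; the map is recovered by
    looking at where one chosen value of each block is placed. *)
Lemma card_good s : s =i [pred i | block_gen c i] ->
  #|[set d | good b d s]| = #|merges|.
Proof.
move=> sE; pose F (f : {ffun 'I_r -> 'I_n}) v : nat := f (B v).
have Fb f i : block_gen b i -> F f (lo i) = F f (hi i).
  by move=> /eqP/ord_inj e; rewrite /F e.
have cnt f : f \in merges -> forall j, #|[set v | F f v == j]| = #|[set p | c p == j]|.
  rewrite inE => /forallP fm j; case: (ltnP j n) => jn.
    by rewrite -(eqP (fm (Ordinal jn))); apply: eq_card => v; rewrite !inE.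
  rewrite !eq_card0 // => x; rewrite !inE; apply/negbTE; rewrite neq_ltn.
    by rewrite (leq_trans (c_bound x) jn).
  by rewrite (leq_trans (ltn_ord _) jn).
pose G f := ((arr (F f) b)^-1)%g.
have injG : {in merges &, injective G}.
  move=> f f' fm fm' /invg_inj e; apply/ffunP => a; have [v <-] := B_surj a.
  apply: ord_inj; rewrite -[LHS]/(F f v) -[RHS]/(F f' v).
  rewrite -(arr_block b c_homo (cnt f fm)) -(arr_block b c_homo (cnt f' fm')).
  by rewrite e.
rewrite -(card_in_imset injG); apply: eq_card => d; rewrite inE.
apply/idP/imsetP => [dg|[f fm ->]]; last exact: (arr_good b_homo (Fb f) c_homo (cnt f fm)).
have cst := good_const b_homo sE dg.
have B_surjb a : exists v, B v == a by have [v <-] := B_surj a; exists v.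
pose pk a : 'I_n := xchoose (B_surjb a).
have pkE a : B (pk a) = a by apply/eqP/(xchooseP (B_surjb a)).
pose f := [ffun a => Ordinal (c_bound (d^-1 (pk a))%g)].
have FE v : F f v = c (d^-1 v)%g.
  by rewrite /F ffunE /=; apply: cst; rewrite /b pkE.
have fm : f \in merges.
  rewrite inE; apply/forallP => j; apply/eqP.
  rewrite -[RHS](card_imset _ (@perm_inj _ d)); apply: eq_card => v; rewrite inE.
  apply/eqP/imsetP => [fj|[p + ->]].
    exists (d^-1 v)%g; rewrite ?permKV // inE -FE /F fj //.
  by rewrite inE => /eqP cj; apply: ord_inj; rewrite -[LHS]/(F f (d p)) FE permK.
exists f => //; apply: (good_arr_unique (F := F f) c_homo sE dg) => p.
by rewrite FE permK.
Qed.

End CountGood.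

(** * Compositions and partitions *)

Lemma plength_len n (w : 'S_n) : plength w = len w. Proof. by rewrite len.unlock. Qed.

Section NonfirstCard.
Variables (n : nat) (b : 'I_n -> nat).
Hypothesis b_homo : forall x y : 'I_n, (x <= y)%N -> (b x <= b y)%N.

(** [hi] matches the generators inside blocks with the positions that are not first in their
    block. *)
Lemma card_block_gen :
  (#|[set z | ~~ nonfirst b z]| + #|[pred i | block_gen b i]| = n)%N.
Proof.
have hi_inj : injective (@hi n) by move=> i j /(congr1 val) /= [] /ord_inj.
rewrite -(card_imset _ hi_inj) -[RHS](card_ord n).
rewrite -(cardsC [set z | ~~ nonfirst b z]); congr (_ + _)%N.
apply: eq_card => z; rewrite !inE negbK; apply/imsetP/idP => [[i bi ->]|].
  by apply/existsP; exists (lo i); rewrite /= ltnSn.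
by move=> /(nonfirst_gen b_homo)[k bk ->]; exists k.
Qed.

Lemma first_inj z z' : ~~ nonfirst b z -> ~~ nonfirst b z' -> b z = b z' -> z = z'.
Proof.
move=> /existsPn fz /existsPn fz' bb; apply/ord_inj.
by have := fz z'; have := fz' z; rewrite bb eqxx !andbT; lia.
Qed.

End NonfirstCard.

Section Composition.
Variables (n : nat) (I : seq nat).
Implicit Types (v : 'I_n) (d w : 'S_n).

Definition rb (v : 'I_n) : nat := reshape_index I v.

Lemma rb_homo (x y : 'I_n) : (x <= y)%N -> (rb x <= rb y)%N.
Proof. by rewrite (reshape_leq I) /rb; lia. Qed.

Hypothesis I_sum : sumn I = n.
Hypothesis I_pos : all (ltn 0) I.

Lemma rb_bound v : (rb v < size I)%N.
Proof. by apply: reshape_indexP; rewrite I_sum. Qed.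

Lemma card_rb a : #|[set v | rb v == a]| = nth 0%N I a.
Proof.
have lt (c : 'I_(nth 0%N I a)) : (flatten_index I a c < n)%N.
  by rewrite -I_sum; apply: flatten_indexP.
pose h c := Ordinal (lt c).
have h_inj : injective h.
  move=> c c' /(congr1 val) /= e; apply/ord_inj.
  by rewrite -(@flatten_indexKr I a c) // e flatten_indexKr.
rewrite -[RHS]card_ord -cardsT -(card_imset _ h_inj); apply: eq_card => v.
rewrite inE; apply/eqP/imsetP => [va|[c _ ->]]; last by rewrite /rb /= flatten_indexKl.
have lt' : (reshape_offset I v < nth 0 I a)%N.
  by rewrite -va; apply: reshape_offsetP; rewrite I_sum.
exists (Ordinal lt') => //; apply: ord_inj.
by rewrite /= -va /rb reshape_indexK.
Qed.

Lemma rb_surj a : (a < size I)%N -> exists v, rb v = a.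
Proof.
move=> aI; have : (0 < #|[set v | rb v == a]|)%N.
  by rewrite card_rb; apply: (allP I_pos); apply: mem_nth.
by case/card_gt0P => v; rewrite inE => /eqP va; exists v.
Qed.

Lemma card_first : #|[set z | ~~ nonfirst rb z]| = size I.
Proof.
rewrite -[RHS]card_ord -cardsT.
pose f z : 'I_(size I) := Ordinal (rb_bound z).
have f_inj : {in [set z | ~~ nonfirst rb z] &, injective f}.
  by move=> z z'; rewrite !inE => fz fz' /(congr1 val) /= /(first_inj fz fz').
rewrite -(card_in_imset f_inj); apply: eq_card => a; rewrite inE.
apply/imsetP; have [v va] := rb_surj (ltn_ord a).
have [z zP zmin] := @arg_minnP _ v (fun z => rb z == a) (fun z : 'I_n => z : nat) (introT eqP va).
exists z; last by apply: ord_inj; rewrite /= (eqP zP).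
rewrite inE; apply/existsPn => x; apply/negP => /andP[xz /eqP bx].
by have := zmin x; rewrite bx zP => /(_ isT); lia.
Qed.

Lemma card_gens : #|[pred i | block_gen rb i]| = (n - size I)%N.
Proof. by have := card_block_gen rb_homo; rewrite card_first; lia. Qed.

Lemma mem_young w : (w \in young n I) = block_perm rb w.
Proof. by rewrite inE. Qed.

Lemma len_rdesc w i : rdesc w i -> len w = (len (w * sgen i)%g).+1.
Proof.
move=> di; rewrite -(lenV (w * _)) invMg sgenV.
by rewrite -lenV (len_sgenN di).
Qed.

Lemma min_coset_repE d : min_coset_rep I d = minrep rb d.
Proof.
apply/idP/idP => [/forall_inP dm|dm].
  rewrite (minrep_rdesc rb_homo); apply/forallP => i; apply/implyP => bi.
  apply/negP => di; have := dm (d * sgen i)%g.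
  rewrite mem_lcoset mulKg mem_young (block_gen_perm bi) => /(_ isT).
  by rewrite !plength_len (len_rdesc di) ltnn.
apply/forall_inP => v; rewrite mem_lcoset mem_young => yb.
by rewrite -(mulKVg d v) !plength_len (len_minrep rb_homo dm yb) leq_addr.
Qed.

Variables (R : comNzRingType) (Q : R).
Local Notation H := (hecke Q n).

Lemma normalizationE (h : H) :
  normalization I h = \sum_(d | minrep rb d) Tw Q d * h * Tw Q d^-1%g.
Proof.
by apply: eq_big => [d|d _]; rewrite ?min_coset_repE // !hT_Tw.
Qed.

Lemma block_JME (z : 'I_n) : block_JM Q I z = jm Q rb z.
Proof. by apply: eq_bigr => x _; rewrite hT_Tw. Qed.

Lemma prod_zero (T : eqType) (A : nzRingType) (s : seq T) (P : pred T) (F : T -> A) z :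
  z \in s -> P z -> F z = 0 -> \prod_(x <- s | P x) F x = 0.
Proof.
move=> + Pz Fz; elim: s => // x s IHs; rewrite inE big_cons.
by case/orP => [/eqP <-|/IHs ->]; [rewrite Pz Fz mul0r | rewrite mulr0 if_same].
Qed.

(** The degree is one less than the number of variables, and the variable at the first position [z0]
    is 0: the only surviving subset is the one that omits [z0]. *)
Lemma block_esymE a : (a < size I)%N ->
  block_esym Q n I a (nth 0%N I a).-1 = \prod_(z | (rb z == a) && nonfirst rb z) jm Q rb z.
Proof.
move=> aI; pose B := [set z : 'I_n | (rb z == a) && nonfirst rb z].
have BY : yblock n I a = [set v | rb v == a] by [].
have [z0 z0P] : exists z0, [set v | rb v == a] :\: B = [set z0].
  have [v va] := rb_surj aI.
  have [z zP zmin] := @arg_minnP _ v (fun z => rb z == a) (fun z : 'I_n => z : nat) (introT eqP va).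
  have fz : ~~ nonfirst rb z.
    apply/existsPn => x; apply/negP => /andP[xz /eqP bx].
    by have := zmin x; rewrite bx zP => /(_ isT); lia.
  exists z; apply/setP => x; rewrite !inE; case: (eqVneq x z) => [->|xz].
    by rewrite zP fz.
  apply/negbTE; rewrite negb_and negbK; case: (boolP (rb x == a)) => //= xa.
  rewrite orbF; apply/existsP; exists z; rewrite (eqP xa) zP andbT.
  by have := zmin x xa; move: xz; rewrite ord_eqE; lia.
have BsubY : B \subset [set v | rb v == a].
  by apply/subsetP => x; rewrite !inE => /andP[].
have z0f : z0 \in [set v | rb v == a] :\: B by rewrite z0P set11.
have cardB : #|B| = (nth 0%N I a).-1.
  have := cardsID B [set v | rb v == a]; rewrite (setIidPr BsubY) z0P cards1 card_rb.
  by lia.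
rewrite /block_esym BY (bigD1 B) /=; last by rewrite BsubY cardB eqxx.
rewrite [X in _ + X]big1 ?addr0.
  by apply: eq_big => [z|z _]; rewrite ?inE // block_JME.
move=> A /andP[/andP[AY /eqP cA] AB]; apply: (prod_zero (z := z0)).
- exact: mem_index_enum.
- apply: contraR AB => z0A; rewrite eqEcard cardB cA leqnn andbT.
  apply/subsetP => x xA; apply: contraT => xB.
  have : x \in [set v | rb v == a] :\: B by rewrite inE xB (subsetP AY).
  by rewrite z0P inE => /eqP xz; rewrite xz (negPf z0A) in xA.
- rewrite block_JME jm_first //; move: z0f; rewrite !inE => /andP[+ za].
  by rewrite za.
Qed.

(** The ring is not commutative; the regrouping is valid because the enumeration of the positions
    runs through the blocks in order. *)
Lemma prod_blocks (A : nzRingType) (P : pred 'I_n) (F : 'I_n -> A) r :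
  \prod_(0 <= a < r) \prod_(z | (rb z == a) && P z) F z =
  \prod_(z | (rb z < r)%N && P z) F z.
Proof.
elim: r => [|r IHr]; first by rewrite big_nil big_pred0.
rewrite big_nat_recr //= IHr.
have : sorted (fun x y : 'I_n => rb x <= rb y)%N (index_enum 'I_n).
  have := iota_sorted 0 n; rewrite -val_enum_ord sorted_map.
  rewrite [index_enum _]unlock -enumT; apply: sub_sorted => x y /=; exact: rb_homo.
elim: (index_enum _) => [|x s IHs] sxs; first by rewrite !big_nil mulr1.
have ss : sorted (fun x y : 'I_n => rb x <= rb y)%N s := path_sorted sxs.
have xs : all (fun y => rb x <= rb y)%N s.
  by apply: order_path_min sxs => u v w; apply: leq_trans.
rewrite !big_cons ltnS; case: (ltngtP (rb x) r) => /= xr.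
- by case: (P x); rewrite -IHs // mulrA.
- exact: IHs.
- have s0 : \prod_(z <- s | (rb z < r)%N && P z) F z = 1.
    by rewrite big1_seq // => z /andP[/andP[+ _] /(allP xs)]; rewrite xr; lia.
  by move: (IHs ss); rewrite s0 !mul1r => ->.
Qed.

Lemma e_naturalE : e_natural Q n I = gam Q rb n.
Proof.
rewrite /e_natural (eq_big_nat _ _ (F2 := fun a =>
  \prod_(z | (rb z == a) && nonfirst rb z) jm Q rb z)); last first.
  by move=> a /andP[_ aI]; apply: block_esymE.
rewrite prod_blocks /gam big_mkord big_mkcond [RHS](eq_bigr (fun z : 'I_n =>
  if nonfirst rb z then jm Q rb z else 1)); last by move=> z _; apply: gfacE.
by apply: eq_bigr => z _; rewrite rb_bound.
Qed.

(** A word for a Coxeter element of the Young subgroup. *)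
Definition gens : seq 'I_n.-1 := enum [set i | block_gen rb i].

Lemma gens_sorted : sorted (@incr n) gens. Proof. exact: sorted_enum. Qed.
Lemma mem_gens : gens =i [pred i | block_gen rb i].
Proof. by move=> i; rewrite mem_enum inE. Qed.
Lemma size_gens : size gens = (n - size I)%N.
Proof. by rewrite -card_gens -cardE; apply: eq_card => i; rewrite inE. Qed.

Lemma normalization_e_central : hcentral (normalization I (e_natural Q n I)).
Proof.
rewrite normalizationE e_naturalE; apply: (normalization_central rb_homo) => j bj.
by apply: gam_comm => //; apply: rb_homo.
Qed.

End Composition.

(** * The transition matrix from power sums to monomial functions *)

Section PowerToMonomial.
Variable n : nat.
Implicit Types la mu : intpart n.

Lemma parts_pos la : all (ltn 0) (parts la).
Proof. by apply/allP => k; apply: intpart_gt0. Qed.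

Definition rbo la (v : 'I_n) : 'I_(size (parts la)) :=
  Ordinal (rb_bound (intpart_sum la) v).

Lemma merges_sum la mu (f : {ffun 'I_(size (parts la)) -> 'I_n}) :
  (f \in merges (rbo la) (rb mu)) =
  [forall j : 'I_n, \sum_(a | f a == j) nth 0%N la a == nth 0%N mu j].
Proof.
rewrite inE; apply: eq_forallb => j; rewrite (card_rb (intpart_sum mu)); congr (_ == _).
rewrite -sum1dep_card (partition_big (rbo la) (fun a => f a == j)) //=.
apply: eq_bigr => a /eqP fa; rewrite -(card_rb (intpart_sum la)) -sum1dep_card.
apply: eq_bigl => v; rewrite andbC.
have -> : (rbo la v == a) = (rb la v == a) by [].
case: eqVneq => //= va; apply/eqP; rewrite -fa; congr (f _); exact: ord_inj.
Qed.

(** Expanding the product of power sums means choosing a variable for each part of [la]; the chosen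
    monomial is that of [mu] exactly when the choice is a merging map. *)
Lemma p2mE la mu : p2m la mu = #|merges (rbo la) (rb mu)|%:Z.
Proof.
rewrite /p2m /psym (big_nth 0%N) big_mkord bigA_distr_bigA /= raddf_sum /=.
rewrite -natz -sumr_const [RHS]big_mkcond /=; apply: eq_bigr => f _.
rewrite mprodXnE mcoeffX merges_sum.
have -> : (\sum_a U_(f a) *+ nth 0%N la a == part_mnm mu)%MM =
    [forall j : 'I_n, \sum_(a | f a == j) nth 0%N la a == nth 0%N mu j].
  have mE j : (\sum_a U_(f a) *+ nth 0%N la a)%MM j = \sum_(a | f a == j) nth 0%N la a.
    rewrite mnm_sumE [RHS]big_mkcond; apply: eq_bigr => a _.
    by rewrite mulmnE mnm1E; case: eqP; rewrite ?mul1n ?mul0n.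
  apply/eqP/forallP => [e j|e]; first by rewrite -mE e mnmE.
  by apply/mnmP => j; rewrite mE mnmE (eqP (e j)).
by case: [forall j, _].
Qed.

End PowerToMonomial.

Lemma coef_normalization_e (R : comNzRingType) (Q : R) (n : nat) (la mu : intpart n) :
  coef (normalization la (e_natural Q n la) * hword Q (rev (gens n mu))) 1%g =
  Q ^+ (size (parts la) - size (parts mu)) *+ #|merges (rbo la) (rb mu)|.
Proof.
have rbh := @rb_homo n la.
rewrite (@e_naturalE n la (intpart_sum la) (parts_pos la)) normalizationE.
rewrite (coef_normalization Q rbh (gens_sorted n mu)).
rewrite (size_gens (intpart_sum mu) (parts_pos mu)) (card_gens (intpart_sum la) (parts_pos la)).
have le1 := intpart_size la; have le2 := intpart_size mu.
(* The exponent [(n - size mu) - (n - size la)] is truncated at the same time as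
   [size la - size mu]. *)
congr (Q ^+ _ *+ _); first by lia.
apply: (@card_good n _ (rbo la)) => //; last exact: mem_gens.
- exact: rb_homo.
- move=> a; have [v va] := rb_surj (intpart_sum la) (parts_pos la) (ltn_ord a).
  by exists v; apply: ord_inj.
- by move=> p; apply: leq_trans (rb_bound (intpart_sum mu) p) le2.
Qed.

(** * Cycle types and words up to commutators *)

Section IncreasingWords.
Variable n : nat.
Implicit Types (s t : seq 'I_n.-1) (i j k : 'I_n.-1) (x : 'I_n) (w v g : 'S_n).

Lemma word_perm_fix s x : all (fun j : 'I_n.-1 => (x < j) || (j.+1 < x))%N s ->
  word_perm s x = x.
Proof.
elim: s => [|j s IHs]; first by rewrite word_perm_nil perm1.
move=> /andP[xj xs]; rewrite word_perm_cons permM (_ : sgen j x = x) ?IHs //.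
by apply: ord_inj; rewrite sgen_val; liaif.
Qed.

Lemma sorted_cat_incr s k t : sorted (@incr n) (s ++ k :: t) ->
  all (fun j : 'I_n.-1 => j < k)%N s /\ all (fun j : 'I_n.-1 => k < j)%N t.
Proof.
rewrite sorted_pairwise; last exact: incr_trans.
rewrite pairwise_cat allrel_consr /= => /and4P[/andP[sk _] _ kt _]; split=> //.
Qed.

Lemma word_perm_hi s k : sorted (@incr n) s -> k \in s -> word_perm s (hi k) = lo k.
Proof.
move=> + /splitPr sk; case: sk => s1 s2 /sorted_cat_incr[h1 h2].
rewrite word_perm_cat word_perm_cons !permM (@word_perm_fix s1); last first.
  by apply: sub_all h1 => j /=; lia.
rewrite sgen_hi word_perm_fix //; apply: sub_all h2 => j /=; lia.
Qed.

Lemma reduced_incr s : sorted (@incr n) s -> reduced s.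
Proof.
elim: s => [|i s IHs] ss; first by rewrite /reduced word_perm_nil len1.
rewrite reduced_cons IHs ?(path_sorted ss) //.
have [_ si] := @sorted_cat_incr [::] i s ss.
have fix_ x : (x <= i)%N -> word_perm s x = x.
  by move=> xi; apply: word_perm_fix; apply: sub_all si => j /=; lia.
rewrite /desc (fix_ (lo i)) // -leqNgt; apply: ltnW; rewrite ltnNge; apply/negP => le.
have := perm_neq (word_perm s) (word_perm s (hi i)) (hi i).
rewrite (fix_ _ le) eqxx => /esym/eqP e.
by move: le; rewrite e /=; lia.
Qed.

Variable b : 'I_n -> nat.
Hypothesis b_homo : forall x y : 'I_n, (x <= y)%N -> (b x <= b y)%N.

Lemma block_perm_word s : all (block_gen b) s -> block_perm b (word_perm s).
Proof.
elim: s => [_|i s IHs]; first by rewrite word_perm_nil block_perm1.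
by move=> /andP[bi bs]; rewrite word_perm_cons block_permM ?block_gen_perm ?IHs.
Qed.

Lemma block_perm_porbit w x y : block_perm b w -> x \in porbit w y -> b x = b y.
Proof.
move=> bw /porbitP[i ->]; elim: i => [|i IHi]; first by rewrite expg0 perm1.
by rewrite expgSr permM (block_permP _ _ bw).
Qed.

(** Orbits stay inside blocks, so the first positions of different blocks lie in different
    orbits. *)
Lemma leq_first_porbits w : block_perm b w ->
  (#|[set z | ~~ nonfirst b z]| <= #|porbits w|)%N.
Proof.
move=> bw.
have inj : {in [set z | ~~ nonfirst b z] &, injective (porbit w)}.
  move=> z z'; rewrite !inE => fz fz' e; apply: (first_inj fz fz').
  by apply: (block_perm_porbit bw); rewrite -e porbit_id.
rewrite -(card_in_imset inj); apply/subset_leq_card/subsetP => _ /imsetP[z _ ->].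
exact: imset_f.
Qed.

End IncreasingWords.

Section CycleType.
Variable n : nat.
Implicit Types (w g : 'S_n) (la mu : intpart n).

Lemma sort_geq_perm (s t : seq nat) : perm_eq s t -> sort geq s = sort geq t.
Proof.
apply/perm_sortP => [x y|x y z /= xy zx|x y /= /andP[xy yx]]; first exact: leq_total.
  exact: leq_trans zx xy.
by apply/eqP; rewrite eqn_leq xy yx.
Qed.

Lemma cycle_type_conj w g : cycle_type (w ^ g)%g = cycle_type w.
Proof.
apply: sort_geq_perm; pose f (c : {set 'I_n}) := g @: c.
have f_inj : injective f by apply/imset_inj/perm_inj.
have porbitJ x : porbit (w ^ g)%g (g x) = f (porbit w x).
  apply/setP => y; apply/porbitP/imsetP => [[i ->]|[_ /porbitP[i ->] ->]].
    by exists ((w ^+ i)%g x); rewrite ?mem_porbit // -conjXg permJ.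
  by exists i; rewrite -conjXg permJ.
have pE : perm_eq (enum (porbits (w ^ g)%g)) (map f (enum (porbits w))).
  apply: uniq_perm; rewrite ?map_inj_uniq ?enum_uniq // => c.
  rewrite mem_enum; apply/imsetP/mapP => [[x _ ->]|[c' + ->]].
    exists (porbit w (g^-1 x)%g); first by rewrite mem_enum imset_f.
    by rewrite -porbitJ permKV.
  by rewrite mem_enum => /imsetP[x _ ->]; exists (g x); rewrite ?porbitJ.
apply: (perm_trans (perm_map _ pE)); rewrite -map_comp.
rewrite (eq_map (g := fun c : {set 'I_n} => #|c|)) // => c /=.
by rewrite card_imset //; apply: perm_inj.
Qed.

Lemma size_cycle_type w : size (cycle_type w) = #|porbits w|.
Proof. by rewrite size_sort size_map cardE. Qed.

Definition cox mu : 'S_n := word_perm (gens n mu).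

Lemma Tw_cox (R : comNzRingType) (Q : R) mu : Tw Q (cox mu) = hword Q (gens n mu).
Proof. by rewrite Tw_word // reduced_incr // gens_sorted. Qed.

(** The increasing word sends [hi k] to [lo k] for each of its letters, which joins neighbours of a
    block; conversely it preserves the blocks. *)
Lemma porbit_cox mu x : porbit (cox mu) x = [set v | rb mu v == rb mu x].
Proof.
apply/setP => y; rewrite inE; apply/idP/eqP => [|bxy].
  apply: block_perm_porbit; apply: block_perm_word; apply/allP => i.
  by rewrite mem_gens.
rewrite (_ : porbit (cox mu) x = porbit (cox mu) y) ?porbit_id //.
apply/esym; apply: (block_const (@rb_homo n mu)) bxy => i bi.
rewrite -(porbit_perm _ 1 (hi i)) expg1 word_perm_hi ?gens_sorted //.
by rewrite mem_gens.
Qed.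

Lemma cycle_type_cox mu : cycle_type (cox mu) = mu.
Proof.
pose blk a : {set 'I_n} := [set v | rb mu v == a].
have cblk a : #|blk a| = nth 0%N mu a by apply/card_rb/intpart_sum.
have pE : perm_eq (enum (porbits (cox mu))) [seq blk a | a <- iota 0 (size mu)].
  apply: uniq_perm; first exact: enum_uniq.
    rewrite map_inj_in_uniq ?iota_uniq // => a a'; rewrite !mem_iota !add0n /= => am _ e.
    have [v va] := rb_surj (intpart_sum mu) (parts_pos mu) am.
    have : v \in blk a by rewrite inE va.
    by rewrite e inE va => /eqP.
  move=> c; rewrite mem_enum; apply/imsetP/mapP => [[x _ ->]|[a]].
    by exists (rb mu x); rewrite ?porbit_cox // mem_iota (rb_bound (intpart_sum mu)).
  rewrite mem_iota add0n /= => am ->.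
  have [v va] := rb_surj (intpart_sum mu) (parts_pos mu) am.
  by exists v; rewrite // porbit_cox va.
have pmu : perm_eq [seq #|c| | c : {set 'I_n} <- enum (porbits (cox mu))] mu.
  apply: (perm_trans (perm_map _ pE)); rewrite -map_comp.
  rewrite (eq_map (g := nth 0%N mu)); last exact: cblk.
  by rewrite -/(mkseq _ _) mkseq_nth.
apply: (sorted_eq (leT := geq)) => [x y z /= xy zx|x y /= /andP[xy yx]||| ].
- exact: leq_trans zx xy.
- by apply/eqP; rewrite eqn_leq xy yx.
- by apply: sort_sorted => x y; apply: leq_total.
- exact: intpart_sorted.
- by apply: perm_trans pmu; rewrite perm_sort.
Qed.

Lemma card_porbits_cox mu : #|porbits (cox mu)| = size (parts mu).
Proof. by rewrite -size_cycle_type cycle_type_cox. Qed.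

End CycleType.

Section SetBlocks.
Variables (n : nat) (S : {set 'I_n.-1}).

(** A new block starts after position [m] when the generator [m] is not in [S]; [setb v] counts the
    cuts before [v]. *)
Definition cut (m : nat) := if insub m is Some i then i \notin S else true.
Definition setb (v : 'I_n) : nat := count cut (iota 0 v).

Lemma setb_homo (x y : 'I_n) : (x <= y)%N -> (setb x <= setb y)%N.
Proof.
by move=> xy; rewrite /setb -(subnKC xy) iotaD count_cat leq_addr.
Qed.

Lemma setb_le v : (setb v <= v)%N.
Proof. by rewrite -[X in (_ <= X)%N](size_iota 0) count_size. Qed.

Lemma setb_bound v : (setb v < n)%N.
Proof. exact: leq_ltn_trans (setb_le v) (ltn_ord v). Qed.

Lemma block_gen_setb i : block_gen setb i = (i \in S).
Proof.
have -> : block_gen setb i = (setb (lo i) == setb (lo i) + cut i)%N.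
  rewrite /block_gen; congr (_ == _); rewrite /setb (_ : hi i = (i + 1)%N :> nat) ?addn1 //.
  by rewrite -addn1 iotaD count_cat /= add0n addn0.
rewrite /cut valK; case: (i \in S); first by rewrite addn0 eqxx.
by rewrite addn1; lia.
Qed.

End SetBlocks.

Lemma perm_nonzero (s t : seq nat) : size s = size t ->
  perm_eq [seq k <- s | 0 < k]%N [seq k <- t | 0 < k]%N -> perm_eq s t.
Proof.
have pz (r : seq nat) : perm_eq r
    ([seq k <- r | 0 < k]%N ++ nseq (size r - size [seq k <- r | 0 < k]%N) 0%N).
  rewrite -(perm_filterC (ltn 0) r) perm_cat2l.
  have -> : (size r - size [seq k <- r | 0 < k] = size [seq k <- r | predC (ltn 0) k])%N.
    by rewrite !size_filter -(count_predC (ltn 0) r) addKn.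
  by elim: r => //= -[|k] r IHr //=; rewrite perm_cons.
move=> st pst; apply: (perm_trans (pz s)); rewrite perm_sym; apply: (perm_trans (pz t)).
by rewrite st (perm_size pst) perm_cat2r perm_sym.
Qed.

Lemma hword_unit (R : comNzRingType) (Q : R) n (s : seq 'I_n.-1) :
  exists y, hword Q s * y = 1 /\ y * hword Q s = 1.
Proof.
elim: s => [|i s [y [sy ys]]]; first by exists 1; rewrite hword_nil mulr1.
(* By the quadratic relation the inverse of [g_i] is [g_i - Q]. *)
have gi : hgen Q i * (hgen Q i - Q%:A) = 1.
  by rewrite mulrBr hgen_quad mulr_algr addrC addKr.
have ig : (hgen Q i - Q%:A) * hgen Q i = 1.
  by rewrite mulrBl hgen_quad mulr_algl addrC addKr.
exists (y * (hgen Q i - Q%:A)); rewrite hword_cons; split.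
  by rewrite mulrA -(mulrA (hgen Q i)) sy mulr1.
by rewrite mulrA -(mulrA y) ig mulr1.
Qed.

Lemma Tw_unit (R : comNzRingType) (Q : R) n (w : 'S_n) :
  exists y, Tw Q w * y = 1 /\ y * Tw Q w = 1.
Proof. by have [s rs <-] := redP w; rewrite Tw_word //; apply: hword_unit. Qed.

(** * From the blocks of a set of generators to a partition *)

Section TraceComposition.
Variables (n : nat) (S : {set 'I_n.-1}).

(** With labels in ['I_n] the block sizes, padded by zeros, form an exponent of degree [n]; [s]
    relabels the blocks so that the sizes become those of [mu]. *)
Lemma setb_intpart : exists (mu : intpart n) (s : 'S_n), forall j,
  #|[set v : 'I_n | s (Ordinal (setb_bound S v)) == j :> nat]| =
  #|[set v : 'I_n | rb mu v == j]|.
Proof.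
pose m : 'X_{1..n} := [multinom #|[set v : 'I_n | setb S v == j]| | j < n].
have mn : mdeg m = n.
  rewrite mdegE -[RHS]card_ord -sum1_card.
  rewrite [RHS](partition_big (fun v => Ordinal (setb_bound S v)) predT) //=.
  by apply: eq_bigr => j _; rewrite /m mnmE -sum1dep_card; apply: eq_bigl.
have [mu pmu] := mnm_intpart mn; exists mu.
have : perm_eq m (part_mnm mu).
  by apply: perm_nonzero; rewrite ?size_tuple // part_mnmE.
case/tuple_permP => s sE; exists s => j.
rewrite (card_rb (intpart_sum mu)).
case: (ltnP j n) => jn; last first.
  rewrite nth_default ?(leq_trans (intpart_size mu)) // eq_card0 // => v; rewrite !inE.
  by apply/negbTE; rewrite neq_ltn (leq_trans (ltn_ord _) jn).
have mE i : m i = part_mnm mu (s i).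
  have -> : m = Multinom [tuple tnth (part_mnm mu) (s j) | j < n] by apply/val_inj/val_inj.
  by rewrite mnm_tnth tnth_mktuple mnm_tnth.
have := mE (s^-1 (Ordinal jn))%g; rewrite permKV !mnmE /= => <-.
apply: eq_card => v; rewrite !inE -[j in LHS]/(Ordinal jn : nat).
rewrite -[LHS]/(s (Ordinal (setb_bound S v)) == Ordinal jn).
by rewrite -(inj_eq (@perm_inj _ s^-1%g)) permK.
Qed.

(** The relabelling [F] is injective on blocks, so the arrangement permutes them without merging.
    Then the letters of [gens n mu] cross [T_d] one by one and become the letters of [S]; as [T_d]
    is invertible, the two words have the same traces. That [mu] precedes [R] and [Q] permits the
    comparison with [Q = 0]. *)
Lemma trace_set : exists mu : intpart n, forall (R : comNzRingType) (Q : R) phi,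
  trace (Q := Q) phi -> phi (hword Q (enum S)) = phi (hword Q (gens n mu)).
Proof.
have [mu [s cnt]] := setb_intpart; exists mu => R Q phi tp.
pose F v : nat := s (Ordinal (setb_bound S v)).
have bh := @setb_homo n S; have ch := @rb_homo n mu.
have Finj v v' : F v = F v' -> setb S v = setb S v'.
  by move=> /ord_inj/perm_inj/(congr1 val).
have Fb i : block_gen (setb S) i -> F (lo i) = F (hi i).
  by move=> /eqP e; rewrite /F; congr (nat_of_ord (s _)); apply: ord_inj.
pose d := ((arr F (setb S))^-1)%g.
have aF v : rb mu (arr F (setb S) v) = F v := arr_block (setb S) ch cnt v.
have dm : minrep (setb S) d := arr_minrep bh Fb.
have word t : all (block_gen (rb mu)) t -> uniq t -> exists t',
    [/\ uniq t', forall j, (j \in t') = has (linked d ^~ j) t &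
      hword Q t * Tw Q d = Tw Q d * hword Q t'].
  elim: t => [_ _|i t IHt /= /andP[ci ct] /andP[it ut]].
    by exists [::]; split=> //; rewrite hword_nil mul1r mulr1.
  have [t' [ut' t'E e]] := IHt ct ut.
  have bd : setb S (d (lo i)) = setb S (d (hi i)).
    apply: Finj; rewrite -!aF !permKV; exact: eqP ci.
  have [j [bj lj hj sd]] := minrep_same bh dm bd.
  have [gd _] := hgen_minrep Q bh dm bj sd.
  have linkE k j' : linked d k j' -> d (lo k) = lo j' by case/andP => /eqP.
  exists (j :: t'); split.
  - rewrite /= ut' andbT t'E; apply/hasPn => k kt; apply/negP => /linkE.
    by rewrite lj => /perm_inj/(congr1 val) /= /ord_inj ki; rewrite -ki kt in it.
  - move=> j'; rewrite inE t'E; congr orb; rewrite /linked -lj -hj.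
    rewrite !ord_eqE /= eqSS andbb eq_sym; exact: gen_eqE.
  - by rewrite !hword_cons -mulrA e mulrA gd mulrA.
have gc : all (block_gen (rb mu)) (gens n mu).
  by apply/allP => i; rewrite mem_gens.
have [t [ut tE e]] := word _ gc (enum_uniq _).
have tS : enum S =i t.
  move=> j; rewrite mem_enum tE; apply/idP/hasP => [jS|[i i_gens /andP[/eqP li /eqP hi_]]].
    have bj : block_gen (setb S) j by rewrite block_gen_setb.
    have [i li hi_] := arr_gen Fb bj.
    exists i; last by rewrite /linked li hi_ !permK !eqxx.
    by rewrite mem_gens inE (arr_block_gen Fb ch cnt bj).
  rewrite -block_gen_setb /block_gen; apply/eqP/Finj.
  rewrite -!aF -li -hi_ /d !permKV.
  by move: i_gens; rewrite mem_gens => /eqP.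
have [y [dy yd]] := Tw_unit Q d.
have [_ _ tC] := tp.
rewrite (trace_word tp (enum_uniq _) ut tS).
rewrite -[hword Q (gens n mu)]mulr1 -dy mulrA e -mulrA tC -mulrA yd.
by rewrite mulr1.
Qed.

End TraceComposition.

(** * The center *)

Section TraceBasis.
Variables (R : comNzRingType) (Q : R) (n : nat).
Local Notation H := (hecke Q n).
Implicit Types (h z : H) (mu nu : intpart n).

Lemma trace_sum (phi : H -> R) (T : Type) (r : seq T) (P : pred T) (F : T -> H) :
  trace phi -> phi (\sum_(i <- r | P i) F i) = \sum_(i <- r | P i) phi (F i).
Proof. by move=> tp; have [tD _ _] := tp; apply: (big_morph phi tD (trace0 tp)). Qed.

Lemma trace_expand h : exists c : {ffun intpart n -> R}, forall phi, trace phi ->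
  phi h = \sum_mu c mu * phi (hword Q (gens n mu)).
Proof.
have [c hc] := spannedP h.
pose expands x := exists e : {ffun intpart n -> R}, forall phi, trace phi ->
  phi x = \sum_mu e mu * phi (hword Q (gens n mu)).
suff [e he] : expands (\sum_A c A *: hword Q (enum A)).
  exists e => phi tp; rewrite hc // -he // trace_sum //.
  by apply: eq_bigr => A _; have [_ tZ _] := tp; rewrite tZ.
elim/big_ind: _ => [|x y [e he] [e' he']|A _].
- by exists [ffun=> 0] => phi tp; rewrite trace0 // big1 // => mu _; rewrite ffunE mul0r.
- exists [ffun mu => e mu + e' mu] => phi tp; have [tD _ _] := tp.
  rewrite tD he // he' // -big_split; apply: eq_bigr => mu _.
  by rewrite ffunE mulrDl.
- have [mu hmu] := trace_set A; exists [ffun nu => c A * (nu == mu)%:R] => phi tp.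
  have [_ tZ _] := tp; rewrite tZ hmu // (bigD1 mu) //= ffunE eqxx mulr1 big1 ?addr0 //.
  by move=> nu ne; rewrite ffunE (negPf ne) mulr0 mul0r.
Qed.

(** Read as a pairing it determines a central element; read as a coefficient at the inverse of
    [cox mu], an element of minimal length, it meets the characterization of the Geck-Rouquier
    elements. *)
Definition tcoef z mu := coef (z * hword Q (gens n mu)) 1%g.

Lemma tcoefE z mu : tcoef z mu = coef z (cox mu)^-1%g.
Proof. by rewrite /tcoef -Tw_cox coef_tau. Qed.

Lemma tcoefB z z' mu : tcoef (z - z') mu = tcoef z mu - tcoef z' mu.
Proof. by rewrite /tcoef mulrBl coefB. Qed.
Lemma tcoefZ a z mu : tcoef (a *: z) mu = a * tcoef z mu.
Proof. by rewrite /tcoef -scalerAl coefZ. Qed.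
Lemma tcoef_sum (T : Type) (r : seq T) (P : pred T) (F : T -> H) mu :
  tcoef (\sum_(i <- r | P i) F i) mu = \sum_(i <- r | P i) tcoef (F i) mu.
Proof. by rewrite /tcoef mulr_suml coef_sum. Qed.

Lemma hcentralB z z' : hcentral z -> hcentral z' -> hcentral (z - z').
Proof. by move=> zc zc' h; rewrite mulrBl mulrBr zc zc'. Qed.
Lemma hcentralZ a z : hcentral z -> hcentral (a *: z).
Proof. by move=> zc h; rewrite -scalerAl -scalerAr zc. Qed.
Lemma hcentral_sum (T : Type) (r : seq T) (P : pred T) (F : T -> H) :
  (forall i, hcentral (F i)) -> hcentral (\sum_(i <- r | P i) F i).
Proof.
by move=> Fc h; rewrite mulr_suml mulr_sumr; apply: eq_bigr => i _; apply: Fc.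
Qed.

Lemma central_eq z z' : hcentral z -> hcentral z' -> tcoef z =1 tcoef z' -> z = z'.
Proof.
move=> zc zc' zz; apply: coef_inj => w; apply/eqP; rewrite -subr_eq0 -coefB coefE.
have [c hc] := trace_expand (Tw Q w^-1%g).
rewrite (hc _ (trace_central (hcentralB zc zc'))) big1 // => mu _.
by rewrite -/(tcoef _ _) tcoefB zz subrr mulr0.
Qed.

End TraceBasis.

Section ClassFunctions.
Variables (R : comNzRingType) (n : nat) (chi : 'S_n -> R).
Hypothesis chiC : forall u v, chi (u * v)%g = chi (v * u)%g.
Local Notation H := (hecke (0 : R) n).

(* At [Q = 0] the algebra is the group algebra of ['S_n]. *)
Lemma trace_class_fun : trace (fun h : H => \sum_w chi w * coef h w).
Proof.
have gen i y : \sum_w chi w * coef (hgen (0 : R) i * y) w =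
    \sum_w chi w * coef (y * hgen (0 : R) i) w.
  under eq_bigr => w _ do rewrite coef_gen mul0r if_same addr0.
  under [RHS]eq_bigr => w _ do rewrite coef_genr mul0r if_same addr0.
  rewrite (reindex_inj (mulgI (sgen i))) [RHS](reindex_inj (mulIg (sgen i))) /=.
  by apply: eq_bigr => w _; rewrite sgenK sgenKr chiC.
split=> [x y|a x|x y].
- by rewrite -big_split; apply: eq_bigr => w _; rewrite coefD mulrDr.
- by rewrite mulr_sumr; apply: eq_bigr => w _; rewrite coefZ mulrCA.
elim/hecke_ind: x y => [a x IHx y|y|i y|x x' IHx IHx' y|i x IHx y].
- rewrite -scalerAl -scalerAr; under eq_bigr => w _ do rewrite coefZ mulrCA.
  under [RHS]eq_bigr => w _ do rewrite coefZ mulrCA.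
  by rewrite -!mulr_sumr IHx.
- by rewrite mul1r mulr1.
- exact: gen.
- rewrite mulrDl mulrDr; under eq_bigr => w _ do rewrite coefD mulrDr.
  under [RHS]eq_bigr => w _ do rewrite coefD mulrDr.
  by rewrite !big_split /= IHx IHx'.
- by rewrite -mulrA gen -mulrA IHx mulrA.
Qed.

Lemma class_fun_Tw w : \sum_u chi u * coef (Tw (0 : R) w) u = chi w.
Proof.
rewrite (bigD1 w) //= coef_Tw eqxx mulr1 big1 ?addr0 // => u uw.
by rewrite coef_Tw (negPf uw) mulr0.
Qed.

End ClassFunctions.

(** * Elements of minimal length in their conjugacy class *)

Section MinimalLength.
Variable n : nat.
Implicit Types (w v u : 'S_n) (mu nu : intpart n).

Lemma cycle_typeC u v : cycle_type (u * v)%g = cycle_type (v * u)%g.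
Proof. by rewrite -(cycle_type_conj (u * v)%g u) conjgE mulgA mulKg. Qed.

Lemma cycle_typeV w : cycle_type w^-1%g = cycle_type w.
Proof. by rewrite /cycle_type porbitsV. Qed.

(* Otherwise the indicator function of the class of [w], a trace function at [Q = 0],
   would vanish on all the words spanning the algebra modulo commutators. *)
Lemma conj_cox w : exists mu, cox mu \in (w ^: [set: 'S_n])%g.
Proof.
apply/existsP; apply: contraT => /existsPn nw.
pose chi v : int := (w \in (v ^: [set: 'S_n])%g)%:R.
have chiC u v : chi (u * v)%g = chi (v * u)%g.
  rewrite /chi; congr (nat_of_bool (_ \in _))%:R.
  by rewrite -(classGidl (u * v)%g (in_setT u)) conjgE mulgA mulKg.
have [c hc] := trace_expand (Tw (0 : int) w).
have := hc _ (trace_class_fun chiC); rewrite class_fun_Tw.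
rewrite big1 => [|mu _]; first by rewrite /chi class_refl.
rewrite -Tw_cox class_fun_Tw /chi class_sym (negPf (nw mu)) mulr0.
by [].
Qed.

(** [w] preserves the blocks cut out by the letters of [t]; there are [n] minus the number of
    distinct letters of them, and each contains an orbit. *)
Lemma len_porbits w t : word_perm t = w -> (n <= #|porbits w| + #|[set i in t]|)%N.
Proof.
move=> tw; pose S := [set i in t].
have bw : block_perm (setb S) w.
  rewrite -tw; apply: block_perm_word; apply/allP => i it.
  by rewrite block_gen_setb inE.
have le := leq_first_porbits bw.
have := card_block_gen (@setb_homo n S).
have -> : #|[pred i | block_gen (setb S) i]| = #|S|.
  by apply: eq_card => i; rewrite !inE block_gen_setb inE.
by move=> e; apply: leq_trans (leq_add le (leqnn _)); rewrite e.
Qed.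

Lemma cardset_size (t : seq 'I_n.-1) : (#|[set i in t]| <= size t)%N.
Proof. by rewrite cardsE card_size. Qed.

Lemma len_cox mu : (len (cox mu) <= n - size (parts mu))%N.
Proof.
by rewrite -(size_gens (intpart_sum mu) (parts_pos mu)); apply: len_min.
Qed.

Lemma len_ge w : (n - #|porbits w| <= len w)%N.
Proof.
have [t rt <-] := redP w; have := len_porbits (erefl (word_perm t)).
have := cardset_size t; rewrite (eqP rt); lia.
Qed.

Lemma porbits_class v w : v \in (w ^: [set: 'S_n])%g -> #|porbits v| = #|porbits w|.
Proof. by case/imsetP => g _ ->; rewrite -!size_cycle_type cycle_type_conj. Qed.

(** Its length is at most [n] minus its number of cycles, a lower bound for the length throughout
    the class. *)
Lemma min_cox mu : min_in_class (cox mu)^-1%g.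
Proof.
apply/forall_inP => v /porbits_class; rewrite porbitsV card_porbits_cox => e.
rewrite !plength_len lenV; apply: leq_trans (len_cox mu) _.
by rewrite -e len_ge.
Qed.

(* Every conjugacy class contains some [cox mu], so the length of [w] is [n] minus its
   number of cycles; a reduced word with a repeated letter would leave more cycles. *)
Lemma min_word w : min_in_class w -> exists t, [/\ uniq t, reduced t & word_perm t = w].
Proof.
move=> /forall_inP wmin; have [mu cmu] := conj_cox w.
have [t rt tw] := redP w; exists t; split=> //; apply/card_uniqP.
have le := wmin _ cmu; rewrite !plength_len in le.
have e := porbits_class cmu; rewrite card_porbits_cox in e.
have lp := len_porbits tw; rewrite cardsE -e in lp.
have lt : (size t <= n - size (parts mu))%N.
  by rewrite (eqP rt) tw; apply: leq_trans le (len_cox mu).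
apply/eqP; rewrite eqn_leq card_size /=; apply: leq_trans lt _.
by rewrite leq_subLR.
Qed.

Lemma min_trace w : min_in_class w -> exists nu, cycle_type w = nu /\
  forall (R : comNzRingType) (Q : R) phi, trace (Q := Q) phi ->
    phi (Tw Q w^-1%g) = phi (hword Q (gens n nu)).
Proof.
move=> /min_word[t [ut rt tw]].
have [nu nuP] := trace_set [set i in t]; exists nu.
have P (R : comNzRingType) (Q : R) phi : trace (Q := Q) phi ->
    phi (Tw Q w^-1%g) = phi (hword Q (gens n nu)).
  move=> tp; rewrite -nuP // -tw -word_perm_rev Tw_word; last first.
    by rewrite /reduced size_rev word_perm_rev lenV.
  by apply: trace_word; rewrite ?rev_uniq ?enum_uniq // => i; rewrite mem_rev mem_enum inE.
(* The indicator of cycle type [nu], a trace function at [Q = 0], takes the value 1 on the word of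
   [nu], hence on [w^-1]; this identifies [nu]. *)
split=> //; pose chi v : int := (cycle_type v == nu)%:R.
have chiC u v : chi (u * v)%g = chi (v * u)%g by rewrite /chi cycle_typeC.
have := P _ _ _ (trace_class_fun chiC); rewrite -Tw_cox !class_fun_Tw /chi.
by rewrite cycle_typeV cycle_type_cox eqxx; case: eqP.
Qed.

End MinimalLength.

(** * Triangularity *)

Section MergeCount.
Variable n : nat.
Implicit Types la mu nu : intpart n.

Definition nmerge la mu := #|merges (rbo la) (rb mu)|.

Lemma merge_image la mu f : f \in merges (rbo la) (rb mu) ->
  [set j : 'I_n | (j < size (parts mu))%N] \subset f @: [set: 'I_(size (parts la))].
Proof.
rewrite merges_sum => /forallP fm; apply/subsetP => j; rewrite inE => jm.
have := fm j; apply: contraLR => nj; rewrite big_pred0.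
  by rewrite eq_sym -lt0n; apply: (allP (parts_pos mu)); apply: mem_nth.
by move=> a; apply: contraNF nj => /eqP <-; apply: imset_f.
Qed.

Lemma card_initial m : (m <= n)%N -> #|[set j : 'I_n | (j < m)%N]| = m.
Proof.
move=> mn; have inj : injective (widen_ord mn).
  by move=> i j /(congr1 val) /= /ord_inj.
rewrite -[RHS]card_ord -cardsT -(card_imset _ inj).
apply: eq_card => j; rewrite inE; apply/idP/imsetP => [jm|[i _ ->]]; last exact: (ltn_ord i).
by exists (Ordinal jm) => //; apply: ord_inj.
Qed.

Lemma nmerge_size la mu : nmerge la mu != 0%N -> (size (parts mu) <= size (parts la))%N.
Proof.
rewrite -lt0n => /card_gt0P[f /merge_image/subset_leq_card].
rewrite card_initial ?intpart_size // => h; apply: leq_trans h _.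
by rewrite -[X in (_ <= X)%N]card_ord -cardsT leq_imset_card.
Qed.

(** With equally many parts a merging map is a bijection onto the nonempty labels, so the parts of
    [la] are those of [mu] rearranged. *)
Lemma nmerge_eq la mu : nmerge la mu != 0%N -> size (parts mu) = size (parts la) -> la = mu.
Proof.
rewrite -lt0n => /card_gt0P[f fm] sE.
have sub := merge_image fm; have cI := card_initial (intpart_size mu).
have cf : #|f @: [set: 'I_(size (parts la))]| = #|[set: 'I_(size (parts la))]|.
  apply/eqP; rewrite eqn_leq leq_imset_card /=.
  by have := subset_leq_card sub; rewrite cI sE cardsT card_ord.
have f_inj : injective f by move=> a a'; apply: (imset_injP (introT eqP cf)); rewrite inE.
have imE : f @: [set: 'I_(size (parts la))] = [set j : 'I_n | (j < size (parts mu))%N].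
  by apply/eqP; rewrite eq_sym eqEcard sub cf cI cardsT card_ord sE leqnn.
apply/eqP; rewrite -intpart_perm_eq.
have laE : parts la = [seq nth 0%N mu (f a) | a <- enum 'I_(size (parts la))].
  apply: (@eq_from_nth _ 0%N) => [|i il]; first by rewrite size_map size_enum_ord.
  rewrite (nth_map (Ordinal il)) ?size_enum_ord //.
  move: fm; rewrite merges_sum => /forallP/(_ (f (nth (Ordinal il) (enum _) i)))/eqP <-.
  rewrite (big_pred1 (nth (Ordinal il) (enum 'I_(size (parts la))) i)) => [|a].
    by rewrite nth_enum_ord.
  by rewrite /= (inj_eq f_inj).
rewrite laE -[X in perm_eq _ X](mkseq_nth 0%N) /mkseq.
rewrite (map_comp (nth 0%N mu) (fun a => f a : nat)); apply: perm_map; apply: uniq_perm.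
- by rewrite map_inj_uniq ?enum_uniq // => a a' /ord_inj/f_inj.
- exact: iota_uniq.
move=> j; rewrite mem_iota add0n /=; apply/mapP/idP => [[a _ ->]|jm].
  have : f a \in f @: [set: 'I_(size (parts la))] by apply: imset_f.
  by rewrite imE inE.
have jn : (j < n)%N := leq_trans jm (intpart_size mu).
have : Ordinal jn \in f @: [set: 'I_(size (parts la))] by rewrite imE inE.
by case/imsetP => a _ e; exists a; rewrite ?mem_enum // -e.
Qed.

Lemma nmerge_refl la : (0 < nmerge la la)%N.
Proof.
apply/card_gt0P; exists [ffun a => widen_ord (intpart_size la) a].
rewrite merges_sum; apply/forallP => j; apply/eqP.
case: (ltnP j (size (parts la))) => jl.
  rewrite (big_pred1 (Ordinal jl)) // => a; rewrite ffunE /=.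
  by apply/eqP/eqP => [/(congr1 val) /= e|->]; apply: ord_inj.
rewrite nth_default // big_pred0 // => a; rewrite ffunE; apply/negbTE.
by rewrite ord_eqE /= neq_ltn (leq_trans (ltn_ord a) jl).
Qed.

Variables (R : comNzRingType) (Q : R).

Definition nentry la mu : R := Q ^+ (size (parts la) - size (parts mu)) *+ nmerge la mu.

Lemma nentry0 la mu : (size (parts la) <= size (parts mu))%N -> la != mu -> nentry la mu = 0.
Proof.
move=> le ne; rewrite /nentry; case: (eqVneq (nmerge la mu) 0%N) => [->//|nz].
have e := nmerge_size nz; case/eqP: ne; apply: nmerge_eq => //.
by apply/eqP; rewrite eqn_leq le e.
Qed.

Lemma nentry_refl la : nentry la la = (nmerge la la)%:R.
Proof. by rewrite /nentry subnn expr0. Qed.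

(* Elimination along the number of parts; only natural numbers have to be inverted. *)
Lemma nentry_delta mu : exists m (c : {ffun intpart n -> R}), (0 < m)%N /\
  forall nu, \sum_la c la * nentry la nu = m%:R * (nu == mu)%:R.
Proof.
move: {2}(size (parts mu)).+1 (ltnSn (size (parts mu))) => k.
elim: k mu => // k IHk mu; rewrite ltnS => muk.
pose small nu := (size (parts nu) < size (parts mu))%N.
have ex nu : exists mc : nat * {ffun intpart n -> R}, (0 < mc.1)%N /\
    (small nu -> forall nu', \sum_la mc.2 la * nentry la nu' = mc.1%:R * (nu' == nu)%:R).
  case: (boolP (small nu)) => [sm|_]; last by exists (1%N, [ffun=> 0]).
  by have [m [c [m0 h]]] := IHk nu (leq_trans sm muk); exists (m, c).
have [F FP] := fin_all_exists ex.
(* Common multiples clear the denominators: [P' nu] times the multiplier of [nu] is [P]. *)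
pose P : nat := \prod_(nu | small nu) (F nu).1.
pose P' nu : nat := \prod_(nu' | small nu' && (nu' != nu)) (F nu').1.
(* [P] times the row of [mu], minus the combinations that cancel its entries at the partitions with
   fewer parts; only the diagonal entry is left. *)
exists (P * nmerge mu mu)%N, [ffun la => P%:R * (la == mu)%:R -
   \sum_(nu | small nu) (P' nu)%:R * nentry mu nu * (F nu).2 la]; split.
  rewrite muln_gt0 nmerge_refl andbT; apply: prodn_cond_gt0 => nu _.
  by have [] := FP nu.
move=> nu; under eq_bigr => la _ do rewrite ffunE mulrBl.
rewrite sumrB (bigD1 mu) //= eqxx mulr1 big1 ?addr0; last first.
  by move=> la /negPf ->; rewrite mulr0 mul0r.
under [X in _ - X]eq_bigr => la _ do rewrite mulr_suml.
rewrite exchange_big /=.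
have inner nu' : small nu' ->
    \sum_la (P' nu')%:R * nentry mu nu' * (F nu').2 la * nentry la nu =
    (P' nu')%:R * nentry mu nu' * ((F nu').1%:R * (nu == nu')%:R).
  move=> snu; rewrite -(FP nu').2 // mulr_sumr; apply: eq_bigr => la _.
  by rewrite mulrA.
rewrite [X in _ - X](eq_bigr _ inner).
have [snu|nsnu] := boolP (small nu).
  rewrite (bigD1 nu) //= eqxx mulr1 big1 ?addr0; last first.
    by move=> nu' /andP[_ ne]; rewrite eq_sym (negPf ne) !mulr0.
  rewrite (_ : nu == mu = false) ?mulr0; last first.
    by apply: contraTF snu => /eqP ->; rewrite /small ltnn.
  by rewrite mulrAC -natrM [(P' nu * _)%N]mulnC /P (bigD1 nu) //= subrr.
rewrite big1 ?subr0; last first.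
  move=> nu' sn; rewrite (_ : nu == nu' = false) ?mulr0 //.
  by apply: contraNF nsnu => /eqP ->.
case: eqVneq => [->|ne]; first by rewrite nentry_refl mulr1 natrM.
by rewrite nentry0 ?mulr0 // 1?eq_sym //; move: nsnu; rewrite /small -leqNgt.
Qed.

End MergeCount.

Section NormalizedElements.
Variables (R : comNzRingType) (Q : R) (n : nat).
Implicit Types la mu nu : intpart n.

Definition nelt la : hecke Q n := normalization la (e_natural Q n la).

Lemma nelt_central la : hcentral (nelt la).
Proof. exact/normalization_e_central/parts_pos/intpart_sum. Qed.

Lemma tcoef_nelt la mu : tcoef (nelt la) mu = nentry Q la mu.
Proof.
rewrite -[RHS]coef_normalization_e /tcoef.
apply: (trace_word (trace_central (nelt_central la))); rewrite ?rev_uniq ?enum_uniq //.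
by move=> i; rewrite mem_rev.
Qed.

End NormalizedElements.

(** * The Geck-Rouquier basis *)

Section BaseChange.
Variables (R S : comNzRingType) (f : {rmorphism R -> S}) (Q : R) (Q' : S) (n : nat).
Hypothesis fQ : f Q = Q'.
Implicit Types h : hecke Q n.
Local Notation spec := (@hspec R S f Q Q' n).

Let rel : hecke_relations (f Q) (@hgen S Q' n).
Proof. by rewrite fQ; apply: hgen_relations. Qed.

Lemma hspec_gen i : spec (hgen Q i) = hgen Q' i.
Proof. exact: hecke_lift_gen. Qed.
Lemma hspecM h h' : spec (h * h') = spec h * spec h'.
Proof. exact: hecke_liftM. Qed.
Lemma hspecD h h' : spec (h + h') = spec h + spec h'.
Proof. exact: hecke_liftD. Qed.
Lemma hspecZ a h : spec (a *: h) = f a *: spec h.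
Proof. exact: hecke_liftZ. Qed.
Lemma hspec1 : spec 1 = 1.
Proof. exact: hecke_lift1. Qed.
Lemma hspec0 : spec 0 = 0.
Proof. by rewrite -(scale0r 0) hspecZ rmorph0 scale0r. Qed.

Lemma hspec_word s : spec (hword Q s) = hword Q' s.
Proof.
elim: s => [|i s IHs]; first by rewrite !hword_nil hspec1.
by rewrite !hword_cons hspecM hspec_gen IHs.
Qed.

Lemma hspec_Tw w : spec (Tw Q w) = Tw Q' w.
Proof. by have [s rs <-] := redP w; rewrite !Tw_word // hspec_word. Qed.

Lemma coef_hspec h w : coef (spec h) w = f (coef h w).
Proof.
rewrite {1}(Tw_expand h) (big_morph spec hspecD hspec0) coef_sum.
rewrite (bigD1 w) //= hspecZ coefZ hspec_Tw coef_Tw eqxx mulr1 big1 ?addr0 // => u uw.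
by rewrite hspecZ coefZ hspec_Tw coef_Tw eq_sym (negPf uw) mulr0.
Qed.

Lemma hspec_central h : hcentral h -> hcentral (spec h).
Proof. by move=> hc; apply: central_gen => i; rewrite -hspec_gen -!hspecM hc. Qed.

Lemma tcoef_hspec h mu : tcoef (spec h) mu = f (tcoef h mu).
Proof. by rewrite !tcoefE coef_hspec. Qed.

End BaseChange.

Section ClassSum.
Variables (n : nat).
Implicit Types la mu nu : intpart n.

Lemma coef_class_sum (R : comNzRingType) (Q : R) la w :
  coef (class_sum Q la) w = (cycle_type w == la)%:R.
Proof.
rewrite /class_sum coef_sum big_mkcond (bigD1 w) //= hT_Tw coef_Tw eqxx big1 ?addr0.
  by case: eqP.
by move=> u uw; case: ifP => // _; rewrite hT_Tw coef_Tw eq_sym (negPf uw).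
Qed.

Lemma class_sum_central (R : comNzRingType) la : hcentral (class_sum (0 : R) la).
Proof.
apply: central_gen => i; apply: coef_inj => w.
rewrite coef_gen coef_genr !mul0r !if_same !addr0 !coef_class_sum.
by rewrite cycle_typeC.
Qed.

Lemma tcoef_class_sum (R : comNzRingType) (Q : R) la mu :
  tcoef (class_sum Q la) mu = (mu == la)%:R.
Proof.
rewrite tcoefE coef_class_sum cycle_typeV cycle_type_cox.
by rewrite (inj_eq (@parts_inj n)).
Qed.

End ClassSum.

Section GeckRouquier.
Variable n : nat.
Implicit Types la mu nu : intpart n.
Local Notation ZX := {poly int}.

(** Elimination gives a central [z] whose pairings are [m] times those wanted. The candidate [g]
    satisfies [m g = z], and [m] is cancellable in Z[X], so [g] is central with the right
    pairings. *)
Lemma geck_rouquier_exists mu : exists g, is_geck_rouquier mu g.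
Proof.
have [m [c [m0 cP]]] := nentry_delta ('X : ZX) mu.
pose z : hecke ('X : ZX) n := \sum_la c la *: nelt 'X la.
have zc : hcentral z by apply: hcentral_sum => la; apply/hcentralZ/nelt_central.
have zE nu : tcoef z nu = m%:R * (nu == mu)%:R.
  by rewrite -cP tcoef_sum; apply: eq_bigr => la _; rewrite tcoefZ tcoef_nelt.
have mI : injective (fun a : ZX => m%:R * a).
  have nz : m%:R != 0 :> ZX by rewrite -polyC_natr polyC_eq0 Num.Theory.pnatr_eq0 -lt0n.
  exact: (mulfI nz).
have ex (w : 'S_n) : exists e : {ffun intpart n -> ZX}, forall phi, trace phi ->
    phi (Tw ('X : ZX) w) = \sum_nu e nu * phi (hword 'X (gens n nu)).
  exact: trace_expand.
have [e eP] := fin_all_exists ex.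
pose g : hecke ('X : ZX) n := \sum_w e w mu *: Tw 'X w^-1%g.
have gE u : coef g u = e u^-1%g mu.
  rewrite coef_sum (bigD1 u^-1%g) //= coefZ coef_Tw invgK eqxx mulr1 big1 ?addr0 // => w wu.
  rewrite coefZ coef_Tw (_ : u == _ = false) ?mulr0 //.
  by apply: contraNF wu => /eqP ->; rewrite invgK.
have mg : m%:R *: g = z.
  apply: coef_inj => u; rewrite coefZ gE [RHS]coefE (eP _ _ (trace_central zc)).
  rewrite (bigD1 mu) //= -/(tcoef _ _) zE eqxx mulr1 big1 ?addr0 1?mulrC // => nu ne.
  by rewrite -/(tcoef _ _) zE (negPf ne) !mulr0.
have gc : hcentral g.
  move=> h; apply: coef_inj => u; apply: mI; rewrite -!coefZ scalerAl scalerAr mg.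
  by rewrite zc.
have gt nu : tcoef g nu = (nu == mu)%:R.
  by apply: mI; rewrite -tcoefZ mg zE.
exists g; split=> //.
  have f0 : horner_eval (0 : int) 'X = 0 by rewrite /horner_eval hornerX.
  (* At [Q = 0] both sides are central and have the same pairings with the words. *)
  apply: central_eq; [exact: hspec_central|exact: class_sum_central|move=> nu].
  rewrite tcoef_class_sum tcoef_hspec // gt.
  by case: eqP; rewrite ?rmorph1 ?rmorph0.
exists [ffun w => coef (g - class_sum 'X mu) w]; split.
  by rewrite {1}(Tw_expand (g - class_sum 'X mu)); apply: eq_bigr => w _; rewrite ffunE hT_Tw.
move=> w wmin; rewrite ffunE coefB coef_class_sum coefE.
have [nu [wt wP]] := min_trace wmin.
rewrite (wP _ _ _ (trace_central gc)) -/(tcoef _ _) gt wt (inj_eq (@parts_inj n)).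
by rewrite subrr.
Qed.

(** The pairing is a coefficient at an element of minimal length, where [g] and the class sum
    agree. *)
Lemma tcoef_geck_rouquier_univ mu g nu : is_geck_rouquier mu g -> tcoef g nu = (nu == mu)%:R.
Proof.
move=> [_ _ [c [gE cmin]]]; rewrite -(tcoef_class_sum ('X : ZX)).
apply/eqP; rewrite -subr_eq0 -tcoefB tcoefE gE coef_sum (bigD1 (cox nu)^-1%g) //=.
rewrite coefZ (cmin _ (min_cox nu)) mul0r add0r big1 // => w wn.
by rewrite coefZ hT_Tw coef_Tw eq_sym (negPf wn) mulr0.
Qed.

Lemma geck_rouquierP (R : comNzRingType) (Q : R) mu :
  hcentral (geck_rouquier Q mu) /\
  forall nu, tcoef (geck_rouquier Q mu) nu = (nu == mu)%:R.
Proof.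
have [g gP] := geck_rouquier_exists mu.
have uP : is_geck_rouquier mu (geck_rouquier_univ mu) := classical_sets.xgetPex 0 (ex_intro _ g gP).
pose f : {rmorphism ZX -> R} := horner_eval Q \o map_poly intr.
have fQ : f 'X = Q by rewrite /f /= /horner_eval map_polyX hornerX.
have E : geck_rouquier Q mu = hspec f Q (geck_rouquier_univ mu) by [].
rewrite E; split; first by apply: hspec_central => //; case: uP.
move=> nu; rewrite tcoef_hspec // (tcoef_geck_rouquier_univ nu uP).
by case: eqP; rewrite ?rmorph1 ?rmorph0.
Qed.

End GeckRouquier.

(** * The basis of the center and its transition matrix *)

Section Basis.
Variables (R : comUnitRingType) (Q : R) (n : nat).
Hypothesis natr_unit : forall m, (m.+1)%:R \is a @GRing.unit R.
Implicit Types la mu nu : intpart n.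

Lemma natr_unit_gt0 m : (0 < m)%N -> m%:R \is a @GRing.unit R.
Proof. by case: m. Qed.

(** The combinations from [nentry_delta], divided by their integers, are dual to the words; [z] is
    the sum of these dual elements weighted by its pairings. *)
Lemma nelt_span z : hcentral z ->
  exists c : {ffun intpart n -> R}, z = \sum_la c la *: nelt Q la.
Proof.
move=> zc; have [m /fin_all_exists[c cP]] := fin_all_exists (nentry_delta Q (n := n)).
exists [ffun la => \sum_mu tcoef z mu * (m mu)%:R^-1 * c mu la].
apply: central_eq => // [|nu]; first by apply: hcentral_sum => la; apply/hcentralZ/nelt_central.
rewrite tcoef_sum; under eq_bigr => la _ do rewrite tcoefZ tcoef_nelt ffunE mulr_suml.
have inner mu : \sum_la tcoef z mu * (m mu)%:R^-1 * c mu la * nentry Q la nu =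
    tcoef z mu * (m mu)%:R^-1 * ((m mu)%:R * (nu == mu)%:R).
  have [_ <-] := cP mu.
  by rewrite mulr_sumr; apply: eq_bigr => la _; rewrite mulrA.
rewrite exchange_big (eq_bigr _ (fun mu _ => inner mu)) (bigD1 nu) //= eqxx mulr1.
rewrite divrK ?natr_unit_gt0 ?(cP nu).1 // big1 ?addr0 // => mu ne.
by rewrite eq_sym (negPf ne) !mulr0.
Qed.

(** Induction from many parts to few: in the pairing with the word of [la], partitions with more
    parts have coefficient 0 already, and the others contribute 0 by triangularity except [la]
    itself. *)
Lemma nelt_free (c : intpart n -> R) : \sum_la c la *: nelt Q la = 0 -> forall la, c la = 0.
Proof.
move=> c0; have cE nu : \sum_la c la * nentry Q la nu = 0.
  under eq_bigr => la _ do rewrite -tcoef_nelt -tcoefZ.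
  by rewrite -tcoef_sum c0 -(scale0r 0) tcoefZ mul0r.
move=> la; move: {2}(n - size (parts la)).+1 (ltnSn (n - size (parts la))) => k.
elim: k la => // k IHk la lak; have := cE la.
rewrite (bigD1 la) //= big1 ?addr0 => [|mu ne].
  rewrite nentry_refl => /(canRL (mulrK (natr_unit_gt0 (nmerge_refl la)))).
  by rewrite mul0r.
have [le|lt] := leqP (size (parts mu)) (size (parts la)); first by rewrite nentry0 ?mulr0.
rewrite IHk ?mul0r //; move: lak lt; have := intpart_size mu; lia.
Qed.

Lemma nelt_basis : center_basis (@nelt R Q n).
Proof.
split=> [la|z zc]; first exact: nelt_central.
have [c cE] := nelt_span zc; exists c; split=> // c' c'E; apply/ffunP => la.
apply/eqP; rewrite -subr_eq0; apply/eqP.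
apply: (nelt_free (c := fun la => c la - c' la)).
under eq_bigr => mu _ do rewrite scalerBl.
by rewrite sumrB -cE -c'E subrr.
Qed.

Hypothesis Q_unit : Q \is a GRing.unit.

Lemma nelt_geck_rouquier la : nelt Q la = \sum_(mu : intpart n)
  (Q ^ ((size (parts la))%:Z - (size (parts mu))%:Z) * (p2m la mu)%:~R) *: geck_rouquier Q mu.
Proof.
apply: central_eq; first exact: nelt_central.
  by apply: hcentral_sum => mu; apply: hcentralZ; case: (geck_rouquierP Q mu).
move=> nu; rewrite tcoef_nelt tcoef_sum (bigD1 nu) //= tcoefZ (geck_rouquierP Q nu).2 eqxx mulr1.
rewrite big1 ?addr0 => [|mu ne]; last first.
  by rewrite tcoefZ (geck_rouquierP Q mu).2 eq_sym (negPf ne) mulr0.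
rewrite /nentry p2mE -/(nmerge la nu) -mulr_natr.
(* If no merging exists both sides vanish; otherwise the integer exponent is nonnegative and agrees
   with the truncated one. *)
case: (eqVneq (nmerge la nu) 0%N) => [->|nz]; first by rewrite !mulr0.
by rewrite subzn ?nmerge_size.
Qed.

(** Conjugation multiplies the entry by [Q] to the power [-(n - size la) + (n - size mu)]. *)
Lemma Qdiag_conj la mu :
  (invmx (Qdiag Q n) *m map_mx intr (P2M n) *m Qdiag Q n) (enum_rank la) (enum_rank mu) =
  Q ^ ((size (parts la))%:Z - (size (parts mu))%:Z) * (p2m la mu)%:~R.
Proof.
pose D' : 'M[R]_#|{: intpart n}| :=
  diag_mx (\row_a Q ^- (n - size (parts (enum_val a)))).
have -> : invmx (Qdiag Q n) = D'.
  have DD : D' *m Qdiag Q n = 1%:M.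
    apply/matrixP => a b; rewrite mul_diag_mx !mxE; case: eqP => [->|_]; last by rewrite mulr0.
    by rewrite !mulr1n mulVr // unitrX.
  have Du : Qdiag Q n \in unitmx by have [] := mulmx1_unit DD.
  by rewrite -[LHS]mul1mx -DD mulmxK.
rewrite mul_mx_diag mul_diag_mx !mxE !enum_rankK mulrC mulrA.
congr (_ * _); have := intpart_size la; have := intpart_size mu.
move: (size (parts la)) (size (parts mu)) => a b bn an.
rewrite exprnN exprnP -exprzDr //; congr (Q ^ _).
by lia.
Qed.

End Basis.

Theorem theorem12 (n : nat) (K : comUnitRingType) (q : K)
    (hn : (0 < n)%N) (hq : q \is a GRing.unit)
    (hQ : q - q^-1 \is a GRing.unit)
    (hrat : forall m : nat, (m.+1)%:R \is a @GRing.unit K) :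
  let Q : K := q - q^-1 in
  let N (la : intpart n) : hecke Q n := normalization la (e_natural Q n la) in
  let Gamma (mu : intpart n) : hecke Q n := geck_rouquier Q mu in
  let D : 'M[K]_#|{: intpart n}| := Qdiag Q n in
  let M : 'M[K]_#|{: intpart n}| := invmx D *m map_mx intr (P2M n) *m D in
  [/\ center_basis N,
      forall la : intpart n,
        N la = \sum_(mu : intpart n) M (enum_rank la) (enum_rank mu) *: Gamma mu
    & forall la : intpart n,
        N la = \sum_(mu : intpart n)
          (Q ^ ((size (parts la))%:Z - (size (parts mu))%:Z)
            * (p2m la mu)%:~R) *: Gamma mu].
Proof.
move=> Q N Gamma D M; split; first exact: nelt_basis.
  by move=> la; rewrite [LHS]nelt_geck_rouquier //; apply: eq_bigr => mu _; rewrite Qdiag_conj.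
by move=> la; apply: nelt_geck_rouquier.
Qed.
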